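(* Let $G$ be a second-countable compact group, let $A$ be a separable $C^*$-algebra, and let $\alpha\colon G\to\mathrm{Aut}(A)$ be an action with the Rokhlin property. Then the canonical inclusion $\iota\colon A^\alpha\to A$ is sequence algebra extendible. In particular, if $A$ is weakly semiprojective, then so is $A^\alpha$. If in addition $G$ is finite, then $A\rtimes_\alpha G$ is also weakly semiprojective.
   Context: Conventions: homomorphisms between $C^*$-algebras are $*$-homomorphisms, subalgebras are $C^*$-subalgebras; actions on $C^*$-algebras are point-norm continuous; $A^\alpha$ is the fixed point algebra and $A\rtimes_\alpha G$ the crossed product. Sequence algebras: for a $C^*$-algebra $A$, let $\ell^\infty(\mathbb{N},A)$ be the $C^*$-algebra of bounded sequences in $A$, $c_0(\mathbb{N},A)$ the ideal of norm-null sequences, $A_\infty=\ell^\infty(\mathbb{N},A)/c_0(\mathbb{N},A)$ with quotient map $\eta_A$; $A$ sits in $A_\infty$ as constant sequences. For a subalgebra $D\subseteq A$, let $\mathrm{Ann}(D,A_\infty)$ be the annihilator of $D$ in $A_\infty$, an ideal of $A_\infty\cap D'$, let $F(D,A)=(A_\infty\cap D')/\mathrm{Ann}(D,A_\infty)$ and let $\kappa_{D,A}$ be the quotient map. If $\alpha\colon G\to\mathrm{Aut}(A)$ is an action and $D$ is $\alpha$-invariant, entrywise application of $\alpha$ gives actions (not necessarily continuous) $\alpha^\infty$ on $\ell^\infty(\mathbb{N},A)$, $\alpha_\infty$ on $A_\infty$ and on $A_\infty\cap D'$, and $F(\alpha)$ on $F(D,A)$. Let $\ell^\infty_\alpha(\mathbb{N},A)$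 be the set of $a\in\ell^\infty(\mathbb{N},A)$ with $g\mapsto\alpha^\infty_g(a)$ norm continuous, $A_{\infty,\alpha}=\eta_A(\ell^\infty_\alpha(\mathbb{N},A))$ and $F_\alpha(D,A)=\kappa_{D,A}(A_{\infty,\alpha}\cap D')$. Rokhlin property: an action $\alpha\colon G\to\mathrm{Aut}(A)$ of a second-countable compact group $G$ on a $\sigma$-unital $C^*$-algebra $A$ has the Rokhlin property if for every separable $\alpha$-invariant subalgebra $D\subseteq A$ there is an equivariant unital homomorphism $\varphi\colon(C(G),\mathtt{Lt})\to(F_\alpha(D,A),F(\alpha))$, where $\mathtt{Lt}$ is the action of $G$ on $C(G)$ induced by left translation. Sequence algebra extendibility: a homomorphism $\theta\colon A\to B$ of $C^*$-algebras is sequence algebra extendible if for every $C^*$-algebra $E$ and every homomorphism $\varphi\colon A\to E_\infty$ there is a homomorphism $\rho\colon B\to E_\infty$ with $\varphi=\rho\circ\theta$. Weak semiprojectivity: a $C^*$-algebra $A$ is weakly semiprojective if for every $C^*$-algebra $B$ and every homomorphism $\psi\colon A\to B_\infty$ there is a homomorphism $\varphi\colon A\to\ell^\infty(\mathbb{N},B)$ with $\eta_B\circ\varphi=\psi$. *)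

(* Defs.v *)
From HB Require Import structures.
From mathcomp Require Import all_boot all_order all_algebra complex.
From mathcomp Require Import all_classical all_reals all_analysis.
Set Implicit Arguments.
Unset Strict Implicit.
Unset Printing Implicit Defensive.
Import Order.TTheory GRing.Theory Num.Theory.
Import numFieldNormedType.Exports.
Local Open Scope classical_set_scope.
Local Open Scope ring_scope.
Local Open Scope complex_scope.

(* MathComp's algebra structures are unital, C*-algebras need not be: the
   product below is therefore a separate operation.  Since the homomorphisms of
   C*-algebras are the *-homomorphisms, all notions phrased through
   homomorphisms only depend on the underlying complex *-algebras. *)
HB.mixin Record isStarAlgebra (R : realType) A of GRing.Lmodule R[i] A := {
  amul : A -> A -> A;
  star : A -> A;
  amulA : associative amul;
  amulDl : left_distributive amul +%R;
  amulDr : right_distributive amul +%R;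
  amulZl : forall (c : R[i]) (x y : A), amul (c *: x) y = c *: amul x y;
  amulZr : forall (c : R[i]) (x y : A), amul x (c *: y) = c *: amul x y;
  starK : involutive star;
  starD : {morph star : x y / x + y};
  starZ : forall (c : R[i]) (x : A), star (c *: x) = (c^*)%R *: star x;
  starM : forall x y : A, star (amul x y) = amul (star y) (star x)
}.

#[short(type="starAlgType")]
HB.structure Definition StarAlgebra (R : realType) :=
  {A of GRing.Lmodule R[i] A & isStarAlgebra R A}.

Infix "**" := amul (at level 40, left associativity) : ring_scope.

HB.mixin Record isCStarAlgebra (R : realType) A
    of CompleteNormedModule R[i] A & StarAlgebra R A := {
  norm_amul : forall x y : A, `|x ** y| <= `|x| * `|y|;
  cstar_identity : forall x : A, `|star x ** x| = `|x| ^+ 2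
}.

#[short(type="cstarAlgType")]
HB.structure Definition CStarAlgebra (R : realType) :=
  {A of CompleteNormedModule R[i] A & StarAlgebra R A & isCStarAlgebra R A}.

Definition star_hom (R : realType) (A B : starAlgType R) (f : A -> B) : Prop :=
  [/\ linear f, {morph f : x y / x ** y} & {morph f : x / star x}].

Section StarTheory.
Variables (R : realType) (A : starAlgType R).
Implicit Types x y z : A.

Lemma amul0l x : 0 ** x = 0.
Proof. by apply: (addrI (0 ** x)); rewrite -amulDl !addr0. Qed.

Lemma amul0r x : x ** 0 = 0.
Proof. by apply: (addrI (x ** 0)); rewrite -amulDr !addr0. Qed.

Lemma amulNl x y : (- x) ** y = - (x ** y).
Proof. by rewrite -scaleN1r amulZl scaleN1r. Qed.

Lemma amulNr x y : x ** (- y) = - (x ** y).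
Proof. by rewrite -scaleN1r amulZr scaleN1r. Qed.

Lemma amulBl x y z : (x - y) ** z = x ** z - y ** z.
Proof. by rewrite amulDl amulNl. Qed.

Lemma amulBr x y z : x ** (y - z) = x ** y - x ** z.
Proof. by rewrite amulDr amulNr. Qed.

Lemma star0 : star (0 : A) = 0.
Proof. by apply: (addrI (star (0 : A))); rewrite -starD !addr0. Qed.

Lemma starN x : star (- x) = - star x.
Proof. by rewrite -scaleN1r starZ rmorphN1 scaleN1r. Qed.

Lemma starB x y : star (x - y) = star x - star y.
Proof. by rewrite starD starN. Qed.

Lemma amul_suml (I : Type) (s : seq I) (F : I -> A) x :
  (\sum_(i <- s) F i) ** x = \sum_(i <- s) F i ** x.
Proof.
elim: s => [|i s IH]; first by rewrite !big_nil amul0l.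
by rewrite !big_cons amulDl IH.
Qed.

Lemma amul_sumr (I : Type) (s : seq I) (F : I -> A) x :
  x ** (\sum_(i <- s) F i) = \sum_(i <- s) x ** F i.
Proof.
elim: s => [|i s IH]; first by rewrite !big_nil amul0r.
by rewrite !big_cons amulDr IH.
Qed.

Lemma star_sum (I : Type) (s : seq I) (F : I -> A) :
  star (\sum_(i <- s) F i) = \sum_(i <- s) star (F i).
Proof.
elim: s => [|i s IH]; first by rewrite !big_nil star0.
by rewrite !big_cons starD IH.
Qed.

End StarTheory.

Section StarHomTheory.
Variables (R : realType) (A B : starAlgType R) (f : A -> B).
Hypothesis hf : star_hom f.

Lemma star_homP c x y : f (c *: x + y) = c *: f x + f y.
Proof. by case: hf => h _ _; exact: h. Qed.

Lemma star_homD : {morph f : x y / x + y}.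
Proof. by move=> x y; rewrite -[x]scale1r star_homP !scale1r. Qed.

Lemma star_hom0 : f 0 = 0.
Proof. by apply: (addrI (f 0)); rewrite -star_homD !addr0. Qed.

Lemma star_homZ c x : f (c *: x) = c *: f x.
Proof. by rewrite -[c *: x]addr0 star_homP star_hom0 addr0. Qed.

Lemma star_homN x : f (- x) = - f x.
Proof. by rewrite -scaleN1r star_homZ scaleN1r. Qed.

Lemma star_homB : {morph f : x y / x - y}.
Proof. by move=> x y; rewrite star_homD star_homN. Qed.

Lemma star_homM : {morph f : x y / x ** y}.
Proof. by case: hf. Qed.

Lemma star_homS : {morph f : x / star x}.
Proof. by case: hf. Qed.

Lemma star_hom_sum (I : Type) (s : seq I) (F : I -> A) :
  f (\sum_(i <- s) F i) = \sum_(i <- s) f (F i).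
Proof.
elim: s => [|i s IH]; first by rewrite !big_nil star_hom0.
by rewrite !big_cons star_homD IH.
Qed.

End StarHomTheory.

Section FunStar.
Variables (R : realType) (T : Type) (A : starAlgType R).
Implicit Types f g h : T -> A.

Definition fmul f g : T -> A := fun t => f t ** g t.
Definition fstar f : T -> A := fun t => star (f t).

Lemma fmulA : associative fmul.
Proof. by move=> f g h; apply/funext => t; rewrite /fmul amulA. Qed.
Lemma fmulDl : left_distributive fmul +%R.
Proof. by move=> f g h; apply/funext => t; rewrite /fmul [LHS]amulDl. Qed.
Lemma fmulDr : right_distributive fmul +%R.
Proof. by move=> f g h; apply/funext => t; rewrite /fmul [LHS]amulDr. Qed.
Lemma fmulZl (c : R[i]) f g : fmul (c *: f) g = c *: fmul f g.
Proof. by apply/funext => t; rewrite /fmul [LHS]amulZl. Qed.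
Lemma fmulZr (c : R[i]) f g : fmul f (c *: g) = c *: fmul f g.
Proof. by apply/funext => t; rewrite /fmul [LHS]amulZr. Qed.
Lemma fstarK : involutive fstar.
Proof. by move=> f; apply/funext => t; rewrite /fstar starK. Qed.
Lemma fstarD : {morph fstar : f g / f + g}.
Proof. by move=> f g; apply/funext => t; rewrite /fstar [LHS]starD. Qed.
Lemma fstarZ (c : R[i]) f : fstar (c *: f) = (c^*)%R *: fstar f.
Proof. by apply/funext => t; rewrite /fstar [LHS]starZ. Qed.
Lemma fstarM f g : fstar (fmul f g) = fmul (fstar g) (fstar f).
Proof. by apply/funext => t; rewrite /fstar /fmul starM. Qed.

HB.instance Definition _ := isStarAlgebra.Build R (T -> A)
  fmulA fmulDl fmulDr fmulZl fmulZr fstarK fstarD fstarZ fstarM.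

End FunStar.

Section ComplexStar.
Variable R : realType.
Implicit Types x y : (R[i])^o.

Lemma cmulZl (c : R[i]) x y : (c *: x : (R[i])^o) * y = c *: (x * y : (R[i])^o).
Proof. by rewrite /GRing.scale /= mulrA. Qed.
Lemma cmulZr (c : R[i]) x y : x * (c *: y : (R[i])^o) = c *: (x * y : (R[i])^o).
Proof. by rewrite /GRing.scale /= mulrCA. Qed.
Lemma conj_starK : involutive (fun x : (R[i])^o => (x^*)%R : (R[i])^o).
Proof. exact: conjCK. Qed.
Lemma conj_starD : {morph (fun x : (R[i])^o => (x^*)%R : (R[i])^o) : x y / x + y}.
Proof. by move=> x y; exact: rmorphD. Qed.
Lemma conj_starZ (c : R[i]) x :
  ((c *: x : (R[i])^o)^*)%R = (c^*)%R *: ((x^*)%R : (R[i])^o).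
Proof. by rewrite /GRing.scale /= rmorphM. Qed.
Lemma conj_starM x y : ((x * y)^*)%R = (y^*)%R * (x^*)%R :> (R[i])^o.
Proof. by rewrite rmorphM mulrC. Qed.

HB.instance Definition _ := isStarAlgebra.Build R (R[i])^o
  (@mulrA (R[i])^o) (@mulrDl (R[i])^o) (@mulrDr (R[i])^o) cmulZl cmulZr
  conj_starK conj_starD conj_starZ conj_starM.

End ComplexStar.

Record starSub (R : realType) (A : starAlgType R) := StarSub {
  subset_of :> A -> Prop;
  starSub0 : subset_of 0;
  starSubP : forall (c : R[i]) x y,
    subset_of x -> subset_of y -> subset_of (c *: x + y);
  starSubM : forall x y, subset_of x -> subset_of y -> subset_of (x ** y);
  starSubS : forall x, subset_of x -> subset_of (star x)
}.

Record subalg (R : realType) (A : starAlgType R) (S : starSub A) := Subalg {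
  subval :> A;
  subvalP : (fun x => `[< S x >]) subval
}.

Section SubStar.
Variables (R : realType) (A : starAlgType R) (S : starSub A).

HB.instance Definition _ := [isSub for @subval R A S].
HB.instance Definition _ := [Choice of subalg S by <:].

Lemma starSub_subsemimod : subsemimod_closed (fun x => `[< S x >]).
Proof.
split; first split.
- by apply/asboolP; exact: starSub0.
- move=> x y /asboolP Sx /asboolP Sy; apply/asboolP.
  by rewrite -[x]scale1r; exact: starSubP.
- move=> c x /asboolP Sx; apply/asboolP.
  by rewrite -[_ *: _]addr0; apply: starSubP => //; exact: starSub0.
Qed.

HB.instance Definition _ :=
  GRing.SubChoice_isSubLmodule.Build R[i] A _ (subalg S) starSub_subsemimod.

Lemma subalgP (x : subalg S) : S (val x).
Proof. by apply/asboolP; exact: subvalP. Qed.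

Definition mksub (x : A) (Sx : S x) : subalg S := Subalg (introT (asboolP _) Sx).

Definition smul (x y : subalg S) := mksub (starSubM (subalgP x) (subalgP y)).
Definition sstar (x : subalg S) := mksub (starSubS (subalgP x)).

Lemma smulA : associative smul.
Proof. by move=> x y z; apply/val_inj; exact: amulA. Qed.
Lemma smulDl : left_distributive smul +%R.
Proof. by move=> x y z; apply/val_inj; exact: amulDl. Qed.
Lemma smulDr : right_distributive smul +%R.
Proof. by move=> x y z; apply/val_inj; exact: amulDr. Qed.
Lemma smulZl (c : R[i]) x y : smul (c *: x) y = c *: smul x y.
Proof. by apply/val_inj; exact: amulZl. Qed.
Lemma smulZr (c : R[i]) x y : smul x (c *: y) = c *: smul x y.
Proof. by apply/val_inj; exact: amulZr. Qed.
Lemma sstarK : involutive sstar.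
Proof. by move=> x; apply/val_inj; exact: starK. Qed.
Lemma sstarD : {morph sstar : x y / x + y}.
Proof. by move=> x y; apply/val_inj; exact: starD. Qed.
Lemma sstarZ (c : R[i]) x : sstar (c *: x) = (c^*)%R *: sstar x.
Proof. by apply/val_inj; exact: starZ. Qed.
Lemma sstarM x y : sstar (smul x y) = smul (sstar y) (sstar x).
Proof. by apply/val_inj; exact: starM. Qed.

HB.instance Definition _ := isStarAlgebra.Build R (subalg S)
  smulA smulDl smulDr smulZl smulZr sstarK sstarD sstarZ sstarM.

Lemma subval_star_hom : star_hom (val : subalg S -> A).
Proof. by split=> // c x y; rewrite linearP. Qed.

End SubStar.

Record starIdeal (R : realType) (A : starAlgType R) := StarIdeal {
  ideal_mem :> A -> Prop;
  starIdeal0 : ideal_mem 0;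
  starIdealP : forall (c : R[i]) x y,
    ideal_mem x -> ideal_mem y -> ideal_mem (c *: x + y);
  starIdealMl : forall x y, ideal_mem y -> ideal_mem (x ** y);
  starIdealMr : forall x y, ideal_mem x -> ideal_mem (x ** y);
  starIdealS : forall x, ideal_mem x -> ideal_mem (star x)
}.

Section IdealEquiv.
Variables (R : realType) (A : starAlgType R) (I : starIdeal A).

Definition ideal_rel : rel A := fun x y => `[< I (x - y) >].

Lemma starIdealN x : I x -> I (- x).
Proof.
by move=> Ix; rewrite -[- x]addr0 -scaleN1r; apply: starIdealP => //; exact: starIdeal0.
Qed.

Lemma starIdealD x y : I x -> I y -> I (x + y).
Proof. by move=> Ix Iy; rewrite -[x]scale1r; exact: starIdealP. Qed.

Lemma starIdealB x y : I x -> I y -> I (x - y).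
Proof. by move=> Ix Iy; apply: starIdealD => //; exact: starIdealN. Qed.

Lemma ideal_rel_refl : reflexive ideal_rel.
Proof. by move=> x; apply/asboolP; rewrite subrr; exact: starIdeal0. Qed.

Lemma ideal_rel_sym : symmetric ideal_rel.
Proof.
by move=> x y; apply/asboolP/asboolP => h; rewrite -opprB; exact: starIdealN.
Qed.

Lemma ideal_rel_trans : transitive ideal_rel.
Proof.
move=> y x z /asboolP h1 /asboolP h2; apply/asboolP.
by rewrite -(subrK y x) -addrA; exact: starIdealD.
Qed.

Canonical ideal_equiv := EquivRel ideal_rel ideal_rel_refl ideal_rel_sym ideal_rel_trans.

End IdealEquiv.

Section QuotientStar.
Variables (R : realType) (A : starAlgType R) (I : starIdeal A).
Local Open Scope quotient_scope.

Definition quotient := {eq_quot (ideal_equiv I)}.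
HB.instance Definition _ := Choice.on quotient.
HB.instance Definition _ := EqQuotient.on quotient.

Definition qpi (x : A) : quotient := \pi_quotient x.
Definition qrep (x : quotient) : A := repr x.

Lemma qrepK : cancel qrep qpi.
Proof. exact: reprK. Qed.

Lemma qpiP x y : qpi x = qpi y <-> I (x - y).
Proof.
split=> [/eqquotP /asboolP //|h].
by apply/eqquotP; apply/asboolP.
Qed.

Lemma qrepP x : I (qrep (qpi x) - x).
Proof. by apply/qpiP; rewrite qrepK. Qed.

Definition qadd x y := qpi (qrep x + qrep y).
Definition qopp x := qpi (- qrep x).
Definition qscale (c : R[i]) x := qpi (c *: qrep x).
Definition qmul x y := qpi (qrep x ** qrep y).
Definition qstar x := qpi (star (qrep x)).

Lemma qaddE x y : qadd (qpi x) (qpi y) = qpi (x + y).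
Proof.
by apply/qpiP; rewrite opprD addrACA; apply: starIdealD; exact: qrepP.
Qed.
Lemma qoppE x : qopp (qpi x) = qpi (- x).
Proof. by apply/qpiP; rewrite -opprD; apply: starIdealN; exact: qrepP. Qed.
Lemma qscaleE c x : qscale c (qpi x) = qpi (c *: x).
Proof.
apply/qpiP; rewrite -scalerBr -[_ *: _]addr0.
by apply: starIdealP; [exact: qrepP|exact: starIdeal0].
Qed.
Lemma qmulE x y : qmul (qpi x) (qpi y) = qpi (x ** y).
Proof.
apply/qpiP.
rewrite -(subrK (qrep (qpi x) ** y) (_ ** _)) -addrA -amulBr -amulBl.
apply: starIdealD; first by apply: starIdealMl; exact: qrepP.
by apply: starIdealMr; exact: qrepP.
Qed.
Lemma qstarE x : qstar (qpi x) = qpi (star x).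
Proof. by apply/qpiP; rewrite -starB; apply: starIdealS; exact: qrepP. Qed.

Lemma qW (P : quotient -> Prop) : (forall x, P (qpi x)) -> forall x, P x.
Proof. by move=> h x; rewrite -(qrepK x). Qed.

Lemma qaddA : associative qadd.
Proof.
by elim/qW=> x; elim/qW=> y; elim/qW=> z; rewrite !qaddE addrA.
Qed.
Lemma qaddC : commutative qadd.
Proof. by elim/qW=> x; elim/qW=> y; rewrite !qaddE addrC. Qed.
Lemma qadd0 : left_id (qpi 0) qadd.
Proof. by elim/qW=> x; rewrite qaddE add0r. Qed.
Lemma qaddN : left_inverse (qpi 0) qopp qadd.
Proof. by elim/qW=> x; rewrite qoppE qaddE addNr. Qed.

HB.instance Definition _ := GRing.isZmodule.Build quotient qaddA qaddC qadd0 qaddN.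

Lemma qscaleA c d x : qscale c (qscale d x) = qscale (c * d) x.
Proof. by elim/qW: x => x; rewrite !qscaleE scalerA. Qed.
Lemma qscale1 : left_id 1 qscale.
Proof. by elim/qW=> x; rewrite qscaleE scale1r. Qed.
Lemma qscaleDr : right_distributive qscale +%R.
Proof.
move=> c; elim/qW=> x; elim/qW=> y.
by rewrite [qpi x + _]qaddE !qscaleE scalerDr -qaddE.
Qed.
Lemma qscaleDl x : {morph qscale^~ x : c d / c + d}.
Proof. by move=> c d; elim/qW: x => x; rewrite !qscaleE scalerDl -qaddE. Qed.

HB.instance Definition _ := GRing.Zmodule_isLmodule.Build R[i] quotient
  qscaleA qscale1 qscaleDr qscaleDl.

Lemma qmulA : associative qmul.
Proof.
by elim/qW=> x; elim/qW=> y; elim/qW=> z; rewrite !qmulE amulA.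
Qed.
Lemma qmulDl : left_distributive qmul +%R.
Proof.
elim/qW=> x; elim/qW=> y; elim/qW=> z.
by rewrite [_ + _]qaddE !qmulE amulDl -qaddE.
Qed.
Lemma qmulDr : right_distributive qmul +%R.
Proof.
elim/qW=> x; elim/qW=> y; elim/qW=> z.
by rewrite [qpi y + _]qaddE !qmulE amulDr -qaddE.
Qed.
Lemma qmulZl (c : R[i]) x y : qmul (c *: x) y = c *: qmul x y.
Proof.
by elim/qW: x => x; elim/qW: y => y; rewrite [c *: qpi x]qscaleE !qmulE amulZl -qscaleE.
Qed.
Lemma qmulZr (c : R[i]) x y : qmul x (c *: y) = c *: qmul x y.
Proof.
by elim/qW: x => x; elim/qW: y => y; rewrite [c *: qpi y]qscaleE !qmulE amulZr -qscaleE.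
Qed.
Lemma qstarK : involutive qstar.
Proof. by elim/qW=> x; rewrite !qstarE starK. Qed.
Lemma qstarD : {morph qstar : x y / x + y}.
Proof.
by elim/qW=> x; elim/qW=> y; rewrite [qpi x + qpi y]qaddE !qstarE starD -qaddE.
Qed.
Lemma qstarZ (c : R[i]) x : qstar (c *: x) = (c^*)%R *: qstar x.
Proof. by elim/qW: x => x; rewrite [c *: qpi x]qscaleE !qstarE starZ -qscaleE. Qed.
Lemma qstarM x y : qstar (qmul x y) = qmul (qstar y) (qstar x).
Proof.
by elim/qW: x => x; elim/qW: y => y; rewrite qmulE !qstarE qmulE starM.
Qed.

HB.instance Definition _ := isStarAlgebra.Build R quotient
  qmulA qmulDl qmulDr qmulZl qmulZr qstarK qstarD qstarZ qstarM.

Lemma qpi_star_hom : star_hom qpi.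
Proof.
split=> [c x y|x y|x].
- by rewrite [c *: qpi x]qscaleE [RHS]qaddE.
- exact: esym (qmulE x y).
- exact: esym (qstarE x).
Qed.

End QuotientStar.

Section QuotientMap.
Variables (R : realType) (A B : starAlgType R).
Variables (I : starIdeal A) (J : starIdeal B).

(* Meaningful when [f] is additive and maps [I] into [J], see [qmapE]. *)
Definition qmap (f : A -> B) (x : quotient I) : quotient J := qpi J (f (qrep x)).

Lemma qmapE (f : A -> B) : star_hom f -> (forall x, I x -> J (f x)) ->
  forall x, qmap f (qpi I x) = qpi J (f x).
Proof.
move=> hf IJ x; apply/qpiP; rewrite -(star_homB hf).
by apply: IJ; exact: qrepP.
Qed.

End QuotientMap.

Section Contractive.
Variable R : realType.

Section CStarTheory.
Variable A : cstarAlgType R.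
Implicit Types (x y : A) (u v : nat -> A).

Lemma cstar_identityr x : `|x ** star x| = `|star x| ^+ 2.
Proof. by rewrite -cstar_identity starK. Qed.

Lemma norm_star x : `|star x| = `|x|.
Proof.
have le y : `|y| <= `|star y|.
  have [->|y0] := eqVneq y 0; first by rewrite star0.
  have := norm_amul (star y) y; rewrite cstar_identity expr2.
  by rewrite ler_pM2r // normr_gt0.
by apply/eqP; rewrite eq_le le -{2}(starK x) le.
Qed.

Lemma cvg_star u x : u @ \oo --> x -> (fun n => star (u n)) @ \oo --> star x.
Proof.
move=> /cvgrPdist_lt ux; apply/cvgrPdist_lt => e e0.
by near=> n; rewrite -starB norm_star; near: n; exact: ux.
Unshelve. all: by end_near. Qed.

Lemma cvg_amul u v x y : u @ \oo --> x -> v @ \oo --> y ->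
  (fun n => u n ** v n) @ \oo --> x ** y.
Proof.
move=> /cvgrPdist_lt ux /cvgrPdist_lt vy; apply/cvgrPdist_lt => e e0.
have y1 : 0 < `|y| + 1 by rewrite ltr_wpDl.
have x1 : 0 < `|x| + 1 by rewrite ltr_wpDl.
have e2 : 0 < e / 2 by rewrite divr_gt0.
near=> n.
have un1 : `|x - u n| < 1 by near: n; exact: ux.
have un : `|x - u n| < e / 2 / (`|y| + 1).
  by near: n; apply: ux; rewrite divr_gt0.
have vn : `|y - v n| < e / 2 / (`|x| + 1).
  by near: n; apply: vy; rewrite divr_gt0.
have -> : x ** y - u n ** v n = (x - u n) ** y + u n ** (y - v n).
  by rewrite amulBl amulBr addrA subrK.
rewrite (le_lt_trans (ler_normD _ _))// [ltRHS](splitr e) ler_ltD//.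
  rewrite (le_trans (norm_amul _ _))// -(divfK (lt0r_neq0 y1) (e / 2)).
  by apply: ler_pM => //; [exact: ltW|rewrite lerDl].
rewrite (le_lt_trans (norm_amul _ _))// (@le_lt_trans _ _ ((`|x| + 1) * `|y - v n|))//.
  apply: ler_wpM2r => //; rewrite -[u n](subrK x) addrC.
  by rewrite (le_trans (ler_normD _ _))// lerD2l distrC ltW.
by rewrite mulrC -ltr_pdivlMr.
Unshelve. all: by end_near. Qed.


Lemma expr_small (r e : R[i]) : 0 <= r -> r < 1 -> 0 < e ->
  exists n, r ^+ n < e.
Proof.
move=> r0 r1 e0.
have rE : r = (complex.Re r)%:C.
  by apply/eqP; move: r0; case: r r1 => x y _; rewrite lecE eq_complex /= eqxx => /andP[].
have eE : e = (complex.Re e)%:C.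
  by apply/eqP; move: e0; case: e => x y; rewrite ltcE eq_complex /= eqxx => /andP[].
move: r0 r1 e0; rewrite rE eE; move: (complex.Re r) (complex.Re e) => x y.
rewrite ler0c => x0; rewrite !ltcE /= !eqxx /= => x1 y0.
have /cvgr_norm_lt/(_ y) : (GRing.exp x : R ^nat) @ \oo --> (0 : R).
  by apply: cvg_expr; rewrite ger0_norm.
rewrite normr0 => /(_ y0) [n _ /(_ n (leqnn n)) /=].
rewrite ger0_norm ?exprn_ge0// => h; exists n.
by rewrite -rmorphXn ltcR.
Qed.

Section SquareRoot.
Variables (a : A) (r : R[i]).
Hypotheses (aa : star a = a) (ar : `|a| <= r) (r1 : r < 1).

Fixpoint sqs n : A :=
  if n is m.+1 then 2^-1 *: (a ** a + sqs m ** sqs m) else 0.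

Let r0 : 0 <= r. Proof. exact: le_trans ar. Qed.

Lemma sqs_le n : `|sqs n| <= r.
Proof.
elim: n => [|n IH] /=; first by rewrite normr0.
rewrite normrZ ger0_norm ?invr_ge0// ler_pdivrMl//.
apply: (le_trans (ler_normD _ _)); rewrite mulr_natl mulr2n.
have le1 x : `|x| <= r -> `|x ** x| <= r.
  move=> xr; apply: (le_trans (norm_amul _ _)).
  rewrite -[leRHS]mulr1; apply: ler_pM => //.
  exact: le_trans (ltW r1).
by apply: lerD; exact: le1.
Qed.

Lemma sqs_contract m n : `|sqs m.+1 - sqs n.+1| <= r * `|sqs m - sqs n|.
Proof.
rewrite /= -scalerBr normrZ ger0_norm ?invr_ge0// ler_pdivrMl//.
rewrite opprD addrACA subrr add0r.
have -> : sqs m ** sqs m - sqs n ** sqs n =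
    sqs m ** (sqs m - sqs n) + (sqs m - sqs n) ** sqs n.
  by rewrite amulBl amulBr addrA subrK.
apply: (le_trans (ler_normD _ _)); rewrite mulr_natl mulr2n.
apply: lerD; apply: (le_trans (norm_amul _ _)).
  by apply: ler_wpM2r => //; exact: sqs_le.
by rewrite mulrC; apply: ler_wpM2r => //; exact: sqs_le.
Qed.

Lemma sqs_cauchy_le n k : `|sqs (n + k) - sqs n| <= r ^+ n.
Proof.
elim: n => [|n IH].
  by rewrite subr0 add0n expr0 (le_trans (sqs_le _))// ltW.
rewrite addSn exprS (le_trans (sqs_contract _ _))//.
exact: ler_wpM2l.
Qed.

Lemma sqs_cvg : cvg (sqs @ \oo).
Proof.
apply: cauchy_cvg; apply: cauchy_exP => e e0.
have [n ne] := expr_small r0 r1 e0.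
exists (sqs n); exists n => // m /= nm.
rewrite -ball_normE /= distrC -(subnKC nm).
exact: le_lt_trans (sqs_cauchy_le _ _) ne.
Qed.

Definition sqs_lim := lim (sqs @ \oo).

Lemma star_sqs n : star (sqs n) = sqs n.
Proof.
elim: n => [|n IH] /=; first exact: star0.
by rewrite starZ starD !starM aa IH fmorphV rmorph_nat.
Qed.

Lemma sqs_comm n : a ** sqs n = sqs n ** a.
Proof.
elim: n => [|n IH] /=; first by rewrite amul0l amul0r.
by rewrite amulZl amulZr amulDl amulDr !amulA IH -(amulA (sqs n)) IH !amulA.
Qed.

Lemma sqs_limit : exists b : A,
  [/\ star b = b, a ** b = b ** a & a ** a + b ** b = b + b].
Proof.
have sb : sqs @ \oo --> sqs_lim := sqs_cvg.
have uq := cvg_unique (@norm_hausdorff _ A).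
have ca : (fun=> a) @ \oo --> a by exact: cvg_cst.
exists sqs_lim; split.
- apply: (uq _ _ _ _ _ sb).
  by have := cvg_star sb; under eq_fun do rewrite star_sqs.
- apply: (uq _ _ _ _ (cvg_amul ca sb)).
  have h : (fun n => a ** sqs n) @ \oo --> sqs_lim ** a.
    by rewrite (funext sqs_comm); exact: cvg_amul.
  exact: h.
- have sb2 : (fun n => sqs n.+1 + sqs n.+1) @ \oo --> sqs_lim + sqs_lim.
    by apply: cvgD; rewrite cvg_shiftS.
  apply: (uq _ _ _ _ _ sb2).
  have -> : (fun n => sqs n.+1 + sqs n.+1) = (fun n => a ** a + sqs n ** sqs n).
    apply/funext => n /=; rewrite -scalerDl.
    by rewrite -[_^-1]mul1r -splitr scale1r.
  by apply: cvgD; exact: cvg_amul.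
Qed.

End SquareRoot.
End CStarTheory.

(* If [p] is self-adjoint and [p^2 + (1 - q)^2 = 1], then [p] is the real part
   of the unitary [p + i(1 - q)] of the unitization. *)
Lemma unitary_part_le1 (B : cstarAlgType R) (p q : B) :
  star p = p -> star q = q -> p ** q = q ** p ->
  p ** p + q ** q = q + q -> `|p| <= 1.
Proof.
move=> sp sq pq pqE.
pose L (c : R[i]) x := p ** x + c *: (x - q ** x).
have LE (c : R[i]) x : (c^*)%R = - c -> c * c = - 1 -> `|L c x| = `|x|.
  move=> cc c2; apply/eqP; rewrite -(@eqrXn2 _ 2)//; apply/eqP.
  rewrite -!cstar_identity; congr (`| _ |); rewrite /L.
  rewrite starD starZ starB !starM sp sq cc.
  rewrite amulDl !amulDr !amulZl !amulZr scalerA mulNr c2 opprK scale1r.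
  set z := star x.
  have -> : (z - z ** q) ** (p ** x) = z ** p ** (x - q ** x).
    rewrite amulBl amulBr !amulA; congr (_ - _).
    by rewrite -(amulA z q p) -pq !amulA.
  rewrite scaleNr addrA addrK.
  rewrite amulBl !amulBr !amulA.
  have -> : z ** p ** p ** x = z ** (q + q - q ** q) ** x.
    by rewrite -pqE addrK !amulA.
  rewrite amulBr amulDr amulBl amulDl !amulA.
  set t := z ** q ** x; set w := z ** q ** q ** x.
  rewrite opprB addrC -!addrA addKr.
  by rewrite [w + _]addrCA subrr addr0 addNr addr0.
have [->|p0] := eqVneq p 0; first by rewrite normr0.
have i2 : 'i * 'i = -1 :> R[i] by rewrite -expr2 sqrCi.
have h1 := LE 'i p (conjCi _) i2.
have h2 : `|L (- 'i) p| = `|p|.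
  by apply: LE; rewrite ?mulrNN// rmorphN /= conjCi.
have : `|L 'i p + L (- 'i) p| <= `|p| + `|p|.
  by rewrite -{1}h1 -h2; exact: ler_normD.
rewrite /L scaleNr addrACA subrr addr0 -mulr2n -scaler_nat normrZ normr_nat.
rewrite -{1}sp cstar_identity -mulr2n -[leRHS]mulr_natl ler_pM2l// expr2.
by rewrite -[leRHS]mul1r ler_pM2r// normr_gt0.
Qed.

Lemma star_hom_contractive (A B : cstarAlgType R) (f : A -> B) :
  star_hom f -> forall x, `|f x| <= `|x|.
Proof.
move=> hf.
have lt1 (a : A) : star a = a -> `|a| < 1 -> `|f a| <= 1.
  move=> aa a1; have [b [sb ab abE]] := sqs_limit aa (lexx _) a1.
  apply: (@unitary_part_le1 _ (f a) (f b)).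
  - by rewrite -(star_homS hf) aa.
  - by rewrite -(star_homS hf) sb.
  - by rewrite -!(star_homM hf) ab.
  - by rewrite -!(star_homM hf) -!(star_homD hf) abE.
have sa (a : A) : star a = a -> `|f a| <= `|a|.
  move=> aa; apply/ler_addgt0Pr => e e0.
  have t0 : 0 < `|a| + e by rewrite ltr_wpDl.
  have tE : `| (`|a| + e)^-1 | = (`|a| + e)^-1 by rewrite ger0_norm// invr_ge0 ltW.
  have := lt1 ((`|a| + e)^-1 *: a).
  rewrite starZ aa (star_homZ hf) !normrZ tE.
  rewrite ltr_pdivrMl// ler_pdivrMl// mulr1 ltrDl; apply=> //.
  by congr (_ *: _); apply/CrealP; rewrite realV ger0_real// ltW.
move=> x; rewrite -(@ler_pXn2r _ 2) ?nnegrE// -!cstar_identity.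
rewrite -(star_homS hf) -(star_homM hf); apply: sa.
by rewrite starM starK.
Qed.

End Contractive.

Lemma norm_cvg0_bounded (R : realType) (A B : cstarAlgType R)
    (u : nat -> A) (v : nat -> B) (M : R[i]) :
  (forall n, `|v n| <= M * `|u n|) -> 
  u @ \oo --> (0 : A) -> v @ \oo --> (0 : B).
Proof.
move=> vM u0; apply/cvgr0Pnorm_lt => e e0.
have M1 : 0 < `|M| + 1 by rewrite ltr_wpDl.
near=> n.
have un : `|u n| < e / (`|M| + 1).
  by near: n; move/cvgr0Pnorm_lt: u0; apply; rewrite divr_gt0.
rewrite (le_lt_trans (vM n))// (@le_lt_trans _ _ ((`|M| + 1) * `|u n|))//.
  have [->|un0] := eqVneq (u n) 0; first by rewrite normr0 !mulr0.
  have M0 : 0 <= M.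
    by have := le_trans (normr_ge0 _) (vM n); rewrite pmulr_lge0 ?normr_gt0.
  by apply: ler_wpM2r => //; rewrite ger0_norm// lerDl.
by rewrite mulrC -ltr_pdivlMr.
Unshelve. all: by end_near. Qed.

Section SequenceAlgebra.
Variables (R : realType) (A : cstarAlgType R).

Definition bounded_seq (a : nat -> A) : Prop :=
  exists M : R[i], forall n, `|a n| <= M.

Lemma bounded0 : bounded_seq 0.
Proof. by exists 0 => n; rewrite normr0. Qed.
Lemma boundedP (c : R[i]) x y :
  bounded_seq x -> bounded_seq y -> bounded_seq (c *: x + y).
Proof.
move=> [M xM] [N yN]; exists (`|c| * M + N) => n.
rewrite (le_trans (ler_normD _ _))// lerD// normrZ.
by apply: ler_wpM2l.
Qed.
Lemma boundedM (x y : nat -> A) :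
  bounded_seq x -> bounded_seq y -> bounded_seq (x ** y).
Proof.
move=> [M xM] [N yN]; exists (M * N) => n.
by rewrite (le_trans (norm_amul _ _))//; exact: ler_pM.
Qed.
Lemma boundedS (x : nat -> A) : bounded_seq x -> bounded_seq (star x).
Proof. by move=> [M xM]; exists M => n; rewrite [leLHS]norm_star. Qed.

Definition linf : starSub (nat -> A) :=
  StarSub bounded0 boundedP boundedM boundedS.

Definition null_seq (a : subalg linf) : Prop := val a @ \oo --> (0 : A).

Lemma null0 : null_seq 0.
Proof. exact: cvg_cst. Qed.
Lemma nullP (c : R[i]) x y : null_seq x -> null_seq y -> null_seq (c *: x + y).
Proof.
move=> x0 y0; rewrite /null_seq.
have -> : (0 : A) = c *: 0 + 0 by rewrite scaler0 addr0.
by apply: cvgD => //; apply: cvgZr.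
Qed.
Lemma nullMl x y : null_seq y -> null_seq (x ** y).
Proof.
have [M xM] := subalgP x.
apply: (@norm_cvg0_bounded _ _ _ _ _ M) => n.
by rewrite (le_trans (norm_amul _ _))//; exact: ler_wpM2r.
Qed.
Lemma nullMr x y : null_seq x -> null_seq (x ** y).
Proof.
have [M yM] := subalgP y.
apply: (@norm_cvg0_bounded _ _ _ _ _ M) => n.
by rewrite (le_trans (norm_amul _ _))// mulrC; exact: ler_wpM2r.
Qed.
Lemma nullS x : null_seq x -> null_seq (star x).
Proof. by move=> x0; rewrite /null_seq -(star0 A); exact: cvg_star. Qed.

Definition c0 : starIdeal (subalg linf) :=
  StarIdeal null0 nullP nullMl nullMr nullS.

Definition seqalg := quotient c0.
HB.instance Definition _ := StarAlgebra.on seqalg.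

Definition eta : subalg linf -> seqalg := qpi c0.

Lemma bounded_cst (a : A) : linf (fun=> a).
Proof. by exists `|a|. Qed.

Definition cst_seq (a : A) : seqalg := eta (mksub (bounded_cst a)).

Lemma eta_star_hom : star_hom eta.
Proof. exact: qpi_star_hom. Qed.

Lemma cst_seq_star_hom : star_hom cst_seq.
Proof.
split=> [c x y|x y|x].
- by rewrite /cst_seq -(star_homP eta_star_hom); congr eta; apply/val_inj.
- by rewrite /cst_seq -(star_homM eta_star_hom); congr eta; apply/val_inj.
- by rewrite /cst_seq -(star_homS eta_star_hom); congr eta; apply/val_inj.
Qed.

End SequenceAlgebra.

Section SequenceAlgebraMap.
Variables (R : realType) (A B : cstarAlgType R) (f : A -> B).
Hypothesis hf : star_hom f.

Lemma bounded_comp (a : subalg (linf A)) : linf B (fun n => f (val a n)).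
Proof.
have [M aM] := subalgP a; exists M => n.
exact: le_trans (star_hom_contractive hf _) (aM n).
Qed.

Definition linf_map (a : subalg (linf A)) : subalg (linf B) :=
  mksub (bounded_comp a).

Lemma linf_map_star_hom : star_hom linf_map.
Proof.
split=> [c x y|x y|x]; apply/val_inj/funext => n.
- exact: (star_homP hf).
- exact: (star_homM hf).
- exact: (star_homS hf).
Qed.

Lemma linf_map_c0 a : c0 A a -> c0 B (linf_map a).
Proof.
apply: (@norm_cvg0_bounded _ _ _ _ _ 1) => n.
by rewrite mul1r; exact: star_hom_contractive.
Qed.

Definition seqalg_map : seqalg A -> seqalg B := qmap (c0 B) linf_map.

Lemma seqalg_mapE a : seqalg_map (eta a) = eta (linf_map a).
Proof. exact: (qmapE linf_map_star_hom linf_map_c0). Qed.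

Lemma seqalg_map_cst a : seqalg_map (cst_seq a) = cst_seq (f a).
Proof. by rewrite seqalg_mapE; congr eta; exact/val_inj. Qed.

Lemma seqalg_map_star_hom : star_hom seqalg_map.
Proof.
have hl := linf_map_star_hom; have he := @eta_star_hom R B.
have ha := @eta_star_hom R A.
split=> [c x y|x y|x].
- rewrite -(qrepK x) -(qrepK y) -(star_homP ha) !seqalg_mapE.
  by rewrite (star_homP hl) (star_homP he).
- rewrite -(qrepK x) -(qrepK y) -(star_homM ha) !seqalg_mapE.
  by rewrite (star_homM hl) (star_homM he).
- rewrite -(qrepK x) -(star_homS ha) !seqalg_mapE.
  by rewrite (star_homS hl) (star_homS he).
Qed.

End SequenceAlgebraMap.

Section CentralSequenceAlgebra.
Variables (R : realType) (A : cstarAlgType R) (D : starSub A).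

Definition in_commutant (x : seqalg A) : Prop :=
  forall d, D d -> x ** cst_seq d = cst_seq d ** x.

Lemma commutant0 : in_commutant 0.
Proof. by move=> d _; rewrite amul0l amul0r. Qed.
Lemma commutantP (c : R[i]) x y :
  in_commutant x -> in_commutant y -> in_commutant (c *: x + y).
Proof.
move=> hx hy d Dd.
by rewrite amulDl amulDr amulZl amulZr hx// hy.
Qed.
Lemma commutantM x y : in_commutant x -> in_commutant y -> in_commutant (x ** y).
Proof. by move=> hx hy d Dd; rewrite -amulA hy// !amulA hx. Qed.
Lemma commutantS x : in_commutant x -> in_commutant (star x).
Proof.
move=> hx d Dd; have := congr1 star (hx _ (starSubS Dd)).
by rewrite !starM -(star_homS (@cst_seq_star_hom R A)) starK.
Qed.

Definition commutant : starSub (seqalg A) :=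
  StarSub commutant0 commutantP commutantM commutantS.

Definition annihilates (x : subalg commutant) : Prop :=
  forall d, D d -> val x ** cst_seq d = 0 /\ cst_seq d ** val x = 0.

Lemma ann0 : annihilates 0.
Proof. by move=> d _; rewrite [val 0]/= amul0l amul0r. Qed.
Lemma annP (c : R[i]) x y : annihilates x -> annihilates y -> annihilates (c *: x + y).
Proof.
move=> hx hy d Dd; have [x1 x2] := hx _ Dd; have [y1 y2] := hy _ Dd.
rewrite linearP amulDl amulDr amulZl amulZr.
by rewrite [X in X *: _ + _]/= x1 x2 y1 y2 scaler0 addr0.
Qed.
Lemma annMl x y : annihilates y -> annihilates (x ** y).
Proof.
move=> hy d Dd; have [y1 y2] := hy _ Dd.
have E : val (x ** y) = val x ** val y by [].
rewrite E amulA -(subalgP x _ Dd) -!amulA y1 y2.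
by rewrite amul0r.
Qed.
Lemma annMr x y : annihilates x -> annihilates (x ** y).
Proof.
move=> hx d Dd; have [x1 x2] := hx _ Dd.
have E : val (x ** y) = val x ** val y by [].
by rewrite E -amulA (subalgP y _ Dd) !amulA x1 x2 amul0l.
Qed.
Lemma annS x : annihilates x -> annihilates (star x).
Proof.
move=> hx d Dd; have [x1 x2] := hx _ (starSubS Dd).
have E : val (star x) = star (val x) by [].
rewrite E -[cst_seq d]starK -!starM -(star_homS (@cst_seq_star_hom R A)).
by rewrite x1 x2 star0.
Qed.

Definition Ann : starIdeal (subalg commutant) :=
  StarIdeal ann0 annP annMl annMr annS.

Definition Falg := quotient Ann.
HB.instance Definition _ := StarAlgebra.on Falg.

Definition kappa : subalg commutant -> Falg := qpi Ann.

End CentralSequenceAlgebra.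

HB.mixin Record isTopologicalGroup G of Group G & Topological G := {
  mulg_continuous : continuous (fun x : G * G => (x.1 * x.2)%g);
  invg_continuous : continuous (fun x : G => (x^-1)%g)
}.

#[short(type="topologicalGroupType")]
HB.structure Definition TopologicalGroup :=
  {G of Group G & Topological G & isTopologicalGroup G}.

Section ContinuousFunctions.
Variables (R : realType) (G : topologicalGroupType).

Definition continuous_fun (f : G -> (R[i])^o) : Prop := continuous f.

Lemma continuous_fun0 : continuous_fun 0.
Proof. exact: cst_continuous. Qed.
Lemma continuous_funP (c : R[i]) (f g : G -> (R[i])^o) :
  continuous_fun f -> continuous_fun g -> continuous_fun (c *: f + g).
Proof.
move=> cf cg x; apply: cvgD; last exact: cg.
by apply: cvgZr; exact: cf.
Qed.
Lemma continuous_funM (f g : G -> (R[i])^o) :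
  continuous_fun f -> continuous_fun g -> continuous_fun (f ** g).
Proof. by move=> cf cg x; apply: cvgM; [exact: cf|exact: cg]. Qed.
Lemma continuous_funS (f : G -> (R[i])^o) :
  continuous_fun f -> continuous_fun (star f).
Proof.
move=> cf x; apply/cvgrPdist_lt => e e0; near=> y.
rewrite /star /= -rmorphB norm_conjC; near: y.
by move/cvgrPdist_lt: (cf x); apply.
Unshelve. all: by end_near. Qed.

Definition CG : starSub (G -> (R[i])^o) :=
  StarSub continuous_fun0 continuous_funP continuous_funM continuous_funS.

Lemma continuous_cst1 : CG (fun=> 1).
Proof. exact: cst_continuous. Qed.

Definition CG1 : subalg CG := mksub continuous_cst1.

Lemma continuous_left_translation (g : G) (f : subalg CG) :
  CG (fun h => val f (g^-1 * h)%g).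
Proof.
have cf : continuous (val f) := subalgP f.
move=> x; apply: (@continuous_comp _ _ _ (fun h : G => (g^-1 * h)%g) (val f)).
  apply: (@continuous_comp _ _ _ (fun h : G => ((g^-1)%g, h)) (fun p => (p.1 * p.2)%g)).
    by apply: cvg_pair; [exact: cvg_cst|exact: cvg_id].
  exact: mulg_continuous.
exact: cf.
Qed.

Definition left_translate (g : G) (f : subalg CG) : subalg CG :=
  mksub (@continuous_left_translation g f).

End ContinuousFunctions.

(* Each [act g] is an automorphism: it is a *-homomorphism with inverse
   [act g^-1]. *)
Record action (R : realType) (G : topologicalGroupType) (A : cstarAlgType R) :=
  Action {
    act :> G -> A -> A;
    act_star_hom : forall g, star_hom (act g);
    act1 : forall a, act 1%g a = a;
    actM : forall g h a, act (g * h)%g a = act g (act h a);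
    act_continuous : forall a, continuous (fun g => act g a)
  }.

Section Actions.
Variables (R : realType) (G : topologicalGroupType) (A : cstarAlgType R).
Variable alpha : action G A.

Definition is_fixed (a : A) : Prop := forall g, alpha g a = a.

Lemma fixed0 : is_fixed 0.
Proof. by move=> g; exact: (star_hom0 (act_star_hom alpha g)). Qed.
Lemma fixedP (c : R[i]) x y : is_fixed x -> is_fixed y -> is_fixed (c *: x + y).
Proof.
by move=> hx hy g; rewrite (star_homP (act_star_hom alpha g)) hx hy.
Qed.
Lemma fixedM x y : is_fixed x -> is_fixed y -> is_fixed (x ** y).
Proof.
by move=> hx hy g; rewrite (star_homM (act_star_hom alpha g)) hx hy.
Qed.
Lemma fixedS x : is_fixed x -> is_fixed (star x).
Proof. by move=> hx g; rewrite (star_homS (act_star_hom alpha g)) hx. Qed.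

Definition fixed_points : starSub A := StarSub fixed0 fixedP fixedM fixedS.

Definition alpha_inf (g : G) : seqalg A -> seqalg A :=
  seqalg_map (act_star_hom alpha g).

(* Norm continuity of the orbit map of a bounded sequence: the topology of the
   supremum norm is that of uniform convergence. *)
Definition linf_alpha (a : subalg (linf A)) : Prop :=
  continuous (fun g : G => (fun n => alpha g (val a n)) : {uniform nat -> A}).

Definition seqalg_alpha (x : seqalg A) : Prop :=
  exists2 a, linf_alpha a & eta a = x.

Section Invariant.
Variable D : starSub A.
Hypothesis Dinv : forall g d, D d -> D (alpha g d).

Lemma commutant_alpha_inf g (x : subalg (commutant D)) :
  commutant D (alpha_inf g (val x)).
Proof.
move=> d Dd.
have -> : cst_seq d = alpha_inf g (cst_seq (alpha (g^-1)%g d)).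
  by rewrite /alpha_inf seqalg_map_cst -actM mulgV act1.
have hi : star_hom (alpha_inf g) := seqalg_map_star_hom (act_star_hom alpha g).
rewrite -!(star_homM hi); congr (alpha_inf _ _).
by apply: (subalgP x); exact: Dinv.
Qed.

Definition alpha_commutant (g : G) (x : subalg (commutant D)) :
  subalg (commutant D) := mksub (commutant_alpha_inf g x).

Definition F_act (g : G) : Falg D -> Falg D :=
  qmap (Ann D) (alpha_commutant g).

Lemma F_actE g x : F_act g (kappa x) = kappa (alpha_commutant g x).
Proof.
have hi : star_hom (alpha_inf g) := seqalg_map_star_hom (act_star_hom alpha g).
apply: qmapE => [|y hy d Dd].
  split=> [c y z|y z|y]; apply/val_inj.
  - exact: (star_homP hi).
  - exact: (star_homM hi).
  - exact: (star_homS hi).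
have -> : cst_seq d = alpha_inf g (cst_seq (alpha (g^-1)%g d)).
  by rewrite /alpha_inf seqalg_map_cst -actM mulgV act1.
have [y1 y2] := hy _ (Dinv (g^-1)%g Dd).
by rewrite -!(star_homM hi) y1 y2 (star_hom0 hi).
Qed.

End Invariant.

Definition Falg_alpha (D : starSub A) (y : Falg D) : Prop :=
  exists2 x : subalg (commutant D), seqalg_alpha (val x) & kappa x = y.

End Actions.

(* For a finite group, the universal completion of C_c(G, A) that defines the
   crossed product is C_c(G, A) itself: all the functions G -> A, with the
   twisted convolution and involution. The function supported at [g] with value
   [a] is the element usually written [a u_g]. *)
Definition crossed_product (R : realType) (G : topologicalGroupType)
    (A : cstarAlgType R) (alpha : action G A)
    (finG : finite_set [set: G]) : Type := G -> A.

Section CrossedProduct.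
Variables (R : realType) (G : topologicalGroupType) (A : cstarAlgType R).
Variables (alpha : action G A) (finG : finite_set [set: G]).
Local Notation P := (crossed_product alpha finG).
Implicit Types f h k : P.

HB.instance Definition _ := GRing.Lmodule.copy P (G -> A).

Definition convolution f h : P :=
  fun s => \sum_(t \in [set: G]) f t ** alpha t (h (t^-1 * s)%g).
Definition convolution_star f : P := fun s => alpha s (star (f (s^-1)%g)).

Lemma sum_groupE (F : G -> A) :
  \sum_(t \in [set: G]) F t = \sum_(t <- finmap.enum_fset (fset_set [set: G])) F t.
Proof. exact: fsbig_finite. Qed.

Lemma eq_sum_group (F H : G -> A) : F =1 H ->
  \sum_(t \in [set: G]) F t = \sum_(t \in [set: G]) H t.
Proof. by move=> /funext ->. Qed.

Lemma reindex_sum_group (F : G -> A) g :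
  \sum_(t \in [set: G]) F t = \sum_(t \in [set: G]) F (g * t)%g.
Proof.
apply: (@reindex_fsbigT _ _ _ _ _ (fun t => (g * t)%g)).
by exists (fun t => (g^-1 * t)%g) => t; rewrite mulgA ?mulVg ?mulgV mul1g.
Qed.

Lemma amul_sum_groupl (F : G -> A) x :
  (\sum_(t \in [set: G]) F t) ** x = \sum_(t \in [set: G]) F t ** x.
Proof. by rewrite !sum_groupE amul_suml. Qed.

Lemma amul_sum_groupr (F : G -> A) x :
  x ** (\sum_(t \in [set: G]) F t) = \sum_(t \in [set: G]) x ** F t.
Proof. by rewrite !sum_groupE amul_sumr. Qed.

Lemma act_sum_group (F : G -> A) g :
  alpha g (\sum_(t \in [set: G]) F t) = \sum_(t \in [set: G]) alpha g (F t).
Proof. by rewrite !sum_groupE (star_hom_sum (act_star_hom alpha g)). Qed.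

Lemma star_sum_group (F : G -> A) :
  star (\sum_(t \in [set: G]) F t) = \sum_(t \in [set: G]) star (F t).
Proof. by rewrite !sum_groupE star_sum. Qed.

Lemma sum_groupD (F H : G -> A) : \sum_(t \in [set: G]) (F t + H t) =
  \sum_(t \in [set: G]) F t + \sum_(t \in [set: G]) H t.
Proof. by rewrite !sum_groupE big_split. Qed.

Lemma sum_groupZ c (F : G -> A) :
  \sum_(t \in [set: G]) c *: F t = c *: \sum_(t \in [set: G]) F t.
Proof. by rewrite !sum_groupE scaler_sumr. Qed.

Lemma convolutionA : associative convolution.
Proof.
move=> f h k; apply/funext => s; rewrite /convolution.
under eq_sum_group do rewrite act_sum_group amul_sum_groupr.
under [RHS]eq_sum_group do rewrite amul_sum_groupl.
rewrite [RHS]exchange_fsbig//; apply: eq_sum_group => r.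
rewrite [RHS](reindex_sum_group _ r); apply: eq_sum_group => t.
rewrite (star_homM (act_star_hom alpha r)) amulA -actM.
by rewrite !mulgA mulVg mul1g invgM.
Qed.
Lemma convolutionDl : left_distributive convolution +%R.
Proof.
move=> f h k; apply/funext => s.
rewrite -[RHS](sum_groupD (fun t => f t ** _) (fun t => h t ** _)).
by apply: eq_sum_group => t; rewrite -amulDl.
Qed.
Lemma convolutionDr : right_distributive convolution +%R.
Proof.
move=> f h k; apply/funext => s.
rewrite -[RHS](sum_groupD (fun t => f t ** _) (fun t => f t ** _)).
by apply: eq_sum_group => t; rewrite -amulDr -(star_homD (act_star_hom alpha t)).
Qed.
Lemma convolutionZl (c : R[i]) f h : convolution (c *: f) h = c *: convolution f h.
Proof.
apply/funext => s; rewrite -[RHS](sum_groupZ c (fun t => f t ** _)).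
by apply: eq_sum_group => t; rewrite -amulZl.
Qed.
Lemma convolutionZr (c : R[i]) f h : convolution f (c *: h) = c *: convolution f h.
Proof.
apply/funext => s; rewrite -[RHS](sum_groupZ c (fun t => f t ** _)).
by apply: eq_sum_group => t; rewrite -amulZr -(star_homZ (act_star_hom alpha t)).
Qed.
Lemma convolution_starK : involutive convolution_star.
Proof.
move=> f; apply/funext => s; rewrite /convolution_star invgK.
by rewrite -(star_homS (act_star_hom alpha _)) starK -actM mulgV act1.
Qed.
Lemma convolution_starD : {morph convolution_star : f h / f + h}.
Proof.
move=> f h; apply/funext => s.
apply: etrans (star_homD (act_star_hom alpha s) _ _).
by congr (alpha s _); exact: starD.
Qed.
Lemma convolution_starZ (c : R[i]) f :
  convolution_star (c *: f) = (c^*)%R *: convolution_star f.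
Proof.
apply/funext => s; apply: etrans (star_homZ (act_star_hom alpha s) _ _).
by congr (alpha s _); exact: starZ.
Qed.
Lemma convolution_starM f h : convolution_star (convolution f h) =
  convolution (convolution_star h) (convolution_star f).
Proof.
apply/funext => s; rewrite /convolution_star /convolution.
rewrite star_sum_group act_sum_group [RHS](reindex_sum_group _ s).
apply: eq_sum_group => t; rewrite starM (star_homM (act_star_hom alpha s)).
rewrite -(star_homS (act_star_hom alpha t)) -!actM invgM.
by rewrite mulgVK mulgK invgK.
Qed.

HB.instance Definition _ := isStarAlgebra.Build R P
  convolutionA convolutionDl convolutionDr convolutionZl convolutionZr
  convolution_starK convolution_starD convolution_starZ convolution_starM.

End CrossedProduct.

Section Properties.
Variable R : realType.

Definition separable_set (A : cstarAlgType R) (D : set A) : Prop :=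
  exists2 Q : set A, countable Q & Q `<=` D /\ D `<=` closure Q.

(* The closed *-subalgebras [D : starSub A] are the C*-subalgebras of [A]. The
   unit of C(G) is required to be sent to a unit of F_act(D, A). *)
Definition Rokhlin_property (G : topologicalGroupType) (A : cstarAlgType R)
    (alpha : action G A) : Prop :=
  forall D : starSub A, closed [set d | D d] -> separable_set [set d | D d] ->
  forall Dinv : (forall g d, D d -> D (alpha g d)),
  exists phi : subalg (CG R G) -> Falg D,
    [/\ star_hom phi,
        forall f, Falg_alpha alpha (phi f),
        forall y, Falg_alpha alpha y ->
          phi (CG1 R G) ** y = y /\ y ** phi (CG1 R G) = y
      & forall g f, phi (left_translate g f) = F_act Dinv g (phi f)].

Definition seqalg_extendible (A B : starAlgType R) (theta : A -> B) : Prop :=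
  forall (E : cstarAlgType R) (phi : A -> seqalg E), star_hom phi ->
  exists2 rho : B -> seqalg E, star_hom rho & phi = rho \o theta.

Definition weakly_semiprojective (A : starAlgType R) : Prop :=
  forall (B : cstarAlgType R) (psi : A -> seqalg B), star_hom psi ->
  exists2 phi : A -> subalg (linf B), star_hom phi & @eta R B \o phi = psi.

End Properties.

(* Main.v *)
Require Import Defs.
From HB Require Import structures.
From mathcomp Require Import all_boot all_order all_algebra complex.
From mathcomp Require Import all_classical all_reals all_analysis.
From mathcomp Require Import ring lra zify.

(* Extendibility.  Given x in A, approximate the orbit map g |-> alpha_g(x) by
   sums of f_i (x) alpha_{g_i}(x) over a partition of unity f_i of G, and map
   them to the sequence algebra A_oo of A by the Rokhlin homomorphism on C(G).
   Equivariance makes the images almost invariant, so that averaging over G moves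
   them into (A^alpha)_oo; the limits form a homomorphism A -> (A^alpha)_oo that
   restricts to the constant sequences on A^alpha.  Composed with phi_oo it takes
   values in (E_oo)_oo, and reindexing along a diagonal brings it back to E_oo.

   Crossed products.  If G is finite, the point masses of C(G) give e_g in A_oo.
   For a homomorphism psi from the crossed product to E_oo, the images V_g of
   e_g u_g after a reindexing satisfy V_g^* V_h rho(a) = delta_{gh} V_1 rho(a) for the
   homomorphism rho(a) = V_1 psi(a), and psi(a u_g) is the sum over h of
   V_h rho(alpha_{h^-1}(a)) V_{g^-1 h}^*: psi is the regular representation
   amplified by the matrix units V_g V_h^*.  These lift exactly to l^oo(E), in
   the form of xi_g with xi_g^* xi_h = delta_{gh} c^2, so that matrices over the
   hereditary subalgebra generated by c act in l^oo(E).  Weak semiprojectivity of A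
   is then applied to rho, seen as a homomorphism into the sequence algebra of that
   hereditary subalgebra. *)

Set Implicit Arguments.
Unset Strict Implicit.
Unset Printing Implicit Defensive.
Import Order.TTheory GRing.Theory Num.Theory.
Import numFieldNormedType.Exports.
Local Open Scope classical_set_scope.
Local Open Scope ring_scope.
Local Open Scope complex_scope.

(** Three obstacles shape the argument. The relations of a Rokhlin lift hold only after
    multiplication by elements of A, so no norm estimate on C(G) (x) A comes for free; it is
    obtained from high powers, and the factor 2 lost there is harmless because only limits matter.
    Invariance in A_oo holds for each g only asymptotically, at a rate depending on g. It becomes
    uniform in g because G is compact and the approximants have lifts with norm-continuous orbits;
    only then can the entries be averaged one by one. Weak semiprojectivity lifts into l^oo of one
    fixed algebra, while lifts of the V_g to l^oo(E) change with the coordinate. The fixed algebra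
    is therefore a hereditary subalgebra of l^oo(E) itself: a sequence in E is replaced by the
    sequence of its coordinate truncations, and the lift is read off along the diagonal. The model
    for xi_g is the column t e_{g1} in the cone over a matrix algebra: the weight t is what allows
    an exact lift. Passing from c b c to xi_g b xi_h^* removes it again, up to the scalar by which c
    acts on the image of rho. *)

Local Notation eta := Defs.eta.

(** * Real-valued norms *)

Section RealNorm.
Variable R : realType.

Lemma ge0_complexE (z : R[i]) : 0 <= z -> z = (complex.Re z)%:C.
Proof. by case: z => x y; rewrite lecE /= => /andP[/eqP -> _]. Qed.

Lemma ltr0C (e : R) : (0 < e%:C) = (0 < e).
Proof. exact: (ltcR 0 e). Qed.

Variable V : normedModType R[i].
Implicit Types x y : V.

Definition nm x : R := complex.Re `|x|.

Lemma normE x : `|x| = (nm x)%:C.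
Proof. exact: ge0_complexE. Qed.

Lemma nm_ge0 x : 0 <= nm x.
Proof. by rewrite -ler0c -normE. Qed.

Lemma nm0 : nm 0 = 0.
Proof. by rewrite /nm normr0. Qed.

Lemma nm_eq0 x : nm x = 0 -> x = 0.
Proof. by move=> h; apply/normr0_eq0; rewrite normE h. Qed.

Lemma nmD x y : nm (x + y) <= nm x + nm y.
Proof. by rewrite -lecR rmorphD /= -!normE ler_normD. Qed.

Lemma nmN x : nm (- x) = nm x.
Proof. by rewrite /nm normrN. Qed.

Lemma nm_sym x y : nm (x - y) = nm (y - x).
Proof. by rewrite -nmN opprB. Qed.

Lemma nmB x y : nm (x - y) <= nm x + nm y.
Proof. by rewrite -(nmN y) nmD. Qed.

Lemma nm_tri y x z : nm (x - z) <= nm (x - y) + nm (y - z).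
Proof. by rewrite -[x - z](subrKA y) nmD. Qed.

Lemma nm_le_sub x y : nm x <= nm (x - y) + nm y.
Proof. by rewrite -{1}[x](subrK y) nmD. Qed.

Definition cabs (c : R[i]) : R := complex.Re `|c|.

Lemma cabsE c : `|c| = (cabs c)%:C.
Proof. exact: ge0_complexE. Qed.

Lemma cabs_ge0 c : 0 <= cabs c.
Proof. by rewrite -ler0c -cabsE. Qed.

Lemma cabsR (r : R) : cabs r%:C = `|r|.
Proof. by apply: complexI; rewrite -cabsE normc_def /= expr0n addr0 sqrtr_sqr. Qed.

Lemma cabsM c d : cabs (c * d) = cabs c * cabs d.
Proof. by apply: complexI; rewrite rmorphM /= -!cabsE normrM. Qed.

Lemma nmZ c x : nm (c *: x) = cabs c * nm x.
Proof. by apply: complexI; rewrite rmorphM /= -cabsE -!normE normrZ. Qed.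

Lemma nmZR (r : R) x : nm (r%:C *: x) = `|r| * nm x.
Proof. by rewrite nmZ cabsR. Qed.

Lemma nm_sum (I : Type) (s : seq I) (P : pred I) (F : I -> V) :
  nm (\sum_(i <- s | P i) F i) <= \sum_(i <- s | P i) nm (F i).
Proof.
elim/big_rec2: _ => [|i y1 y2 _ h]; first by rewrite nm0.
by apply: (le_trans (nmD _ _)); rewrite lerD2l.
Qed.

Lemma cvg_nmP {T} (F : set_system T) {FF : Filter F} (f : T -> V) l :
  f @ F --> l <-> forall e : R, 0 < e -> \forall t \near F, nm (l - f t) < e.
Proof.
split=> [/cvgrPdist_lt h e e0|h].
  have e0' : 0 < e%:C by rewrite ltr0C.
  by have := h _ e0'; apply: filterS => t; rewrite normE ltcR.
apply/cvgrPdist_lt => e e0; have eE := ge0_complexE (ltW e0).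
have e0' : 0 < complex.Re e by rewrite -ltr0C -eE.
by have := h _ e0'; apply: filterS => t; rewrite normE eE ltcR.
Qed.

Lemma nm_eq x y : (forall e : R, 0 < e -> nm (x - y) <= e) -> x = y.
Proof.
move=> h; apply/eqP; rewrite -subr_eq0; apply/eqP/nm_eq0/eqP; rewrite eq_le.
by rewrite nm_ge0 andbT; apply/ler_addgt0Pr => e e0; rewrite add0r h.
Qed.

Lemma continuous_nm {T : topologicalType} (f : T -> V) :
  continuous f -> continuous (fun t => nm (f t)).
Proof.
move=> cf t; apply/cvgrPdist_lt => e e0.
have /cvg_nmP/(_ e e0) := cf t; apply: filterS => s.
apply: le_lt_trans; rewrite ler_norml.
have := nm_le_sub (f t) (f s); have := nm_le_sub (f s) (f t).
by rewrite (nm_sym (f s)) => h1 h2; apply/andP; split; lra.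
Qed.

End RealNorm.

(** The limit inherits the rate [r]; limits built this way come with the estimate that later
    compares them with their approximants. *)
Lemma complete_nm (R : realType) (V : CompleteNormedModule.type R[i])
    (u : nat -> V) (r : nat -> R) :
  (forall m n, (m <= n)%N -> nm (u n - u m) <= r m) ->
  (forall e : R, 0 < e -> exists m, r m < e) ->
  exists l, (forall m, nm (l - u m) <= r m) /\ u @ \oo --> l.
Proof.
move=> ur r0; have cu : cvg (u @ \oo).
  apply: cauchy_cvg; apply: cauchy_exP => e e0.
  have eE := ge0_complexE (ltW e0).
  have e0' : 0 < complex.Re e by rewrite -ltr0C -eE.
  have [m rm] := r0 _ e0'.
  exists (u m); exists m => // n /= mn.
  rewrite -ball_normE /= normE eE ltcR nm_sym.
  exact: le_lt_trans (ur _ _ mn) rm.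
exists (lim (u @ \oo)); split => // m; apply/ler_addgt0Pr => e e0.
have /cvg_nmP/(_ e e0)[n _ /(_ (maxn m n))] := cu.
rewrite /= leq_maxr => /(_ isT) h.
apply: (le_trans (nm_tri (u (maxn m n)) _ _)); rewrite addrC; apply: lerD.
  exact: ur (leq_maxl _ _).
exact: ltW.
Qed.

Section RealNormCStar.
Variables (R : realType) (A : cstarAlgType R).
Implicit Types x y : A.

Lemma nmM x y : nm (x ** y) <= nm x * nm y.
Proof. by rewrite -lecR rmorphM /= -!normE norm_amul. Qed.

Lemma nm_cstar x : nm (star x ** x) = nm x ^+ 2.
Proof. by apply: complexI; rewrite rmorphXn /= -!normE cstar_identity. Qed.

Lemma nm_star x : nm (star x) = nm x.
Proof. by rewrite /nm norm_star. Qed.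

Lemma nm_cstarr x : nm (x ** star x) = nm x ^+ 2.
Proof. by rewrite -{1}[x]starK nm_cstar nm_star. Qed.

Lemma star_amul_eq0 x : star x ** x = 0 -> x = 0.
Proof.
by move=> h; apply: nm_eq0; apply/eqP; rewrite -sqrf_eq0 -nm_cstar h nm0.
Qed.

(** By the C*-identity, testing on [star x] suffices. Elements can thus be bounded through left
    multiplication, without a unit. *)
Lemma nm_mulP x (r : R) : 0 <= r ->
  (forall y, nm (x ** y) <= r * nm y) -> nm x <= r.
Proof.
move=> r0 h; have := h (star x); rewrite nm_cstarr nm_star expr2.
have [->|x0] := eqVneq (nm x) 0; first by [].
by rewrite ler_pM2r // lt_neqAle nm_ge0 eq_sym x0.
Qed.

End RealNormCStar.

Lemma nm_contractive (R : realType) (A B : cstarAlgType R) (f : A -> B) :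
  star_hom f -> forall x, nm (f x) <= nm x.
Proof. by move=> hf x; rewrite -lecR -!normE; exact: star_hom_contractive. Qed.

(* [lra] compares atoms up to conversion, which is very slow on norms. *)
Ltac nm_lra :=
  repeat match goal with |- context [@nm ?R ?V ?x] => move: (@nm R V x) => ? end; lra.

(* [bd x r] is to be read as "the norm of [x] is at most [r]". *)
Record cstar_data (R : realType) (V : starAlgType R) := CStarData {
  bd : V -> R -> Prop;
  bd_ge0 : forall x r, bd x r -> 0 <= r;
  bd_ex : forall x, exists r, bd x r;
  bd_closed : forall x r, (forall e, 0 < e -> bd x (r + e)) -> bd x r;
  bd_le : forall x r s, r <= s -> bd x r -> bd x s;
  bd_eq0 : forall x, bd x 0 -> x = 0;
  bdD : forall x y r s, bd x r -> bd y s -> bd (x + y) (r + s);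
  bdZ : forall c x r, bd x r -> bd (c *: x) (cabs c * r);
  bdM : forall x y r s, bd x r -> bd y s -> bd (x ** y) (r * s);
  bdS : forall x r, bd x r -> bd (star x) r;
  bdC : forall x r, 0 <= r -> bd (star x ** x) (r ^+ 2) -> bd x r;
  bd_complete : forall u : nat -> V,
    (forall m n, (m <= n)%N -> bd (u n - u m) (2^-1 ^+ m)) ->
    exists l, forall e, 0 < e -> exists N, forall m, (N <= m)%N -> bd (l - u m) e
}.

(** * C*-norms obtained from their sets of upper bounds *)

Definition cstar_of (R : realType) (V : starAlgType R) (d : cstar_data V) : Type := V.

Section CStarOf.
Variables (R : realType) (V : starAlgType R) (d : cstar_data V).
Local Notation W := (cstar_of d).
Implicit Types x y : W.

HB.instance Definition _ := StarAlgebra.copy W V.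

Definition bd_norm x : R := inf [set r | bd d x r].

Lemma bd_has_inf x : has_inf [set r | bd d x r].
Proof.
split; first by have [r] := bd_ex d x; exists r.
by exists 0 => r /= /bd_ge0.
Qed.

Lemma bd_normP x r : bd d x r <-> bd_norm x <= r.
Proof.
split=> [h|h]; first by apply: ge_inf => //; exact: (bd_has_inf x).2.
apply: bd_closed => e e0.
have [s ds se] := inf_adherent e0 (bd_has_inf x).
apply: bd_le ds; apply: ltW; apply: (lt_le_trans se); exact: lerD.
Qed.

Lemma bd_norm_bd x : bd d x (bd_norm x).
Proof. exact/bd_normP. Qed.

Lemma bd_norm_ge0 x : 0 <= bd_norm x.
Proof. exact: bd_ge0 (bd_norm_bd x). Qed.

Lemma bd_normD x y : (bd_norm (x + y))%:C <= (bd_norm x)%:C + (bd_norm y)%:C.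
Proof. by rewrite -rmorphD lecR; apply/bd_normP/bdD; exact: bd_norm_bd. Qed.

Lemma bd_norm0 : bd_norm 0 = 0.
Proof.
apply: le_anti; rewrite bd_norm_ge0 andbT; apply/bd_normP.
by have := bdZ 0 (bd_norm_bd 0); rewrite scale0r (cabsR 0) normr0 mul0r.
Qed.

Lemma bd_normZ (c : R[i]) x : (bd_norm (c *: x))%:C = `|c| * (bd_norm x)%:C.
Proof.
rewrite cabsE -rmorphM; congr (_%:C).
have le (b : R[i]) (y : W) : bd_norm (b *: y) <= cabs b * bd_norm y.
  by apply/bd_normP/bdZ; exact: bd_norm_bd.
have [->|c0] := eqVneq c 0.
  by rewrite scale0r bd_norm0 (cabsR 0) normr0 mul0r.
apply: le_anti; rewrite le /=; have := le c^-1 (c *: x).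
rewrite scalerA mulVf// scale1r => h.
apply: (le_trans (ler_wpM2l (cabs_ge0 _) h)).
by rewrite mulrA -cabsM mulfV// (cabsR 1) normr1 mul1r.
Qed.

Lemma bd_norm_eq0 x : (bd_norm x)%:C = 0 -> x = 0.
Proof. by move=> /complexI h; apply: (@bd_eq0 _ _ d); rewrite bd_normP h. Qed.

HB.instance Definition _ :=
  @Lmodule_isNormed.Build R[i] W (fun x => (bd_norm x)%:C) bd_normD bd_normZ bd_norm_eq0.

Lemma bd_nm x : nm x = bd_norm x.
Proof. by []. Qed.

(** The filter is followed by centers [u n] of balls of radius 2^-(n+2) that belong to it. Two such
    balls meet, so the centers have the geometric rate that [bd_complete] asks for, and the filter
    converges to their limit. *)
Lemma bd_cauchy_cvg (F : set_system W) : ProperFilter F -> cauchy F -> cvg F.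
Proof.
move=> FF /cauchyP cF.
have e0 n : 0 < (2^-1 ^+ n.+2)%:C :> R[i] by rewrite ltr0C exprn_gt0.
have /choice[u uP] : forall n, exists x, F (ball x ((2^-1 ^+ n.+2)%:C : R[i])).
  by move=> n; exact: cF.
have close (x y : W) (r s : R) : F (ball x (r%:C : R[i])) -> F (ball y (s%:C : R[i])) ->
    nm (x - y) < r + s.
  move=> Fx Fy; have [z []] := filter_ex (filterI Fx Fy).
  rewrite -!ball_normE /= !normE !ltcR => h1 h2.
  by apply: (le_lt_trans (nm_tri z _ _)); rewrite (nm_sym z); exact: ltrD.
have half n : (2^-1 ^+ n.+2 : R) = 4^-1 * 2^-1 ^+ n.
  by rewrite !exprS mulrA -invfM; congr (_ ^-1 * _); rewrite -natrM.
have mono m n : (m <= n)%N -> (2^-1 ^+ n : R) <= 2^-1 ^+ m.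
  by move=> mn; rewrite ler_wiXn2l ?invr_ge0 ?invf_le1 ?ler1n.
have [m n mn|l lP] := @bd_complete _ _ d u.
  apply/bd_normP; rewrite -bd_nm; apply: (le_trans (ltW (close _ _ _ _ (uP _) (uP _)))).
  rewrite !half; have := mono _ _ mn; have := mono _ _ (leq0n n); rewrite expr0.
  have : 0 < 2^-1 ^+ m :> R by rewrite exprn_gt0.
  by lra.
apply/cvg_ex; exists l; apply/cvg_ballP => e e_gt0.
have eE := ge0_complexE (ltW e_gt0).
have re0 : 0 < complex.Re e / 2 by rewrite divr_gt0// -ltr0C -eE.
have [N NP] := lP _ re0.
have /cvgr_norm_lt/(_ (complex.Re e / 2)) : (GRing.exp 2^-1 : R ^nat) @ \oo --> (0 : R).
  by apply: cvg_expr; rewrite ger0_norm ?invr_ge0 ?invf_lt1 ?ltr1n.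
rewrite normr0 => /(_ re0) [n _ /(_ (maxn N n))] /=.
rewrite leq_maxr ger0_norm ?exprn_ge0 ?invr_ge0// => /(_ isT) small.
have {}NP := NP _ (leq_maxl N n).
apply: filterS (uP (maxn N n)) => z; rewrite -!ball_normE /= !normE eE !ltcR => h.
apply: (le_lt_trans (nm_tri (u (maxn N n)) _ _)).
move/bd_normP: NP; rewrite -bd_nm; move: h; rewrite half.
have : 0 < 2^-1 ^+ maxn N n :> R by rewrite exprn_gt0.
by move: small; lra.
Qed.

HB.instance Definition _ := Uniform_isComplete.Build W bd_cauchy_cvg.

Lemma bd_norm_amul x y : `|x ** y| <= `|x| * `|y|.
Proof.
by rewrite !normE -rmorphM lecR !bd_nm; apply/bd_normP/bdM; exact: bd_norm_bd.
Qed.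

Lemma bd_cstar_identity x : `|star x ** x| = `|x| ^+ 2.
Proof.
rewrite !normE -rmorphXn !bd_nm; congr (_%:C); apply: le_anti; apply/andP; split.
  by apply/bd_normP; rewrite expr2; apply: bdM; [apply: bdS|]; exact: bd_norm_bd.
set s := bd_norm (star x ** x); have s0 : 0 <= s by exact: bd_norm_ge0.
rewrite -[leRHS](sqr_sqrtr s0) ler_sqr ?nnegrE ?sqrtr_ge0 ?bd_norm_ge0//.
by apply/bd_normP/bdC; rewrite ?sqrtr_ge0// sqr_sqrtr//; exact: bd_norm_bd.
Qed.

HB.instance Definition _ := isCStarAlgebra.Build R W bd_norm_amul bd_cstar_identity.

End CStarOf.

(** The conditions are met in finite blocks: [m j] settles those of code at most [j] from time [K j]
    on. At time [k] the largest block [j <= k] with [K j <= k] is used; it eventually passes every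
    code. *)
Lemma diagonal_choice (I : countType) (S : I -> nat -> nat -> Prop) :
  (forall i, \forall m \near \oo, \forall k \near \oo, S i m k) ->
  exists n : nat -> nat, forall i, \forall k \near \oo, S i (n k) k.
Proof.
move=> hS; pose T j m k := forall i, (pickle i <= j)%N -> S i m k.
have hT j : exists m, \forall k \near \oo, T j m k.
  pose U p m k := forall i, pickle i = p -> S i m k.
  have hU p : \forall m \near \oo, \forall k \near \oo, U p m k.
    have [[i ip]|no] := pselect (exists i : I, pickle i = p).
      apply: filterS (hS i) => m; apply: filterS => k h i' i'p.
      by rewrite -ip in i'p; rewrite (pcan_inj pickleK i'p).
    by apply: nearW => m; apply: nearW => k i ip; case: no; exists i.
  suff /filter_ex[m hm] : \forall m \near \oo, \forall k \near \oo, T j m k by exists m.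
  elim: j => [|j IH].
    by apply: filterS (hU 0%N) => m; apply: filterS => k h i; rewrite leqn0 => /eqP /h.
  apply: filterS2 IH (hU j.+1) => m; apply: filterS2 => k h1 h2 i.
  by rewrite leq_eqVlt => /orP[/eqP /h2|/h1].
have [m hm] := choice hT.
have /choice[K hK] : forall j, exists K, forall k, (K <= k)%N -> T j (m j) k.
  by move=> j; have [K _ KP] := hm j; exists K => k /KP.
pose P k := [pred j : 'I_k.+1 | (K j <= k)%N].
(* For early [k] the set [P k] may be empty and the maximum is then [0]; only large [k] matter. *)
exists (fun k => m (\max_(j in P k) j)%N) => i.
exists (maxn (pickle i) (K (pickle i))) => // k /=; rewrite geq_max => /andP[ik Kk].
have iP : (Ordinal (n := k.+1) ik : 'I_k.+1) \in P k by [].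
have P0 : (0 < #|P k|)%N by apply/card_gt0P; exists (Ordinal (n := k.+1) ik).
have /= mx := @leq_bigmax_cond _ (mem (P k)) (fun j : 'I_k.+1 => j : nat) _ iP.
have [j jP jE] := eq_bigmax_cond (fun j : 'I_k.+1 => j : nat) P0.
by rewrite jE in mx *; exact: hK jP _ mx.
Qed.

(** * Sequence algebras are C*-algebras *)

Section SeqAlgNorm.
Variables (R : realType) (E : cstarAlgType R).
Implicit Types (x y : seqalg E) (u v : nat -> E).

Lemma linf_nmP u : linf E u <-> exists M : R, forall n, nm (u n) <= M.
Proof.
split=> [[M uM]|[M uM]]; last by exists M%:C => n; rewrite normE lecR.
have M0 : 0 <= M := le_trans (normr_ge0 _) (uM 0%N).
by exists (complex.Re M) => n; rewrite -lecR -normE -ge0_complexE.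
Qed.

Lemma near_linf u (M : R) : (\forall n \near \oo, nm (u n) <= M) -> linf E u.
Proof.
move=> [N _ uM]; apply/linf_nmP; exists (M + \sum_(i < N) nm (u i)) => n.
have s0 : 0 <= \sum_(i < N) nm (u i) by apply: sumr_ge0 => i _; exact: nm_ge0.
have M0 : 0 <= M by apply: le_trans (nm_ge0 (u N)) (uM N _) => /=.
have [Nn|nN] := leqP N n.
  by rewrite -[leLHS]addr0; apply: lerD => //; exact: uM.
rewrite (bigD1 (Ordinal nN))//= addrCA lerDl addr_ge0//.
by apply: sumr_ge0 => i _; exact: nm_ge0.
Qed.

Definition rseq x : nat -> E := val (qrep x).

Lemma eta_qrep x : eta (qrep x) = x.
Proof. exact: qrepK. Qed.

Lemma eta_eqP (a b : subalg (linf E)) : eta a = eta b <->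
  forall e : R, 0 < e -> \forall n \near \oo, nm (val a n - val b n) <= e.
Proof.
split=> [/qpiP h e e0|h].
  move/cvg_nmP: h => /(_ e e0); apply: filterS => n /=.
  by rewrite sub0r nmN => /ltW.
apply/qpiP/cvg_nmP => e e0.
have e2 : 0 < e / 2 by rewrite divr_gt0.
apply: filterS (h _ e2) => n /= hn; rewrite sub0r nmN.
by apply: (le_lt_trans hn); rewrite gtr_pMr// invf_lt1// ltr1n.
Qed.

(** The quotient norm is the limsup of the norms of any representative; this is the statement that
    it is at most [r]. *)
Definition sbd x (r : R) :=
  forall e, 0 < e -> \forall n \near \oo, nm (rseq x n) <= r + e.

Lemma sbdP (a : subalg (linf E)) r : sbd (eta a) r <->
  forall e, 0 < e -> \forall n \near \oo, nm (val a n) <= r + e.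
Proof.
have /eta_eqP h := eta_qrep (eta a).
have e2 (e : R) : 0 < e -> 0 < e / 2 by move=> e0; rewrite divr_gt0.
split=> H e e0; apply: filterS2 (H _ (e2 _ e0)) (h _ (e2 _ e0)) => n.
- rewrite nm_sym => h1 h2; have := nm_le_sub (val a n) (rseq (eta a) n).
  by rewrite /rseq in h1 *; lra.
- by move=> h1 h2; have := nm_le_sub (rseq (eta a) n) (val a n); rewrite /rseq; lra.
Qed.

Lemma seqW (P : seqalg E -> Prop) : (forall a, P (eta a)) -> forall x, P x.
Proof. by move=> h x; rewrite -(eta_qrep x). Qed.

Lemma sbd_ge0 x r : sbd x r -> 0 <= r.
Proof.
move=> h; apply/ler_addgt0Pr => e e0.
have [n hn] := filter_ex (h _ e0).
exact: le_trans (nm_ge0 _) hn.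
Qed.

Lemma sbd_ex x : exists r, sbd x r.
Proof.
have /linf_nmP[M hM] := subalgP (qrep x).
exists M => e e0; apply: nearW => n.
by apply: (le_trans (hM n)); rewrite lerDl ltW.
Qed.

Lemma sbd_closed x r : (forall e, 0 < e -> sbd x (r + e)) -> sbd x r.
Proof.
move=> h e e0; have e2 : 0 < e / 2 by rewrite divr_gt0.
by apply: filterS (h _ e2 _ e2) => n; rewrite -addrA -splitr.
Qed.

Lemma sbd_le x r s : r <= s -> sbd x r -> sbd x s.
Proof.
move=> rs h e e0; apply: filterS (h _ e0) => n hn.
by apply: (le_trans hn); rewrite lerD2r.
Qed.

Lemma sbd_eq0 x : sbd x 0 -> x = 0.
Proof.
elim/seqW: x => a /sbdP h; rewrite -(star_hom0 (@eta_star_hom R E)).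
by apply/eta_eqP => e e0; apply: filterS (h e e0) => n; rewrite add0r /= subr0.
Qed.

Lemma sbdD x y r s : sbd x r -> sbd y s -> sbd (x + y) (r + s).
Proof.
elim/seqW: x => a; elim/seqW: y => b /sbdP ha /sbdP hb.
rewrite -(star_homD (@eta_star_hom R E)); apply/sbdP => e e0.
have e2 : 0 < e / 2 by rewrite divr_gt0.
apply: filterS2 (ha _ e2) (hb _ e2) => n h1 h2.
by apply: (le_trans (nmD _ _)); lra.
Qed.

Lemma sbdZ (c : R[i]) x r : sbd x r -> sbd (c *: x) (cabs c * r).
Proof.
elim/seqW: x => a /sbdP ha.
rewrite -(star_homZ (@eta_star_hom R E)); apply/sbdP => e e0.
have c1 : 0 < cabs c + 1 by rewrite ltr_wpDl ?cabs_ge0.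
apply: filterS (ha (e / (cabs c + 1)) _) => [n|]; last by rewrite divr_gt0.
have -> : val (c *: a) n = c *: val a n by [].
rewrite nmZ => h; apply: (le_trans (ler_wpM2l (cabs_ge0 c) h)).
rewrite mulrDr lerD2l mulrCA -[leRHS]mulr1 ler_pM2l// ler_pdivrMr// mul1r.
by rewrite lerDl.
Qed.

Lemma sbdM x y r s : sbd x r -> sbd y s -> sbd (x ** y) (r * s).
Proof.
move=> hx hy; have r0 := sbd_ge0 hx; have s0 := sbd_ge0 hy.
elim/seqW: x hx => a /sbdP ha; elim/seqW: y hy => b /sbdP hb.
rewrite -(star_homM (@eta_star_hom R E)); apply/sbdP => e e0.
(* Since [d <= 1], [(r + d) * (s + d)] is at most [r * s + d * (r + s + 1)]. *)
pose d := Num.min 1 (e / (r + s + 1)).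
have rs : 0 < r + s + 1 by lra.
have d0 : 0 < d by rewrite lt_min ltr01 divr_gt0.
have d1 : d <= 1 by rewrite ge_min lexx.
have de : d * (r + s + 1) <= e.
  by rewrite -ler_pdivlMr// /d ge_min lexx orbT.
apply: filterS2 (ha _ d0) (hb _ d0) => n h1 h2.
have -> : val (a ** b) n = val a n ** val b n by [].
apply: (le_trans (nmM _ _)).
apply: (le_trans (ler_pM (nm_ge0 _) (nm_ge0 _) h1 h2)).
by nra.
Qed.

Lemma sbdS x r : sbd x r -> sbd (star x) r.
Proof.
elim/seqW: x => a /sbdP ha; rewrite -(star_homS (@eta_star_hom R E)).
apply/sbdP => e e0; apply: filterS (ha _ e0) => n.
have -> : val (star a) n = star (val a n) by [].
by rewrite nm_star.
Qed.

Lemma sbdC x r : 0 <= r -> sbd (star x ** x) (r ^+ 2) -> sbd x r.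
Proof.
move=> r0; elim/seqW: x => a.
rewrite -(star_homS (@eta_star_hom R E)) -(star_homM (@eta_star_hom R E)).
move=> /sbdP h; apply/sbdP => e e0.
have e2 : 0 < e ^+ 2 by rewrite exprn_gt0.
apply: filterS (h _ e2) => n.
have -> : val (star a ** a) n = star (val a n) ** val a n by [].
rewrite nm_cstar => hn; have re : 0 <= r + e by lra.
have : nm (val a n) ^+ 2 <= (r + e) ^+ 2 by nra.
by rewrite ler_sqr ?nnegrE ?nm_ge0.
Qed.

(** The limit is a diagonal through representatives: for each [i], entry [k] of the chosen [u (n k)]
    is within twice 2^-i of entry [k] of [u i] for almost all [k]. *)
Lemma sbd_complete (u : nat -> seqalg E) :
  (forall m n, (m <= n)%N -> sbd (u n - u m) (2^-1 ^+ m)) ->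
  exists l, forall e, 0 < e -> exists N, forall m, (N <= m)%N -> sbd (l - u m) e.
Proof.
move=> hu.
have p0 m : 0 < 2^-1 ^+ m :> R by rewrite exprn_gt0.
have sbdB x y r : sbd (x - y) r -> forall e, 0 < e ->
    \forall k \near \oo, nm (rseq x k - rseq y k) <= r + e.
  move=> h e e0; rewrite -(eta_qrep x) -(eta_qrep y) in h.
  by rewrite -(star_homB (@eta_star_hom R E)) in h; exact: (sbdP _ _).1 h _ e0.
have [n hn] := @diagonal_choice nat
  (fun i m k => nm (rseq (u m) k - rseq (u i) k) <= 2^-1 ^+ i + 2^-1 ^+ i)
  (fun i => filterS (fun m im => sbdB _ _ _ (hu i m im) _ (p0 i)) (nbhs_infty_ge i)).
pose v k := rseq (u (n k)) k.
have bv : linf E v.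
  have /linf_nmP[M hM] := subalgP (qrep (u 0%N)).
  apply: (@near_linf _ (2 + M)); apply: filterS (hn 0%N) => k.
  rewrite !expr0 => h; apply: (le_trans (nm_le_sub _ (rseq (u 0%N) k))).
  by apply: lerD => //; exact: hM.
exists (eta (mksub bv)) => e e0.
have /cvgr_norm_lt/(_ (e / 4)) : (GRing.exp 2^-1 : R ^nat) @ \oo --> (0 : R).
  by apply: cvg_expr; rewrite ger0_norm ?invr_ge0 ?invf_lt1 ?ltr1n.
rewrite normr0 => /(_ _)[|N _ HN]; first by rewrite divr_gt0.
exists N => m Nm; rewrite -(eta_qrep (u m)) -(star_homB (@eta_star_hom R E)).
apply/sbdP => d d0; apply: filterS (hn m) => k /= h.
have := HN m Nm; rewrite /= ger0_norm ?exprn_ge0 ?invr_ge0// => h2.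
by rewrite /v /rseq in h *; lra.
Qed.

(** With this norm a sequence algebra can itself serve as coefficients of a sequence algebra, and
    homomorphisms into it are contractive. *)
Definition seqalg_data : cstar_data (seqalg E) :=
  CStarData sbd_ge0 sbd_ex sbd_closed sbd_le sbd_eq0 sbdD sbdZ sbdM sbdS sbdC
    sbd_complete.

HB.instance Definition _ := CStarAlgebra.copy (seqalg E) (cstar_of seqalg_data).

Lemma nm_etaP (a : subalg (linf E)) (r : R) : nm (eta a) <= r <->
  forall e, 0 < e -> \forall n \near \oo, nm (val a n) <= r + e.
Proof. by rewrite -sbdP; split => /(@bd_normP _ _ seqalg_data). Qed.

End SeqAlgNorm.

Lemma half_pow_small (R : realType) (e : R) : 0 < e -> exists m, 2^-1 ^+ m < e.
Proof.
move=> e0.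
have /cvgr_norm_lt/(_ e) : (GRing.exp 2^-1 : R ^nat) @ \oo --> (0 : R).
  by apply: cvg_expr; rewrite ger0_norm ?invr_ge0 ?invf_lt1 ?ltr1n.
rewrite normr0 => /(_ e0)[N _ /(_ N (leqnn N)) h].
by exists N; move: h; rewrite /= ger0_norm ?exprn_ge0 ?invr_ge0.
Qed.

(* A *-algebra faithfully represented by a uniformly closed *-algebra of
   bounded functions with values in a C*-algebra is a C*-algebra. *)
Record star_rep (R : realType) (V : starAlgType R) (E : cstarAlgType R) := StarRep {
  rep_index : Type;
  rep : rep_index -> V -> E;
  rep_star_hom : forall t, star_hom (rep t);
  rep_inj : forall v, (forall t, rep t v = 0) -> v = 0;
  rep_bounded : forall v, exists M : R, forall t, nm (rep t v) <= M;
  rep_complete : forall l : rep_index -> E,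
    (forall e : R, 0 < e -> exists v, forall t, nm (l t - rep t v) <= e) ->
    exists v, forall t, rep t v = l t
}.

Section RepData.
Variables (R : realType) (V : starAlgType R) (E : cstarAlgType R).
Variable p : star_rep V E.
Local Notation pi := (rep (s := p)).
Implicit Types x y : V.

Definition rbd x (r : R) := 0 <= r /\ forall t, nm (pi t x) <= r.

Let hp t : star_hom (pi t) := rep_star_hom t.

Lemma rbd_ge0 x r : rbd x r -> 0 <= r. Proof. by case. Qed.
Lemma rbd_ex x : exists r, rbd x r.
Proof.
have [M hM] := rep_bounded p x; exists (Num.max 0 M); split.
  by rewrite le_max lexx.
by move=> t; rewrite le_max hM orbT.
Qed.
Lemma rbd_closed x r : (forall e, 0 < e -> rbd x (r + e)) -> rbd x r.
Proof.
move=> h; split=> [|t]; apply/ler_addgt0Pr => e e0; have [h1 h2] := h e e0 => //.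
Qed.
Lemma rbd_le x r s : r <= s -> rbd x r -> rbd x s.
Proof.
by move=> rs [r0 h]; split=> [|t]; [exact: le_trans rs|exact: le_trans (h t) rs].
Qed.
Lemma rbd_eq0 x : rbd x 0 -> x = 0.
Proof.
move=> [_ h]; apply: (rep_inj (s := p)) => t; apply: nm_eq0; apply: le_anti.
by rewrite h nm_ge0.
Qed.
Lemma rbdD x y r s : rbd x r -> rbd y s -> rbd (x + y) (r + s).
Proof.
move=> [r0 h1] [s0 h2]; split=> [|t]; first exact: addr_ge0.
by rewrite (star_homD (hp t)); apply: (le_trans (nmD _ _)); exact: lerD.
Qed.
Lemma rbdZ (c : R[i]) x r : rbd x r -> rbd (c *: x) (cabs c * r).
Proof.
move=> [r0 h1]; split=> [|t]; first by rewrite mulr_ge0 ?cabs_ge0.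
by rewrite (star_homZ (hp t)) nmZ ler_wpM2l ?cabs_ge0.
Qed.
Lemma rbdM x y r s : rbd x r -> rbd y s -> rbd (x ** y) (r * s).
Proof.
move=> [r0 h1] [s0 h2]; split=> [|t]; first exact: mulr_ge0.
rewrite (star_homM (hp t)); apply: (le_trans (nmM _ _)).
by apply: ler_pM => //; exact: nm_ge0.
Qed.
Lemma rbdS x r : rbd x r -> rbd (star x) r.
Proof. by move=> [r0 h]; split=> // t; rewrite (star_homS (hp t)) nm_star. Qed.
Lemma rbdC x r : 0 <= r -> rbd (star x ** x) (r ^+ 2) -> rbd x r.
Proof.
move=> r0 [_ h]; split=> // t; have := h t.
rewrite (star_homM (hp t)) (star_homS (hp t)) nm_cstar.
by rewrite ler_sqr ?nnegrE ?nm_ge0.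
Qed.
Lemma rbd_complete (u : nat -> V) :
  (forall m n, (m <= n)%N -> rbd (u n - u m) (2^-1 ^+ m)) ->
  exists l, forall e, 0 < e -> exists N, forall m, (N <= m)%N -> rbd (l - u m) e.
Proof.
move=> hu.
have /choice[l hl] : forall t, exists l, forall m, nm (l - pi t (u m)) <= 2^-1 ^+ m.
  move=> t; have [m n mn||l [hl _]] := @complete_nm _ E (fun n => pi t (u n)) (fun m => 2^-1 ^+ m).
  - by rewrite -(star_homB (hp t)); have [] := hu m n mn.
  - exact: half_pow_small.
  - by exists l.
have [v hv] : exists v, forall t, pi t v = l t.
  apply: rep_complete => e /half_pow_small[m me]; exists (u m) => t.
  exact: le_trans (hl t m) (ltW me).
exists v => e e0; have [N Ne] := half_pow_small e0; exists N => m Nm; split; first exact: ltW.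
move=> t; rewrite (star_homB (hp t)) hv; apply: (le_trans (hl t m)).
apply: le_trans (ltW Ne).
by apply: ler_wiXn2l => //; rewrite ?invr_ge0 ?invf_le1 ?ler1n.
Qed.

Definition rep_data : cstar_data V :=
  CStarData rbd_ge0 rbd_ex rbd_closed rbd_le rbd_eq0 rbdD rbdZ rbdM rbdS rbdC
    rbd_complete.

Lemma nm_repP (x : cstar_of rep_data) (r : R) : 0 <= r ->
  nm x <= r <-> forall t, nm (pi t x) <= r.
Proof.
move=> r0; have := @bd_normP _ _ rep_data x r; rewrite -bd_nm /= /rbd => <-.
by split=> [[]|].
Qed.

Lemma nm_rep_le (x : cstar_of rep_data) t : nm (pi t x) <= nm x.
Proof. exact: ((nm_repP x (nm_ge0 x)).1 (lexx _) t). Qed.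

End RepData.

(** * Closed subalgebras and bounded sequences as C*-algebras *)

Section ClosedSub.
Variables (R : realType) (A : cstarAlgType R) (S : starSub A).
Hypothesis clS : closed [set x | S x].

Lemma closed_sub_complete (l : unit -> A) :
  (forall e : R, 0 < e -> exists v : subalg S, forall t, nm (l t - val v) <= e) ->
  exists v : subalg S, forall t, val v = l t.
Proof.
move=> h; have Sl : S (l tt).
  apply: clS => B /nbhs_ballP[e /= e0]; rewrite -ball_normE => eB.
  have eE := ge0_complexE (ltW e0).
  have e2 : 0 < complex.Re e / 2 by rewrite divr_gt0// -ltr0C -eE.
  have [v hv] := h _ e2; exists (val v); split; first exact: subalgP.
  apply: eB => /=; rewrite normE eE ltcR; apply: le_lt_trans (hv tt) _.
  by rewrite gtr_pMr ?invf_lt1 ?ltr1n// -ltr0C -eE.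
by exists (mksub Sl); case.
Qed.

Definition closed_sub_rep : star_rep (subalg S) A.
Proof.
exists unit (fun _ => val).
- by move=> _; exact: subval_star_hom.
- by move=> v /(_ tt) h; apply: val_inj.
- by move=> v; exists (nm (val v)).
- exact: closed_sub_complete.
Defined.

Definition closed_sub := cstar_of (rep_data closed_sub_rep).
HB.instance Definition _ := CStarAlgebra.on closed_sub.

Lemma nm_closed_sub (x : closed_sub) : nm x = nm (val (x : subalg S)).
Proof.
apply: le_anti; rewrite (@nm_rep_le _ _ _ closed_sub_rep x tt) andbT.
by apply/(@nm_repP _ _ _ closed_sub_rep) => //; exact: nm_ge0.
Qed.

End ClosedSub.

Section BoundedSeq.
Variables (R : realType) (E : cstarAlgType R).

Lemma linf_complete (l : nat -> E) :
  (forall e : R, 0 < e -> exists v : subalg (linf E), forall n, nm (l n - val v n) <= e) ->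
  exists v : subalg (linf E), forall n, val v n = l n.
Proof.
move=> h; have bl : linf E l.
  have [v hv] := h 1 ltr01; have /linf_nmP[M hM] := subalgP v.
  apply/linf_nmP; exists (1 + M) => n.
  by apply: (le_trans (nm_le_sub _ (val v n))); exact: lerD.
by exists (mksub bl).
Qed.

Definition linf_rep : star_rep (subalg (linf E)) E.
Proof.
exists nat (fun n a => val a n).
- by move=> n; split.
- by move=> v h; apply/val_inj/funext => n; exact: h.
- by move=> v; apply/linf_nmP; exact: subalgP.
- exact: linf_complete.
Defined.

Definition linf_alg := cstar_of (rep_data linf_rep).
HB.instance Definition _ := CStarAlgebra.on linf_alg.

Definition ev (n : nat) (a : linf_alg) : E := val (a : subalg (linf E)) n.

Lemma ev_star_hom n : star_hom (ev n).
Proof. by split. Qed.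

Lemma nm_linf_algP (a : linf_alg) (r : R) : 0 <= r -> nm a <= r <-> forall n, nm (ev n a) <= r.
Proof. by move=> r0; exact: (@nm_repP _ _ _ linf_rep a r r0). Qed.

Lemma ev_inj (a b : linf_alg) : (forall n, ev n a = ev n b) -> a = b.
Proof. by move=> h; apply: (@val_inj _ _ (subalg (linf E))); exact/funext. Qed.

Lemma eta_linf_alg_star_hom : star_hom (@eta R E : linf_alg -> seqalg E).
Proof. exact: eta_star_hom. Qed.

End BoundedSeq.

(** * Dense sequences *)

Section Separable.
Variable R : realType.

Lemma countable_enum (T : choiceType) (t0 : T) (Q : set T) : countable Q ->
  exists s : nat -> T, forall x, Q x -> exists i, s i = x.
Proof.
move=> /countable_injP[f fi].
have /choice[s hs] : forall n, exists x, forall y, Q y -> f y = n -> x = y.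
  move=> n; have [[x [Qx fx]]|no] := pselect (exists x, Q x /\ f x = n).
    by exists x => y Qy fy; apply: fi; rewrite ?inE// fx fy.
  by exists t0 => y Qy fy; case: no; exists y.
by exists s => x Qx; exists (f x); exact: hs.
Qed.

Lemma closure_nm (V : normedModType R[i]) (Q : set V) x (e : R) :
  closure Q x -> 0 < e -> exists2 y, Q y & nm (x - y) < e.
Proof.
move=> cQ e0; have e0' : 0 < (e%:C : R[i]) by rewrite ltr0C.
have [y [Qy]] := cQ _ (nbhsx_ballx x _ e0').
by rewrite -ball_normE /= normE ltcR => h; exists y.
Qed.

(** A dense sequence of the algebra may miss [D] altogether. For each [s i] and each radius 2^-j a
    point of [D] in that ball is added, if there is one. *)
Lemma dense_seq (A : cstarAlgType R) (D : set A) :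
  separable_set [set: A] -> D 0 -> exists s : nat -> A,
    (forall x (e : R), 0 < e -> exists i, nm (x - s i) < e) /\
    (forall x (e : R), D x -> 0 < e -> exists2 i, D (s i) & nm (x - s i) < e).
Proof.
move=> [Q cQ [_ dQ]] D0; have [s hs] := countable_enum (0 : A) cQ.
have ds x (e : R) : 0 < e -> exists i, nm (x - s i) < e.
  move=> e0; have [y /hs[i <-] xy] := closure_nm (dQ x I) e0.
  by exists i.
have /choice[d hd] : forall ij : nat * nat, exists d, D d /\
    ((exists2 z, D z & nm (z - s ij.1) < 2^-1 ^+ ij.2) -> nm (d - s ij.1) < 2^-1 ^+ ij.2).
  move=> [i j] /=.
  have [[z Dz h]|no] := pselect (exists2 z, D z & nm (z - s i) < 2^-1 ^+ j).
    by exists z.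
  by exists 0; split.
exists (fun n => match unpickle n : option (nat + nat * nat) with
  | Some (inl i) => s i | Some (inr ij) => d ij | None => 0 end); split.
  by move=> x e /(ds x)[i h]; exists (pickle (inl i : nat + nat * nat)); rewrite pickleK.
move=> x e Dx e0; have e2 : 0 < e / 2 by rewrite divr_gt0.
have [j je] := half_pow_small e2.
have j0 : 0 < 2^-1 ^+ j :> R by rewrite exprn_gt0.
have [i hi] := ds x _ j0.
exists (pickle (inr (i, j) : nat + nat * nat)); rewrite pickleK; have [Dd h] := hd (i, j) => //=.
have {}h := h (ex_intro2 _ _ x Dx hi).
apply: (le_lt_trans (nm_tri (s i) _ _)); rewrite (nm_sym (s i)).
by move: hi h je; rewrite /=; lra.
Qed.

Lemma dense_complex : exists c : nat -> R[i],
  forall z (e : R), 0 < e -> exists i, cabs (z - c i) < e.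
Proof.
exists (fun n => match unpickle n : option (rat * rat) with
  | Some (p, q) => ratr p +i* ratr q | None => 0 end) => -[x y] e e0.
have e2 : 0 < e / 2 by rewrite divr_gt0.
have near1 (t : R) : exists q : rat, `|t - ratr q| < e / 2.
  have tt : t - e / 2 < t + e / 2 by lra.
  have [q] := rat_in_itvoo tt.
  by rewrite in_itv /= => /andP[h1 h2]; exists q; rewrite ltr_norml; apply/andP; split; lra.
have [p hp] := near1 x; have [q hq] := near1 y.
exists (pickle (p, q)); rewrite pickleK.
have -> : (x +i* y) - (ratr p +i* ratr q) =
    (x - ratr p)%:C + 'i * (y - ratr q)%:C :> R[i].
  by simpc.
apply: (@le_lt_trans _ _ (`|x - ratr p| + `|y - ratr q|)); last by lra.
have := ler_normD (x - ratr p)%:C ('i * (y - ratr q)%:C).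
by rewrite normrM normCi mul1r !cabsE -rmorphD lecR !cabsR.
Qed.

End Separable.

(** Unfolds a norm bound in the iterated sequence algebra into the nested form of
    [diagonal_choice]. *)
Lemma double_seq_le (R : realType) (E : cstarAlgType R)
    (a : subalg (linf (seqalg E))) (b : nat -> subalg (linf E)) (r : R) :
  (forall m, val a m = eta (b m)) -> nm (eta a) <= r ->
  forall e, 0 < e -> \forall m \near \oo, \forall k \near \oo, nm (val (b m) k) <= r + e.
Proof.
move=> ab /nm_etaP h e e0; have e2 : 0 < e / 2 by rewrite divr_gt0.
apply: filterS (h _ e2) => m; rewrite ab => /nm_etaP /(_ _ e2).
by apply: filterS => k; rewrite -addrA -splitr.
Qed.

(** Turns estimates on a dense set into identities: the defect [u] of a relation is dominated by a
    defect [v] that vanishes in the limit. *)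
Lemma cvg_nm_le0 (R : realType) (A B : cstarAlgType R) (u : nat -> A) (v : nat -> B) l :
  u @ \oo --> l -> v @ \oo --> (0 : B) -> (forall n, nm (u n) <= nm (v n)) -> l = 0.
Proof.
move=> ul v0 uv; have u0 : u @ \oo --> (0 : A).
  apply/cvg_nmP => e e0; move/cvg_nmP: v0 => /(_ e e0); apply: filterS => n.
  by rewrite !sub0r !nmN; exact: le_lt_trans.
exact: (cvg_unique (@norm_hausdorff _ A) ul u0).
Qed.

(** * Reindexing of double sequences *)

Section Reindexing.
Variables (R : realType) (A E : cstarAlgType R) (tau : A -> seqalg (seqalg E)).
Variables (D : set A) (y : A -> seqalg E).
Hypotheses (sepA : separable_set [set: A]) (htau : star_hom tau) (D0 : D 0).
Hypothesis tauD : forall x, D x -> tau x = cst_seq (y x).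

Let T x : subalg (linf (seqalg E)) := qrep (tau x).
Let B x m : subalg (linf E) := qrep (val (T x) m).

Let TE x : eta (T x) = tau x. Proof. exact: eta_qrep. Qed.
Let BE x m : eta (B x m) = val (T x) m. Proof. exact: eta_qrep. Qed.
Let h1 := @eta_star_hom R (seqalg E).
Let h2 := @eta_star_hom R E.

(** The dense sequence is not closed under the operations, so the relations appear as defects: the
    defect for [r] is at most that for [s], because [tau] is contractive. Indices and precisions
    being countable in number, one diagonal serves them all. *)
Lemma seqalg_reindex_dense (s : nat -> A) (c : nat -> R[i]) : exists r : nat -> seqalg E,
  [/\ forall i j l q, nm (r l - (c q *: r i + r j)) <= nm (s l - (c q *: s i + s j)),
      forall i j l, nm (r l - r i ** r j) <= nm (s l - s i ** s j),
      forall i j, nm (r j - star (r i)) <= nm (s j - star (s i)),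
      forall i j, nm (r j - r i) <= nm (s j - s i)
    & forall i, D (s i) -> r i = y (s i)].
Proof.
have valB (S : cstarAlgType R) (a b : subalg (linf S)) m : val (a - b) m = val a m - val b m.
  by [].
have valL (S : cstarAlgType R) z (a b : subalg (linf S)) m :
  val (z *: a + b) m = z *: val a m + val b m by [].
pose C1 i j l q e m k := nm (val (B (s l) m - (c q *: B (s i) m + B (s j) m)) k)
  <= nm (s l - (c q *: s i + s j)) + e.
pose C2 i j l e m k := nm (val (B (s l) m - (B (s i) m ** B (s j) m)) k)
  <= nm (s l - s i ** s j) + e.
pose C3 i j e m k := nm (val (B (s j) m - star (B (s i) m)) k)
  <= nm (s j - star (s i)) + e.
pose C4 i j e m k := nm (val (B (s j) m - B (s i) m) k) <= nm (s j - s i) + e.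
pose C5 i e m k := D (s i) -> nm (val (B (s i) m - qrep (y (s i))) k) <= e.
(* Ensures that the diagonal sequences are bounded. *)
pose C6 i e m k := nm (val (B (s i) m) k) <= nm (s i) + e.
have [|n hn] := @diagonal_choice (nat * nat * nat * nat * nat)%type
  (fun t m k => let: (i, j, l, q, p) := t in let e := 2^-1 ^+ p in
   [/\ C1 i j l q e m k, C2 i j l e m k, C3 i j e m k & C4 i j e m k] /\
   (C5 i e m k /\ C6 i e m k)) _.
  move=> [[[[i j] l] q] p]; set e := 2^-1 ^+ p.
  have e0 : 0 < e by rewrite exprn_gt0.
  have H1 : \forall m \near \oo, \forall k \near \oo, C1 i j l q e m k.
    apply: (@double_seq_le _ _ (T (s l) - (c q *: T (s i) + T (s j)))) => // [m|].
      by rewrite (star_homB h2 (B (s l) m)) (star_homP h2 (c q) (B (s i) m)) !BE valB valL.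
    rewrite (star_homB h1) (star_homP h1) !TE -(star_homP htau) -(star_homB htau).
    exact: nm_contractive.
  have H2 : \forall m \near \oo, \forall k \near \oo, C2 i j l e m k.
    apply: (@double_seq_le _ _ (T (s l) - (T (s i) ** T (s j)))) => // [m|].
      by rewrite (star_homB h2 (B (s l) m)) (star_homM h2 (B (s i) m)) !BE valB.
    rewrite (star_homB h1) (star_homM h1) !TE -(star_homM htau) -(star_homB htau).
    exact: nm_contractive.
  have H3 : \forall m \near \oo, \forall k \near \oo, C3 i j e m k.
    apply: (@double_seq_le _ _ (T (s j) - star (T (s i)))) => // [m|].
      by rewrite (star_homB h2 (B (s j) m)) (star_homS h2 (B (s i) m)) !BE valB.
    rewrite (star_homB h1) (star_homS h1) !TE -(star_homS htau) -(star_homB htau).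
    exact: nm_contractive.
  have H4 : \forall m \near \oo, \forall k \near \oo, C4 i j e m k.
    apply: (@double_seq_le _ _ (T (s j) - T (s i))) => // [m|].
      by rewrite (star_homB h2 (B (s j) m)) !BE.
    rewrite (star_homB h1) !TE -(star_homB htau).
    exact: nm_contractive.
  have H5 : \forall m \near \oo, \forall k \near \oo, C5 i e m k.
    have [Ds|nD] := pselect (D (s i)); last first.
      by apply: nearW => m; apply: nearW => k /nD.
    have := @double_seq_le _ _ (T (s i) - mksub (Defs.bounded_cst (y (s i))))
      (fun m => B (s i) m - qrep (y (s i))) 0.
    have F1 m : val (T (s i) - mksub (Defs.bounded_cst (y (s i)))) m =
        eta (B (s i) m - qrep (y (s i))).
      by rewrite (star_homB h2) BE eta_qrep.
    have F2 : nm (eta (T (s i) - mksub (Defs.bounded_cst (y (s i))))) <= 0.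
      by rewrite (star_homB h1) TE tauD// subrr nm0.
    move=> /(_ F1 F2 e e0); apply: filterS => m; apply: filterS => k.
    by rewrite add0r => h _.
  have H6 : \forall m \near \oo, \forall k \near \oo, C6 i e m k.
    apply: (@double_seq_le _ _ (T (s i))) => //.
    by rewrite TE; exact: nm_contractive.
  near=> m; near=> k; split; first split.
  - by near: k; near: m.
  - by near: k; near: m.
  - by near: k; near: m.
  - by near: k; near: m.
  - by split; near: k; near: m.
pose v i k := val (B (s i) (n k)) k.
have bv i : linf E (v i).
  apply: (@near_linf _ _ _ (nm (s i) + 1)).
  by apply: filterS (hn (i, i, i, i, 0%N)) => k; rewrite expr0 => -[_ []].
pose a i := mksub (bv i).
have prec (P : R -> nat -> Prop) (b : subalg (linf E)) (r : R) :
    (forall e k, P e k -> nm (val b k) <= r + e) ->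
    (forall p, \forall k \near \oo, P (2^-1 ^+ p) k) -> nm (eta b) <= r.
  move=> h hP; apply/nm_etaP => e /half_pow_small[p pe].
  apply: filterS (hP p) => k /h hk; apply: (le_trans hk).
  by rewrite lerD2l ltW.
exists (fun i => eta (a i)); split.
- move=> i j l q; rewrite -(star_homP h2) -(star_homB h2).
  apply: (prec (fun e k => C1 i j l q e (n k) k)) => // p.
  by apply: filterS (hn (i, j, l, q, p)) => k [[]].
- move=> i j l; rewrite -(star_homM h2) -(star_homB h2).
  apply: (prec (fun e k => C2 i j l e (n k) k)) => // p.
  by apply: filterS (hn (i, j, l, l, p)) => k [[]].
- move=> i j; rewrite -(star_homS h2) -(star_homB h2).
  apply: (prec (fun e k => C3 i j e (n k) k)) => // p.
  by apply: filterS (hn (i, j, j, j, p)) => k [[]].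
- move=> i j; rewrite -(star_homB h2).
  apply: (prec (fun e k => C4 i j e (n k) k)) => // p.
  by apply: filterS (hn (i, j, j, j, p)) => k [[]].
- move=> i Di; rewrite -[RHS]eta_qrep; apply: nm_eq => e e0.
  rewrite -(star_homB h2); apply: le_trans (ltW e0).
  apply: (prec (fun e k => C5 i e (n k) k)) => [d k /(_ Di)|p]; first by rewrite add0r.
  by apply: filterS (hn (i, i, i, i, p)) => k [_ []].
Unshelve. all: by end_near. Qed.

Theorem seqalg_reindex : exists rho : A -> seqalg E,
  star_hom rho /\ forall x, D x -> rho x = y x.
Proof.
have [s [ds dsD]] := dense_seq sepA D0.
have [c dc] := dense_complex R.
have [r [rP rM rS rB rD]] := seqalg_reindex_dense s c.
have approx x : exists i : nat -> nat, forall m, nm (x - s (i m)) < 2^-1 ^+ m / 2.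
  have /choice[i hi] : forall m, exists i, nm (x - s i) < 2^-1 ^+ m / 2.
    by move=> m; apply: ds; rewrite divr_gt0// exprn_gt0.
  by exists i.
(* The inequality for all [i] determines the value, so independence of the approximating sequence
   never has to be discussed. *)
have /choice[rho hrho] : forall x, exists z, forall i, nm (z - r i) <= nm (x - s i).
  move=> x; have [i hi] := approx x.
  have mono m n : (m <= n)%N -> (2^-1 ^+ n : R) <= 2^-1 ^+ m.
    by move=> mn; rewrite ler_wiXn2l ?invr_ge0 ?invf_le1 ?ler1n.
  have [m n mn||z [hz _]] := @complete_nm _ (seqalg E) (fun m => r (i m)) (fun m => 2^-1 ^+ m).
  - apply: (le_trans (rB _ _)); apply: (le_trans (nm_tri x _ _)); rewrite (nm_sym _ x).
    by have := hi m; have := hi n; have := mono m n mn; lra.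
  - exact: half_pow_small.
  exists z => j; apply/ler_addgt0Pr => e e0.
  have e2 : 0 < e / 2 by rewrite divr_gt0.
  have [m me] := half_pow_small e2; move: (hz m) (rB j (i m)) (hi m) me.
  move: (nm_tri (r (i m)) z (r j)) (nm_tri x (s (i m)) (s j)).
  by rewrite (nm_sym (s (i m)) x); nm_lra.
have cvg_s x : exists i : nat -> nat,
    (fun m => s (i m)) @ \oo --> x /\ (fun m => r (i m)) @ \oo --> rho x.
  have [i hi] := approx x; exists i.
  have sx : (fun m => s (i m)) @ \oo --> x.
    apply/cvg_nmP => e /half_pow_small[N Ne]; exists N => // m /= Nm.
    apply: (lt_trans (hi m)); apply: le_lt_trans Ne.
    apply: (@le_trans _ _ (2^-1 ^+ m)); last first.
      by rewrite ler_wiXn2l ?invr_ge0 ?invf_le1 ?ler1n.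
    by rewrite ler_pdivrMr// ler_peMr// ?exprn_ge0 ?invr_ge0 ?ler1n.
  split => //; apply/cvg_nmP => e e0; move/cvg_nmP: sx => /(_ e e0).
  by apply: filterS => m; exact: le_lt_trans (hrho _ _).
exists rho; split; first split.
- move=> z x w.
  have [i [si ri]] := cvg_s x; have [j [sj rj]] := cvg_s w.
  have [l [sl rl]] := cvg_s (z *: x + w).
  have /choice[q hq] : forall m, exists q, cabs (z - c q) < 2^-1 ^+ m.
    by move=> m; apply: dc; rewrite exprn_gt0.
  have cz : (fun m => c (q m) : R[i]^o) @ \oo --> (z : R[i]^o).
    apply/(@cvg_nmP _ R[i]^o) => e /half_pow_small[N Ne]; exists N => // m /= Nm.
    apply: (lt_trans (hq m)); apply: le_lt_trans Ne.
    by rewrite ler_wiXn2l ?invr_ge0 ?invf_le1 ?ler1n.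
  apply/eqP; rewrite -subr_eq0; apply/eqP.
  apply: (@cvg_nm_le0 _ _ _ (fun m => r (l m) - (c (q m) *: r (i m) + r (j m)))
    (fun m => s (l m) - (c (q m) *: s (i m) + s (j m)))) => //.
    by apply: cvgB => //; apply: cvgD => //; exact: cvgZ.
  rewrite -[X in _ --> X](subrr (z *: x + w)).
  by apply: cvgB => //; apply: cvgD => //; exact: cvgZ.
- move=> x w.
  have [i [si ri]] := cvg_s x; have [j [sj rj]] := cvg_s w.
  have [l [sl rl]] := cvg_s (x ** w).
  apply/eqP; rewrite -subr_eq0; apply/eqP.
  apply: (@cvg_nm_le0 _ _ _ (fun m => r (l m) - r (i m) ** r (j m))
    (fun m => s (l m) - s (i m) ** s (j m))) => //.
    by apply: cvgB => //; exact: cvg_amul.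
  rewrite -[X in _ --> X](subrr (x ** w)).
  by apply: cvgB => //; exact: cvg_amul.
- move=> x.
  have [i [si ri]] := cvg_s x; have [l [sl rl]] := cvg_s (star x).
  apply/eqP; rewrite -subr_eq0; apply/eqP.
  apply: (@cvg_nm_le0 _ _ _ (fun m => r (l m) - star (r (i m)))
    (fun m => s (l m) - star (s (i m)))) => //.
    by apply: cvgB => //; exact: cvg_star.
  rewrite -[X in _ --> X](subrr (star x)).
  by apply: cvgB => //; exact: cvg_star.
- move=> x Dx; apply: nm_eq => e e0.
  have e2 : 0 < e / 2 by rewrite divr_gt0.
  have [i Di xi] := dsD x _ Dx e2.
  (* Nothing is assumed of [y]. Its continuity on [D] is inherited from [tau], as constant sequences
     do not decrease the norm. *)
  have cst_le (z : seqalg E) : nm z <= nm (cst_seq z).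
    apply/ler_addgt0Pr => d d0.
    have /nm_etaP /(_ _ d0) [N _ /(_ N (leqnn N))] := lexx (nm (cst_seq z)).
    by [].
  apply: (le_trans (nm_tri (r i) _ _)); have h3 := hrho x i.
  rewrite (rD i Di).
  have : nm (y (s i) - y x) <= nm (s i - x).
    apply: (le_trans (cst_le _)); rewrite (star_homB (@cst_seq_star_hom _ _)).
    rewrite -!tauD// -(star_homB htau); exact: nm_contractive.
  by rewrite (nm_sym _ x); move: h3 xi; rewrite (rD i Di); lra.
Qed.

End Reindexing.

Lemma pow_small (R : realType) (q e : R) : 0 <= q -> q < 1 -> 0 < e -> exists m, q ^+ m < e.
Proof.
move=> q0 q1 e0.
have /cvgr_norm_lt/(_ e) : (GRing.exp q : R ^nat) @ \oo --> (0 : R).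
  by apply: cvg_expr; rewrite ger0_norm.
rewrite normr0 => /(_ e0)[N _ /(_ N (leqnn N)) h].
by exists N; move: h; rewrite /= ger0_norm ?exprn_ge0.
Qed.

Lemma compact_finite_cover (G : topologicalGroupType) (N : G -> G -> Prop) :
  compact [set: G] -> (forall g, \forall h \near g, N g h) ->
  exists n (t : 'I_n.+1 -> G), forall h, exists i, N (t i) h.
Proof.
move=> /compact_near_coveringP cG hN.
(* Finite sequences directed by inclusion: the near-covering form of compactness then yields a
   finite subcover. *)
pose F := filter_from [set: seq G] (fun s0 => [set s : seq G | {subset s0 <= s}]).
have FF : Filter F.
  apply: filter_from_filter; first by exists [::].
  move=> s1 s2 _ _; exists (s1 ++ s2) => // s /= h.
  by split=> g gs; apply: h; rewrite mem_cat gs ?orbT.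
have [|s0 _ /(_ s0 (fun _ => id)) h0] := cG _ F (fun (s : seq G) h => exists2 g, g \in s & N g h) FF.
  move=> g _; exists ([set h | N g h], [set s : seq G | {subset [:: g] <= s}]); first split => //=.
  - exact: hN.
  - by exists [:: g].
  - by move=> [h s] /= [Ngh gs]; exists g => //; apply: gs; rewrite inE.
(* Adding [1] makes the family nonempty, so that it can be averaged over ['I_n.+1]. *)
pose s := 1%g :: s0.
exists (size s0), (fun i : 'I_(size s) => nth 1%g s i) => h.
have [g gs Ngh] := h0 h I.
have {}gs : g \in s by rewrite inE gs orbT.
by exists (Ordinal (etrans (index_mem g s) gs)); rewrite nth_index.
Qed.

(** * Averaging over a compact group *)

Section Averaging.
Variables (R : realType) (G : topologicalGroupType) (A : cstarAlgType R).
Variables (alpha : action G A).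
Hypothesis compG : compact [set: G].
Implicit Types (x y : A) (g h s : G).

Let hal g : star_hom (alpha g) := act_star_hom alpha g.

Lemma nm_act g x : nm (alpha g x) = nm x.
Proof.
apply: le_anti; rewrite nm_contractive//= -{1}[x](act1 alpha) -(mulVg g) actM.
exact: nm_contractive.
Qed.

Lemma nm_act_sub g x y : nm (alpha g x - alpha g y) = nm (x - y).
Proof. by rewrite -(star_homB (hal g)) nm_act. Qed.

(** Joint continuity at each pair [(g, s)] becomes uniform in [s] because the group is compact. *)
Lemma near_act_uniform x (e : R) g : 0 < e ->
  \forall h \near g, forall s, nm (alpha (h * s)%g x - alpha (g * s)%g x) <= e.
Proof.
move=> e0; have e2 : 0 < e / 2 by rewrite divr_gt0.
have /compact_near_coveringP cG := compG.
suff: \forall h \near nbhs g, [set: G] `<=`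
    (fun s => nm (alpha (h * s)%g x - alpha (g * s)%g x) <= e).
  by apply: filterS => h H s; exact: H.
apply: cG => s _.
have cm : {for (g, s), continuous (fun p : G * G => alpha (p.1 * p.2)%g x)}.
  apply: (@continuous_comp _ _ _ (fun p : G * G => (p.1 * p.2)%g) (fun g => alpha g x)).
    exact: mulg_continuous.
  exact: act_continuous.
move/cvg_nmP: cm => /(_ _ e2) [[U V] /= [Ug Vs] UV].
exists (V, U) => //= -[s' h] /= [Vs' Uh].
have := UV (h, s') (conj Uh Vs'); have := UV (g, s') (conj (nbhs_singleton Ug) Vs').
rewrite /= => h1 h2.
apply: (le_trans (nm_tri (alpha (g * s)%g x) _ _)); rewrite nm_sym; lra.
Qed.

Definition convex_pred (P : A -> Prop) := forall n (f : 'I_n.+1 -> A),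
  (forall i, P (f i)) -> P ((n.+1%:R^-1 : R)%:C *: \sum_i f i).

Lemma avg_cst n x : (n.+1%:R^-1 : R)%:C *: (\sum_(i < n.+1) x) = x.
Proof.
rewrite sumr_const card_ord -[x *+ _]scaler_nat scalerA.
by rewrite -(rmorph_nat (real_complex R)) -rmorphM mulVf ?pnatr_eq0// scale1r.
Qed.

Lemma convex_ball x (e : R) : convex_pred (fun y => nm (y - x) <= e).
Proof.
move=> n f h.
have -> : (n.+1%:R^-1 : R)%:C *: \sum_i f i - x =
    (n.+1%:R^-1 : R)%:C *: \sum_i (f i - x).
  by rewrite sumrB scalerBr avg_cst.
rewrite nmZR ger0_norm ?invr_ge0// ler_pdivrMl ?ltr0n//.
apply: (le_trans (nm_sum _ _ _)); apply: (le_trans (ler_sum _ (fun i _ => h i))).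
by rewrite sumr_const card_ord mulr_natl.
Qed.

Definition osc (D : R) x := forall g, nm (alpha g x - x) <= D.

Section Halving.
Variables (n : nat) (t : 'I_n.+1 -> G) (eta : R) (P : A -> Prop).
Hypothesis convP : convex_pred P.

(** The points [t i] give an [eta]-net of the orbit. The inner quantifier over [s] makes the
    property survive averaging, where right translates by the [t j] appear. *)
Definition equi x := forall g, exists i, forall s,
  nm (alpha (g * s)%g x - alpha (t i * s)%g x) <= eta.

Let avg x := (n.+1%:R^-1 : R)%:C *: \sum_i alpha (t i) x.

Let act_avg g x : alpha g (avg x) = (n.+1%:R^-1 : R)%:C *: \sum_i alpha (g * t i)%g x.
Proof.
rewrite (star_homZ (hal g)) (star_hom_sum (hal g)); congr (_ *: _).
by apply: eq_bigr => i _; rewrite actM.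
Qed.

Let avg_sub (f : 'I_n.+1 -> A) (h : 'I_n.+1 -> A) (e : R) :
  (forall i, nm (f i - h i) <= e) ->
  nm ((n.+1%:R^-1 : R)%:C *: \sum_i f i - (n.+1%:R^-1 : R)%:C *: \sum_i h i) <= e.
Proof.
move=> H; have := @convex_ball 0 e n (fun i => f i - h i).
by rewrite subr0 sumrB scalerBr; apply => i; rewrite subr0.
Qed.

Lemma equi_avg x : equi x -> equi (avg x).
Proof.
move=> ex g; have [i hi] := ex g; exists i => s.
by rewrite !act_avg; apply: avg_sub => j; rewrite -!mulgA.
Qed.

(** For each orbit point [alpha k x], one of the [n.+1] terms of the average is within [eta] of it
    and the others within [D], so the average is within [D'] of the whole orbit. Hence it is also
    within [D'] of its own translates, which are averages of orbit points. *)
Lemma osc_avg x (D : R) : eta <= D -> equi x -> osc D x ->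
  osc (eta + (1 - n.+1%:R^-1) * (D - eta)) (avg x).
Proof.
move=> eD ex oD.
set D' := _ + _ * _.
have near_orbit k : nm (avg x - alpha k x) <= D'.
  have [i hi] := ex k.
  have -> : avg x - alpha k x = (n.+1%:R^-1 : R)%:C *: \sum_j (alpha (t j) x - alpha k x).
    by rewrite sumrB scalerBr avg_cst.
  rewrite nmZR ger0_norm ?invr_ge0// ler_pdivrMl ?ltr0n//.
  apply: (le_trans (nm_sum _ _ _)); rewrite (bigD1 i)//=.
  apply: (@le_trans _ _ (eta + \sum_(j < n.+1 | j != i) D)).
    apply: lerD; first by have := hi 1%g; rewrite !mulg1 nm_sym.
    apply: ler_sum => j _.
    by rewrite -[t j](mulVKg k) actM nm_act_sub; exact: oD.
  have mE : n.+1%:R * D' = n.+1%:R * D - (D - eta).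
    rewrite /D'; have : (n.+1%:R : R) != 0 by rewrite pnatr_eq0.
    by move: (n.+1%:R : R) => m m0; field.
  by rewrite mE sumr_const cardC1 card_ord -[D *+ _]mulr_natl -natr1; lra.
move=> g; rewrite nm_sym act_avg.
rewrite -[X in nm (X - _)](avg_cst n).
by apply: avg_sub => i; exact: near_orbit.
Qed.

Lemma orbit_avg x : (forall g, P (alpha g x)) -> forall g, P (alpha g (avg x)).
Proof. by move=> h g; rewrite act_avg; apply: convP => i; exact: h. Qed.

Lemma osc_iter x (D : R) : 0 <= eta -> 0 <= D -> equi x -> osc D x ->
  (forall g, P (alpha g x)) -> forall k, exists y,
  [/\ osc (eta + (1 - n.+1%:R^-1) ^+ k * D) y, equi y & forall g, P (alpha g y)].
Proof.
move=> e0 D0 ex oD Px; have q0 : 0 <= 1 - n.+1%:R^-1 :> R.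
  by rewrite subr_ge0 invf_le1 ?ltr0n// ler1n.
elim=> [|k [y [oy ey Py]]].
  exists x; split=> // g; rewrite expr0 mul1r.
  by apply: (le_trans (oD g)); rewrite lerDr.
exists (avg y); split; [|exact: equi_avg|exact: orbit_avg].
have := osc_avg _ ey oy; rewrite lerDl mulr_ge0 ?exprn_ge0// => /(_ isT).
by rewrite [eta + _ - eta]addrAC subrr add0r mulrA -exprS.
Qed.

End Halving.

(** Averaging over a [D / 4]-net contracts the oscillation towards [D / 4], and the excess falls
    below [D / 4] after [k] rounds. The bound on [y - x] is carried along as part of the convex
    condition [P']. *)
Lemma osc_halve (P : A -> Prop) x (D : R) : convex_pred P -> 0 < D -> osc D x ->
  (forall g, P (alpha g x)) ->
  exists y, [/\ osc (D / 2) y, nm (y - x) <= D & forall g, P (alpha g y)].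
Proof.
move=> cP D0 oD Px; have D4 : 0 < D / 4 by rewrite divr_gt0.
have [n [t ht]] := compact_finite_cover compG (fun g => near_act_uniform x g D4).
pose P' y := P y /\ nm (y - x) <= D.
have cP' : convex_pred P'.
  move=> m f hf; split; first by apply: cP => i; exact: (hf i).1.
  by apply: convex_ball => i; exact: (hf i).2.
have P'x g : P' (alpha g x) by [].
have ex : equi t (D / 4) x by move=> g; have [i hi] := ht g; exists i.
have [|||k kq] := @pow_small R (1 - n.+1%:R^-1) 4^-1 _ _ _.
- by rewrite subr_ge0 invf_le1 ?ltr0n// ler1n.
- by rewrite gtrBl invr_gt0 ltr0n.
- by rewrite invr_gt0.
have [y [oy _ Py]] := osc_iter cP' (ltW D4) (ltW D0) ex oD P'x k.
exists y; split.
- by move=> g; apply: (le_trans (oy g)); nra.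
- by have := (Py 1%g).2; rewrite act1.
- by move=> g; have [] := Py g.
Qed.

(* Successive averages over finite subsets of [G] replace the Haar integral. *)
Theorem invariant_point (P : A -> Prop) x : closed [set y | P y] -> convex_pred P ->
  (forall g, P (alpha g x)) -> exists2 y, is_fixed alpha y & P y.
Proof.
move=> clP cP Px.
(* The initial oscillation is at most [2 * nm x]; adding [1] keeps the bound positive when
   [x = 0]. *)
pose D k : R := (2 * nm x + 1) * 2^-1 ^+ k.
have D0 k : 0 < D k by rewrite mulr_gt0 ?exprn_gt0// ltr_wpDl// mulr_ge0 ?nm_ge0.
have DS k : D k.+1 = D k / 2 by rewrite /D exprSr mulrA.
pose Q k y := osc (D k) y /\ forall g, P (alpha g y).
have /choice[f hf] : forall ky : nat * A, exists y, Q ky.1 ky.2 ->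
    Q ky.1.+1 y /\ nm (y - ky.2) <= D ky.1.
  move=> [k y] /=; have [[oy Py]|nQ] := pselect (Q k y); last by exists y.
  have [z [oz zy Pz]] := osc_halve cP (D0 k) oy Py.
  by exists z => _; split=> //; split=> //; rewrite DS.
pose u := fix u k := if k is k'.+1 then f (k', u k') else x.
have Qu k : Q k (u k).
  elim: k => [|k IH]; last by have [] := hf (k, u k) IH.
  split=> // g; apply: (le_trans (nmB _ _)); rewrite nm_act /D expr0; lra.
have uS k : nm (u k.+1 - u k) <= D k by have [] := hf (k, u k) (Qu k).
have uD m k : nm (u (m + k)%N - u m) <= 2 * D m - 2 * D (m + k)%N.
  elim: k => [|k IH]; first by rewrite addn0 !subrr nm0.
  rewrite addnS; apply: (le_trans (nm_tri (u (m + k)%N) _ _)).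
  by have := uS (m + k)%N; rewrite DS; lra.
have [m n mn|e e0|l [hl ul]] := @complete_nm _ A u (fun k => 2 * D k).
- rewrite -(subnKC mn); apply: (le_trans (uD _ _)).
  by have := D0 (m + (n - m))%N; lra.
- have e1 : 0 < e / (2 * (2 * nm x + 1)).
    by rewrite divr_gt0// mulr_gt0// ltr_wpDl// mulr_ge0 ?nm_ge0.
  have [m hm] := half_pow_small e1; exists m.
  move: hm; rewrite ltr_pdivlMr; first by rewrite /D; lra.
  by rewrite mulr_gt0// ltr_wpDl// mulr_ge0 ?nm_ge0.
exists l; last first.
  apply: (closed_cvg (fun y => P y) clP _ _ ul); apply: nearW => k.
  by have [_ /(_ 1%g)] := Qu k; rewrite act1.
move=> g; apply: nm_eq => e e0; have e4 : 0 < e / 4 by rewrite divr_gt0.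
have e1 : 0 < e / (8 * (2 * nm x + 1)).
  by rewrite divr_gt0// mulr_gt0// ltr_wpDl// mulr_ge0 ?nm_ge0.
have [m hm] := half_pow_small e1.
have Dm : 8 * D m < e.
  move: hm; rewrite ltr_pdivlMr; first by rewrite /D; lra.
  by rewrite mulr_gt0// ltr_wpDl// mulr_ge0 ?nm_ge0.
apply: (le_trans (nm_tri (alpha g (u m)) _ _)); rewrite nm_act_sub.
have := nm_tri (u m) (alpha g (u m)) l; have := (Qu m).1 g; have := hl m.
by rewrite (nm_sym (u m) l); have := D0 m; lra.
Qed.

End Averaging.

(** * Approximate units and absolute values *)

(* A reflexive decision procedure for identities that hold in all
   non-unital rings. *)
Inductive nc_expr :=
| NcVar of nat | NcZero | NcAdd of nc_expr & nc_expr | NcOpp of nc_expr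
| NcMul of nc_expr & nc_expr.

Section NonCommutativeRing.
Variables (R : realType) (A : starAlgType R) (env : seq A).
Local Notation v := (nth 0 env).

Fixpoint nc_eval (e : nc_expr) : A :=
  match e with
  | NcVar i => v i
  | NcZero => 0
  | NcAdd a b => nc_eval a + nc_eval b
  | NcOpp a => - nc_eval a
  | NcMul a b => nc_eval a ** nc_eval b
  end.

(** A nonempty word with its first letter kept apart: without a unit the empty word has no value. *)
Definition nc_mono := (nat * seq nat)%type.
Definition nc_mono_mul (m n : nc_mono) : nc_mono := (m.1, m.2 ++ n.1 :: n.2).
Definition nc_mono_eval (m : nc_mono) : A := foldl (fun x i => x ** v i) (v m.1) m.2.
Definition nc_prod (p q : seq nc_mono) := [seq nc_mono_mul m n | m <- p, n <- q].

(** The two lists hold the monomials of positive and of negative sign. Comparing crosswise sums, as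
    in [nc_ringP], takes care of cancellation. *)
Fixpoint nc_norm (e : nc_expr) : seq nc_mono * seq nc_mono :=
  match e with
  | NcVar i => ([:: (i, [::])], [::])
  | NcZero => ([::], [::])
  | NcAdd a b => let p := nc_norm a in let q := nc_norm b in (p.1 ++ q.1, p.2 ++ q.2)
  | NcOpp a => let p := nc_norm a in (p.2, p.1)
  | NcMul a b => let p := nc_norm a in let q := nc_norm b in
      (nc_prod p.1 q.1 ++ nc_prod p.2 q.2, nc_prod p.1 q.2 ++ nc_prod p.2 q.1)
  end.

Let S (p : seq nc_mono) : A := \sum_(m <- p) nc_mono_eval m.

Lemma nc_mono_mulE m n :
  nc_mono_eval (nc_mono_mul m n) = nc_mono_eval m ** nc_mono_eval n.
Proof.
case: m n => [i s] [j t]; rewrite /nc_mono_eval /nc_mono_mul /= foldl_cat /=.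
move: (foldl _ (v i) s) => x; elim/last_ind: t => //= t k IH.
by rewrite !foldl_rcons IH amulA.
Qed.

Lemma nc_prodE p q : S (nc_prod p q) = S p ** S q.
Proof.
rewrite /S /nc_prod big_allpairs_dep /= amul_suml; apply: eq_bigr => m _.
by rewrite amul_sumr; apply: eq_bigr => n _; exact: nc_mono_mulE.
Qed.

Lemma nc_normE e : nc_eval e = S (nc_norm e).1 - S (nc_norm e).2.
Proof.
have S_cat p q : S (p ++ q) = S p + S q by rewrite /S big_cat.
elim: e => [i||a IHa b IHb|a IHa|a IHa b IHb] /=; rewrite ?IHa ?IHb.
- by rewrite /S big_seq1 big_nil subr0.
- by rewrite /S !big_nil subr0.
- by rewrite !S_cat opprD addrACA.
- by rewrite opprB.
- rewrite !S_cat !nc_prodE amulBl !amulBr opprB opprD.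
  by rewrite [LHS]addrACA.
Qed.

Lemma nc_ringP a b :
  perm_eq ((nc_norm a).1 ++ (nc_norm b).2) ((nc_norm b).1 ++ (nc_norm a).2) ->
  nc_eval a = nc_eval b.
Proof.
move=> h; rewrite !nc_normE.
have : S ((nc_norm a).1 ++ (nc_norm b).2) = S ((nc_norm b).1 ++ (nc_norm a).2).
  exact: perm_big.
rewrite /S !big_cat /= => E; apply/eqP.
by rewrite subr_eq addrAC eq_sym subr_eq; apply/eqP/esym.
Qed.

End NonCommutativeRing.

Ltac nc_index x env :=
  lazymatch env with
  | ?y :: ?s => match constr:(tt) with
    | _ => let _ := match constr:(tt) with _ => unify x y end in constr:(0%N)
    | _ => let n := nc_index x s in constr:(n.+1)
    end
  end.

Ltac nc_mem x env :=
  lazymatch env with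
  | [::] => constr:(false)
  | ?y :: ?s => match constr:(tt) with
    | _ => let _ := match constr:(tt) with _ => constr_eq x y end in constr:(true)
    | _ => nc_mem x s
    end
  end.

Ltac nc_atoms t env :=
  lazymatch t with
  | 0 => env
  | ?a + ?b => let e := nc_atoms a env in nc_atoms b e
  | - ?a => nc_atoms a env
  | ?a ** ?b => let e := nc_atoms a env in nc_atoms b e
  | _ => let m := nc_mem t env in
    lazymatch m with true => env | false => constr:(t :: env) end
  end.

Ltac nc_reify t env :=
  lazymatch t with
  | 0 => constr:(NcZero)
  | ?a + ?b => let x := nc_reify a env in let y := nc_reify b env in constr:(NcAdd x y)
  | - ?a => let x := nc_reify a env in constr:(NcOpp x)
  | ?a ** ?b => let x := nc_reify a env in let y := nc_reify b env in constr:(NcMul x y)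
  | _ => let i := nc_index t env in constr:(NcVar i)
  end.

Ltac nc_ring :=
  lazymatch goal with
  | |- @eq ?T ?l ?r =>
    let e0 := nc_atoms l (@nil T) in
    let e := nc_atoms r e0 in
    let x := nc_reify l e in
    let y := nc_reify r e in
    refine (@nc_ringP _ _ e x y _); vm_compute; reflexivity
  end.

Section Contractions.
Variables (R : realType) (A : cstarAlgType R).
Implicit Types (d e x y z : A).

(* [1 - d^2 = (1 - b)^2] for the [b] of [sqs_limit], and [d + i (1 - b)] is a
   unitary of the unitization. *)
Lemma sub_sqr_contractive_lt d x : star d = d -> nm d < 1 ->
  nm (x - d ** d ** x) <= nm x.
Proof.
move=> sd d1; have d1' : `|d| < 1 by rewrite normE (ltcR _ 1).
have [b [sb db bE]] := sqs_limit sd (lexx _) d1'.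
have dE : d ** d = b + b - b ** b by rewrite -bE addrK.
have L (c : R[i]) y : (c^*)%R = - c -> c * c = -1 -> nm (d ** y + c *: (y - b ** y)) = nm y.
  move=> cc c2; apply/eqP; rewrite -(@eqrXn2 _ 2) ?nm_ge0//; apply/eqP.
  rewrite -!nm_cstar; congr (nm _); set t := star y.
  rewrite starD starM sd starZ cc starB starM sb -/t.
  set p := t - t ** b; set q := y - b ** y.
  rewrite amulDl !amulDr !amulZl !amulZr scalerA mulNr c2 opprK scale1r scaleNr.
  have -> : p ** (d ** y) = t ** d ** q.
    have -> : p ** (d ** y) = t ** d ** y - t ** (b ** d) ** y by rewrite /p; nc_ring.
    by rewrite -db /q; nc_ring.
  rewrite addrA addrK.
  have -> : t ** d ** (d ** y) = t ** (d ** d) ** y by nc_ring.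
  by rewrite dE /p /q; nc_ring.
(* Multiplication by [1 - b] is, up to ['i], half the difference of the two isometries supplied by
   [L]. *)
have B y : nm (y - b ** y) <= nm y.
  have i2 : 'i * 'i = -1 :> R[i] by rewrite -expr2 sqrCi.
  have h1 := L 'i y (conjCi _) i2.
  have h2 : nm (d ** y + (- 'i) *: (y - b ** y)) = nm y.
    by apply: L; rewrite ?mulrNN// rmorphN /= conjCi.
  have := nmB (d ** y + 'i *: (y - b ** y)) (d ** y + (- 'i) *: (y - b ** y)).
  rewrite h1 h2 opprD addrACA subrr add0r scaleNr opprK.
  set w := y - b ** y; have -> : 'i *: w + 'i *: w = ('i * (2 : R)%:C) *: w.
    by rewrite rmorph_nat -scalerDl mulr_natr.
  rewrite nmZ cabsM cabsR normr_nat.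
  have -> : cabs ('i : R[i]) = 1 by apply: complexI; rewrite -cabsE normCi.
  by lra.
have -> : x - d ** d ** x = (x - b ** x) - b ** (x - b ** x).
  by rewrite dE; nc_ring.
exact: le_trans (B _) (B _).
Qed.

(** The boundary case comes from [(1 - r) d], with [r] small enough for the correction to stay below
    [e]. *)
Lemma sub_sqr_contractive d x : star d = d -> nm d <= 1 ->
  nm (x - d ** d ** x) <= nm x.
Proof.
move=> sd d1; apply/ler_addgt0Pr => e e0.
pose M := nm (d ** d ** x) + 1.
have M0 : 0 < M by rewrite ltr_wpDl// nm_ge0.
pose r := Num.min 1 (e / (2 * M)).
have r0 : 0 < r by rewrite lt_min ltr01 divr_gt0// mulr_gt0.
have r1 : r <= 1 by rewrite ge_min lexx.
have re : r * (2 * M) <= e.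
  by rewrite -ler_pdivlMr ?mulr_gt0// /r ge_min lexx orbT.
have := @sub_sqr_contractive_lt ((1 - r)%:C *: d) x.
have t0 : 0 <= 1 - r by lra.
have rc : (((1 - r)%:C)^*)%R = (1 - r)%:C :> R[i] by apply/CrealP; rewrite complex_real.
rewrite starZ sd rc nmZR ger0_norm// => /(_ erefl).
have lt1 : (1 - r) * nm d < 1 by have := nm_ge0 d; nra.
move=> /(_ lt1); rewrite !amulZl !amulZr !amulZl scalerA -rmorphM => h.
have -> : x - d ** d ** x = (x - ((1 - r) * (1 - r))%:C *: (d ** d ** x))
    + (r * (r - 2))%:C *: (d ** d ** x).
  rewrite -addrA; congr (_ + _); rewrite -scaleNr -scalerDl -rmorphN -rmorphD.
  by rewrite -scaleN1r; congr (_ *: _); rewrite -(rmorphN1 (real_complex R)); congr (_%:C); ring.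
apply: (le_trans (nmD _ _)); rewrite nmZR lerD//.
have -> : `|r * (r - 2)| = r * (2 - r).
  by rewrite normrM ger0_norm ?ltW// distrC ger0_norm//; lra.
have := nm_ge0 (d ** d ** x); move: re; rewrite /M; nra.
Qed.

End Contractions.

Section ApproximateUnit.
Variables (R : realType) (A : cstarAlgType R).
Implicit Types (d e x y z : A).

(** States without a unitization that left multiplication by [1 - e] is a contraction. *)
Definition contractive e := forall x, nm (x - e ** x) <= nm x.

Lemma contractive_le2 e : contractive e -> nm e <= 2.
Proof.
move=> ce; apply: nm_mulP => // y; have := ce y.
have := nm_le_sub (e ** y) y; rewrite (nm_sym (e ** y)); lra.
Qed.

(** With [z] the image of [x] under [1 - star e], moving this factor across gives
    [star z ** z = star x ** (z - e ** z)]. *)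
Lemma contractive_star e : contractive e -> contractive (star e).
Proof.
move=> ce x; set z := x - star e ** x.
have [->|z0] := eqVneq (nm z) 0; first exact: nm_ge0.
rewrite -(@ler_pM2r _ (nm z)) ?lt_neqAle ?nm_ge0 ?andbT 1?eq_sym// -expr2 -nm_cstar.
have -> : star z ** z = star x ** (z - e ** z).
  by rewrite /z starB starM starK; nc_ring.
apply: (le_trans (nmM _ _)); rewrite nm_star; apply: ler_wpM2l; first exact: nm_ge0.
exact: ce.
Qed.

(** The new element is [1 - (1 - e') (1 - e)] written without a unit. *)
Lemma contractive_comp e e' : contractive e -> contractive e' ->
  contractive (e' + e - e' ** e).
Proof.
move=> ce ce' x; have -> : x - (e' + e - e' ** e) ** x = (x - e ** x) - e' ** (x - e ** x).
  by nc_ring.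
exact: le_trans (ce' _) (ce _).
Qed.

(* With [s = 1 - d^2], take [1 - e] to be the mean of [1, s, ..., s^n]; then
   [(1 - e) (1 - s)] telescopes. *)
Lemma approx_unit_sa d (eps : R) : star d = d -> nm d <= 1 -> 0 < eps ->
  exists2 e, contractive e & nm (d ** d - e ** (d ** d)) <= eps.
Proof.
move=> sd d1 eps0; pose D := d ** d.
have cD : contractive D by move=> x; exact: sub_sqr_contractive.
(* Here [1 - u n] is the [n]-th power of [s = 1 - d^2]. *)
pose u := fix u n := if n is m.+1 then D + u m - D ** u m else 0.
have cu n : contractive (u n).
  elim: n => [|n IH] /=; first by move=> x; rewrite amul0l subr0.
  exact: contractive_comp.
have uD n : u n ** D = D ** u n.
  elim: n => [|n IH] /=; first by rewrite amul0l amul0r.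
  have -> : (D + u n - D ** u n) ** D = D ** D + u n ** D - D ** (u n ** D) by nc_ring.
  by rewrite IH; nc_ring.
have eps2 : 0 <= 2 / eps by rewrite divr_ge0// ltW.
pose n := Num.Def.archi_bound (2 / eps).
have hn : 2 < n.+1%:R * eps.
  rewrite -ltr_pdivrMr//; apply: (lt_trans (archi_boundP eps2)).
  by rewrite ltr_nat.
pose r : R := n.+1%:R^-1.
have r0 : 0 <= r by rewrite invr_ge0.
have rs x : r%:C *: (\sum_(j < n.+1) x) = x.
  rewrite sumr_const card_ord -[x *+ _]scaler_nat scalerA.
  by rewrite -(rmorph_nat (real_complex R)) -rmorphM mulVf ?pnatr_eq0// scale1r.
exists (r%:C *: \sum_(j < n.+1) u j).
  move=> x; have -> : x - (r%:C *: \sum_(j < n.+1) u j) ** x =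
      r%:C *: \sum_(j < n.+1) (x - u j ** x).
    by rewrite sumrB scalerBr rs amulZl amul_suml.
  rewrite nmZR ger0_norm// ler_pdivrMl ?ltr0n//.
  apply: (le_trans (nm_sum _ _ _)); apply: (@le_trans _ _ (\sum_(j < n.+1) nm x)).
    by apply: ler_sum => j _; exact: cu.
  by rewrite sumr_const card_ord mulr_natl.
have -> : D - (r%:C *: \sum_(j < n.+1) u j) ** D = r%:C *: u n.+1.
  rewrite -{1}(rs D) amulZl amul_suml -scalerBr -sumrB; congr (_ *: _).
  elim: n.+1 => [|m IH]; first by rewrite big_ord0.
  by rewrite big_ord_recr IH /= uD; nc_ring.
rewrite nmZR ger0_norm// ler_pdivrMl ?ltr0n//.
exact: le_trans (contractive_le2 (cu _)) (ltW hn).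
Qed.

(** The self-adjoint case controls a square [d ** d]. The estimate [step] leads from there to
    [d = y ** star y] and then to [y], each time at the cost of a square root; hence the tolerance
    [eps ^+ 4]. *)
Lemma approx_unit1 y (eps : R) : 0 < eps ->
  exists2 e, contractive e & nm (y - e ** y) <= eps.
Proof.
move=> eps0; wlog y1 : y eps eps0 / nm y <= 1.
  move=> H; have y0 : 0 < nm y + 1 by rewrite ltr_wpDl ?nm_ge0.
  have yE : `|(nm y + 1)^-1| = (nm y + 1)^-1 by rewrite ger0_norm// invr_ge0 ltW.
  have [||e ce he] := H ((nm y + 1)^-1%:C *: y) (eps / (nm y + 1)).
  - by rewrite divr_gt0.
  - by rewrite nmZR yE ler_pdivrMl// mulr1 lerDl.
  exists e => //; move: he; rewrite amulZr -scalerBr nmZR yE.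
  by rewrite mulrC ler_pM2r// invr_gt0.
pose d := y ** star y.
have sd : star d = d by rewrite /d starM starK.
have d1 : nm d <= 1 by rewrite /d nm_cstarr expr_le1 ?nm_ge0.
have e4 : 0 < eps ^+ 4 by rewrite exprn_gt0.
have [e ce he] := approx_unit_sa sd d1 e4; exists e => //.
have step z : nm (z - e ** z) ^+ 2 <= nm (z ** star z - e ** (z ** star z)).
  rewrite -nm_cstarr; set w := z ** star z.
  have -> : (z - e ** z) ** star (z - e ** z) = star ((star w - star (e ** w)) - e ** (star w - star (e ** w))).
    by rewrite !starB !starM !starB !starM !starK; nc_ring.
  by rewrite nm_star; apply: (le_trans (ce _)); rewrite -starB nm_star.
have h1 := step y; have := step d; rewrite sd -/d => h2.
suff : nm (y - e ** y) ^+ 4 <= eps ^+ 4.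
  by rewrite ler_pXn2r// ?nnegrE ?nm_ge0 ?ltW.
apply: le_trans he; apply: le_trans h2; rewrite (exprM _ 2 2).
by rewrite ler_sqr ?nnegrE ?sqr_ge0 ?nm_ge0.
Qed.

(** The new unit [e'] is chosen for the residual [y - e ** y]; being contractive, it does not spoil
    the estimates already reached by [e]. *)
Lemma approx_unit (F : seq A) (eps : R) : 0 < eps ->
  exists2 e, contractive e & forall x, x \in F -> nm (x - e ** x) <= eps.
Proof.
move=> eps0; elim: F => [|y F [e ce he]].
  by exists 0 => // x; rewrite amul0l subr0.
have [e' ce' he'] := approx_unit1 (y - e ** y) eps0.
exists (e' + e - e' ** e); first exact: contractive_comp.
have E x : x - (e' + e - e' ** e) ** x = (x - e ** x) - e' ** (x - e ** x) by nc_ring.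
move=> x; rewrite inE E => /orP[/eqP ->|/he hx]; first exact: he'.
exact: le_trans (ce' _) hx.
Qed.

Lemma approx_unit_star (F : seq A) (eps : R) : 0 < eps ->
  exists e, [/\ contractive e, star e = e
    & forall x, x \in F -> nm (x - e ** x) <= eps].
Proof.
move=> eps0; have [e ce he] := approx_unit F eps0.
exists (star e + e - star e ** e); split.
- by apply: contractive_comp => //; exact: contractive_star.
- by rewrite starB starD starM starK [e + _]addrC.
move=> x /he hx; have -> : x - (star e + e - star e ** e) ** x =
  (x - e ** x) - star e ** (x - e ** x) by nc_ring.
exact: le_trans (contractive_star ce _) hx.
Qed.

Lemma closed_lipschitz_ball (f : A -> A) (C eps : R) :
  (forall b b', nm (f b - f b') <= C * nm (b - b')) -> closed [set b | nm (f b) <= eps].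
Proof.
move=> hf b cb; apply/ler_addgt0Pr => e e0.
have C1 : 0 < `|C| + 1 by rewrite ltr_wpDl.
have [b' /= hb' bb'] := closure_nm cb (divr_gt0 e0 C1).
rewrite addrC; apply: (le_trans (nm_le_sub _ (f b'))); apply: lerD => //.
apply: (le_trans (hf _ _)); move: bb'; rewrite ltr_pdivlMr//.
have := nm_ge0 (b - b'); have := ler_norm C; nra.
Qed.

Lemma convex_affine_ball (f : A -> A) z (eps : R) : linear f ->
  convex_pred (fun b => nm (z - f b) <= eps).
Proof.
move=> lf n t ht; have f0 : f 0 = 0.
  by have := lf (-1) 0 0; rewrite scaler0 addr0 scaleN1r addNr.
have fZ c x : f (c *: x) = c *: f x by have := lf c x 0; rewrite f0 !addr0.
have fD : {morph f : x y / x + y} by move=> x y; have := lf 1 x y; rewrite !scale1r.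
have := @convex_ball R A z eps n (fun i => f (t i)).
rewrite nm_sym fZ (big_morph f fD f0); apply => i.
by rewrite nm_sym.
Qed.

End ApproximateUnit.

(** The unit [e] is chosen for a finite net [S] of the orbits of [F] and of its adjoints, so that
    every translate of [e] is good for [F]. Being good is closed and convex, and [invariant_point]
    yields a fixed element. *)
Lemma invariant_approx_unit (R : realType) (G : topologicalGroupType)
    (A : cstarAlgType R) (alpha : action G A) (F : seq A) (eps : R) :
  compact [set: G] -> 0 < eps -> exists e, [/\ is_fixed alpha e, nm e <= 2
    & forall x, x \in F -> nm (x - e ** x) <= eps /\ nm (x - x ** e) <= eps].
Proof.
move=> cG eps0; have e2 : 0 < eps / 2 by rewrite divr_gt0.
pose good (e x : A) := nm (x - e ** x) <= eps /\ nm (x - x ** e) <= eps.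
have net x : exists S : seq A, forall g, exists2 z, z \in S & nm (alpha g x - z) <= eps / 2.
  have [n [t ht]] := compact_finite_cover cG (fun g => near_act_uniform alpha cG x g e2).
  exists [seq alpha (t i) x | i : 'I_n.+1] => g; have [i hi] := ht g.
  exists (alpha (t i) x); first by apply/mapP; exists i; rewrite ?mem_enum.
  by have := hi 1%g; rewrite !mulg1.
have [S hS] : exists S : seq A, forall x, x \in F -> forall g,
    (exists2 z, z \in S & nm (alpha g x - z) <= eps / 2) /\
    (exists2 z, z \in S & nm (alpha g (star x) - z) <= eps / 2).
  elim: F => [|x F [S hS]]; first by exists [::].
  have [S1 h1] := net x; have [S2 h2] := net (star x).
  exists (S1 ++ S2 ++ S) => y; rewrite inE => /orP[/eqP ->|yF] g.
    have [z1 z1S hz1] := h1 g; have [z2 z2S hz2] := h2 g.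
    by split; [exists z1|exists z2] => //; rewrite !mem_cat ?z1S ?z2S ?orbT.
  have [[z1 z1S hz1] [z2 z2S hz2]] := hS y yF g.
  by split; [exists z1|exists z2] => //; rewrite !mem_cat ?z1S ?z2S ?orbT.
have [e [ce se he]] := approx_unit_star S e2.
have orbit x : (exists2 z, z \in S & nm (x - z) <= eps / 2) -> nm (x - e ** x) <= eps.
  move=> [z /he hz xz]; have -> : x - e ** x = (z - e ** z) + ((x - z) - e ** (x - z)).
    by nc_ring.
  by apply: (le_trans (nmD _ _)); have := ce (x - z); lra.
pose P (b : A) := nm b <= 2 /\ forall x, x \in F -> good b x.
have [||g|b fb [b2 hb]] := @invariant_point _ _ _ alpha cG P e.
- have -> : [set b : A | P b] = [set b : A | nm b <= 2] `&` \bigcap_(x in [set` F])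
      ([set b : A | nm (x - b ** x) <= eps] `&` [set b : A | nm (x - x ** b) <= eps]).
    apply/seteqP; split=> b; first by move=> [h1 h2]; split.
    by move=> [h1 h2]; split=> // x xF; have [] := h2 x xF.
  apply: closedI; first by apply: (@closed_lipschitz_ball _ _ id 1) => b b'; rewrite mul1r.
  apply: closed_bigI => x _; apply: closedI.
    apply: (@closed_lipschitz_ball _ _ (fun b => x - b ** x) (nm x)) => b b'.
    have -> : x - b ** x - (x - b' ** x) = - ((b - b') ** x) by nc_ring.
    by rewrite nmN mulrC; exact: nmM.
  apply: (@closed_lipschitz_ball _ _ (fun b => x - x ** b) (nm x)) => b b'.
  have -> : x - x ** b - (x - x ** b') = - (x ** (b - b')) by nc_ring.
  by rewrite nmN; exact: nmM.
- move=> n f hf; split.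
    by rewrite -nmN -sub0r; apply: (@convex_affine_ball _ _ id 0) => // i; rewrite sub0r nmN; exact: (hf i).1.
  move=> x xF; split.
    by apply: (@convex_affine_ball _ _ (fun b => b ** x)) => [c y z|i]; [rewrite amulDl amulZl|exact: ((hf i).2 x xF).1].
  by apply: (@convex_affine_ball _ _ (fun b => x ** b)) => [c y z|i]; [rewrite amulDr amulZr|exact: ((hf i).2 x xF).2].
- have hal := act_star_hom alpha g.
  split; first by rewrite nm_act; exact: contractive_le2.
  have inv x : x = alpha g (alpha g^-1%g x) by rewrite -actM mulgV act1.
  move=> x xF; have [h1 h2] := hS x xF g^-1%g; split.
    by rewrite {1 2}(inv x) -(star_homM hal) -(star_homB hal) nm_act; exact: orbit.
  rewrite -nm_star starB starM -(star_homS hal) se {1 2}(inv (star x)).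
  by rewrite -(star_homM hal) -(star_homB hal) nm_act; exact: orbit.
by exists b.
Qed.

Lemma invariant_approx_unit_seq (R : realType) (G : topologicalGroupType)
    (A : cstarAlgType R) (alpha : action G A) :
  compact [set: G] -> separable_set [set: A] ->
  exists e : nat -> A, [/\ forall n, is_fixed alpha (e n), forall n, nm (e n) <= 2
    & forall x, (fun n => e n ** x) @ \oo --> x /\ (fun n => x ** e n) @ \oo --> x].
Proof.
move=> cG sepA; have [s [ds _]] := @dense_seq R A [set: A] sepA I.
have /choice[e he] : forall n, exists e, [/\ is_fixed alpha e, nm e <= 2
    & forall x, x \in [seq s i | i <- iota 0 n] ->
      nm (x - e ** x) <= 2^-1 ^+ n /\ nm (x - x ** e) <= 2^-1 ^+ n].
  by move=> n; apply: invariant_approx_unit => //; rewrite exprn_gt0.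
exists e; split=> [n|n|x]; [by have [] := he n|by have [] := he n|].
have key eps : 0 < eps -> \forall n \near \oo,
    nm (x - e n ** x) < eps /\ nm (x - x ** e n) < eps.
  move=> eps0; have e6 : 0 < eps / 6 by rewrite divr_gt0.
  have [i hi] := ds x _ e6; have [m hm] := half_pow_small e6.
  exists (maxn i.+1 m) => // n /=; rewrite geq_max => /andP[iN mN].
  have [_ e2 /(_ (s i))] := he n; rewrite map_f ?mem_iota//= => /(_ isT)[h1 h2].
  have hmn : 2^-1 ^+ n < eps / 6.
    by apply: le_lt_trans hm; rewrite ler_wiXn2l ?invr_ge0 ?invf_le1 ?ler1n.
  have q : nm (x - s i) * nm (e n) <= eps / 3.
    by have := nm_ge0 (x - s i); have := nm_ge0 (e n); nra.
  split.
    have -> : x - e n ** x = (x - s i) + (s i - e n ** s i) - e n ** (x - s i).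
      by nc_ring.
    apply: (le_lt_trans (nmB _ _)); have := nmD (x - s i) (s i - e n ** s i).
    by have := nmM (e n) (x - s i); lra.
  have -> : x - x ** e n = (x - s i) + (s i - s i ** e n) - (x - s i) ** e n.
    by nc_ring.
  apply: (le_lt_trans (nmB _ _)); have := nmD (x - s i) (s i - s i ** e n).
  by have := nmM (x - s i) (e n); lra.
by split; apply/cvg_nmP => eps /key; apply: filterS => n [].
Qed.

(** * Square roots by iteration *)

Section SqrtIteration.
Variable R : realType.
Implicit Types (s mu : R).

(* Converges to [1 - sqrt (1 - s)]. *)
Fixpoint sqrt_it s n : R :=
  if n is m.+1 then 2^-1 * (s + sqrt_it s m ^+ 2) else 0.

Local Notation sigma := (sqrt_it 1).

Lemma sqrt_it_bound mu n : 0 <= mu -> mu <= 1 ->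
  0 <= sqrt_it (1 - mu ^+ 2) n <= 1 - mu.
Proof.
move=> m0 m1; elim: n => [|n /andP[h0 h1]] /=; first by rewrite lexx subr_ge0.
by apply/andP; split; nra.
Qed.

Lemma sigma_bound n : 0 <= sigma n <= 1.
Proof.
by have := sqrt_it_bound n (lexx 0) ler01; rewrite expr0n /= !subr0.
Qed.

Lemma sigma_leS n : sigma n <= sigma n.+1.
Proof. by have /= := sqr_ge0 (1 - sigma n); nra. Qed.

Lemma sigma_le m n : (m <= n)%N -> sigma m <= sigma n.
Proof.
move=> /subnKC <-; elim: (n - m)%N => [|k IH]; first by rewrite addn0.
by rewrite addnS; apply: le_trans IH (sigma_leS _).
Qed.

(** Each step raises [sigma] by half the square of [1 - sigma]; if this gap stayed above [e], the
    sequence would exceed [1]. *)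
Lemma sigma_cvg (e : R) : 0 < e -> exists m, 1 - sigma m < e.
Proof.
move=> e0.
apply: contrapT => /forallNP H.
have {}H m : e <= 1 - sigma m by rewrite leNgt; apply/negP; exact: H.
have grow m : m%:R * (e ^+ 2 / 2) <= sigma m.
  elim: m => [|m IH]; first by rewrite mul0r.
  have := H m; rewrite -natr1 /=; move: IH; move: (m%:R : R) (sigma m) => k t; nra.
have e2 : 0 <= (e ^+ 2 / 2)^-1 by rewrite invr_ge0 divr_ge0// sqr_ge0.
have := archi_boundP e2; move: (Num.Def.archi_bound _) => m.
have := grow m; have /andP[_] := sigma_bound m; rewrite -[(_ / 2)^-1]mul1r ltr_pdivrMr.
  by lra.
by rewrite divr_gt0// exprn_gt0.
Qed.

End SqrtIteration.

Section AbsoluteValue.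
Variables (R : realType) (A : cstarAlgType R) (d : A).
Local Notation sigma := (sqrt_it (1 : R)).
Local Notation "r *:r x" := ((r : R)%:C *: x) (at level 40).

(** In the unitization, [sigma n - abs_it n] is the square root iteration for [1 - d^2], whose limit
    is [1 - |d|]. Splitting off the scalar part keeps the iteration in [A]; [f n] is left
    multiplication by the whole iterate. *)
Fixpoint abs_it n : A :=
  if n is m.+1 then
    2^-1 *:r (d ** d) + sigma m *:r abs_it m - 2^-1 *:r (abs_it m ** abs_it m)
  else 0.

Let f n x := sigma n *:r x - abs_it n ** x.

Hypotheses (sd : star d = d) (d1 : nm d <= 1).

Let k : R[i] := (2^-1 : R)%:C.
Let kk : k + k = 1.
Proof. by rewrite /k -rmorphD -(rmorph1 (real_complex R)); congr (_%:C); lra. Qed.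

Let fS n x : f n.+1 x = k *: (x - d ** d ** x) + k *: f n (f n x).
Proof.
rewrite /f /= -/k; set g := (sigma n)%:C; set c := abs_it n.
have -> : (2^-1 * (1 + sigma n ^+ 2))%:C = k + k * g * g.
  by rewrite rmorphM rmorphD rmorph1 rmorphXn /= -/k -/g; ring.
have ge : g = k * g + k * g by rewrite -mulrDl kk mul1r.
rewrite scalerDl amulBl amulDl !amulZl scalerBr [c ** (_ - _)]amulBr amulZr.
rewrite !scalerBr !scalerA ?mulrA.
have -> : g *: (c ** x) = (k * g) *: (c ** x) + (k * g) *: (c ** x).
  by rewrite -scalerDl -ge.
by rewrite !amulA; nc_ring.
Qed.

Let nmk (x : A) : nm (k *: x) = 2^-1 * nm x.
Proof. by rewrite nmZR ger0_norm// invr_ge0. Qed.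

Let f_le n x : nm (f n x) <= sigma n * nm x.
Proof.
elim: n x => [|n IH] x; first by rewrite /f /= scale0r amul0l subrr nm0 mul0r.
rewrite fS; apply: (le_trans (nmD _ _)); rewrite !nmk.
have h1 := sub_sqr_contractive x sd d1.
have := IH (f n x); have := IH x; have /andP[s0 s1] := sigma_bound R n.
have := nm_ge0 x; rewrite /=; nra.
Qed.

(** The scalar iteration majorizes that of operators: both increments factor like a difference of
    squares, and the factors are bounded by induction and by [f_le]. *)
Let f_sub n x : nm (f n.+1 x - f n x) <= (sigma n.+1 - sigma n) * nm x.
Proof.
elim: n x => [|n IH] x.
  have -> : f 0 x = 0 by rewrite /f /= scale0r amul0l subrr.
  by rewrite !subr0 f_le.
have fB m y z : f m (y - z) = f m y - f m z by rewrite /f scalerBr; nc_ring.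
have -> : f n.+2 x - f n.+1 x =
    k *: (f n.+1 (f n.+1 x - f n x)) + k *: (f n.+1 (f n x) - f n (f n x)).
  rewrite fB -scalerDr subrKA {1}fS [X in _ - X]fS opprD addrACA subrr add0r.
  by rewrite -scalerBr.
apply: (le_trans (nmD _ _)); rewrite !nmk.
have := IH (f n x); have := IH x; have := f_le n x; have := f_le n.+1 (f n.+1 x - f n x).
have /andP[s0 _] := sigma_bound R n; have := sigma_leS R n.
have /andP[s0' _] := sigma_bound R n.+1.
have -> : sigma n.+2 - sigma n.+1 =
  2^-1 * ((sigma n.+1 - sigma n) * (sigma n.+1 + sigma n)).
  have E m : sqrt_it (1 : R) m.+1 = 2^-1 * (1 + sigma m ^+ 2) by [].
  rewrite (E n.+1) [X in _ - X = _](E n).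
  by move: (sigma n.+1) (sigma n) => t s; field.
move: (sigma n.+1) s0' (sigma n) s0 => t t0 s s0 st h1 h2 h3 h4.
have n0 := nm_ge0 x.
have := @ler_wpM2l _ t t0 _ _ h3; have ts : 0 <= t - s by lra.
have := @ler_wpM2l _ _ ts _ _ h2.
lra.
Qed.

Let abs_sub m n : (m <= n)%N -> nm (abs_it n - abs_it m) <= 2 * (1 - sigma m).
Proof.
have step j : nm (abs_it j.+1 - abs_it j) <= 2 * (sigma j.+1 - sigma j).
  have st := sigma_leS R j.
  apply: nm_mulP => [|y]; first by rewrite mulr_ge0// subr_ge0.
  have -> : (abs_it j.+1 - abs_it j) ** y =
      (sigma j.+1 - sigma j) *:r y - (f j.+1 y - f j y).
    by rewrite /f rmorphB scalerBl; nc_ring.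
  apply: (le_trans (nmB _ _)); rewrite nmZR ger0_norm ?subr_ge0//.
  by have := f_sub j y; lra.
move=> /subnKC <-; apply: (@le_trans _ _ (2 * (sigma (m + (n - m)) - sigma m))).
  elim: (n - m)%N => [|j IH]; first by rewrite addn0 !subrr nm0 mulr0.
  rewrite addnS; apply: (le_trans (nm_tri (abs_it (m + j)) _ _)).
  by have := step (m + j)%N; lra.
by have /andP[_] := sigma_bound R (m + (n - m)); lra.
Qed.

Let sigmaC : (fun n => (sigma n)%:C : R[i]^o) @ \oo --> (1 : R[i]^o).
Proof.
apply/(@cvg_nmP _ R[i]^o) => e /sigma_cvg[N hN]; exists N => // n /= Nn.
rewrite (_ : nm _ = `|1 - sigma n|).
  by have := sigma_le R Nn; have /andP[_ ?] := sigma_bound R n; rewrite ger0_norm ?subr_ge0//; lra.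
by rewrite -cabsR rmorphB rmorph1.
Qed.

Lemma star_abs_it n : star (abs_it n) = abs_it n.
Proof.
have rc (r : R) : ((r%:C)^*)%R = r%:C :> R[i] by apply/CrealP; rewrite complex_real.
elim: n => [|n IH] /=; first exact: star0.
by rewrite starB starD !starZ !starM IH sd !rc.
Qed.

Lemma abs_it_comm y n : y ** (d ** d) = (d ** d) ** y -> y ** abs_it n = abs_it n ** y.
Proof.
move=> yd; elim: n => [|n IH] /=; first by rewrite amul0l amul0r.
rewrite amulBr amulDr !amulZr yd IH amulBl amulDl !amulZl.
by congr (_ - _ *: _); rewrite amulA IH -amulA IH amulA.
Qed.

Lemma abs_it_eigen (C : cstarAlgType R) (h : A -> C) z (mu : R) n : star_hom h ->
  h (d ** d) ** z = (mu ^+ 2) *:r z ->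
  h (abs_it n) ** z = (sigma n - sqrt_it (1 - mu ^+ 2) n) *:r z.
Proof.
move=> hh hd; elim: n => [|n IH] /=.
  by rewrite (star_hom0 hh) subrr amul0l scale0r.
rewrite (star_homB hh) (star_homD hh) !(star_homZ hh) (star_homM hh (abs_it n)).
rewrite amulBl amulDl !amulZl hd -amulA IH amulZr IH !scalerA -scalerDl -scalerBl.
by congr (_ *: _); rewrite -!rmorphM -rmorphD -rmorphB; congr (_%:C); field.
Qed.

Lemma abs_it_lim : exists w, [/\ star w = w, w ** w = d ** d,
    forall y, y ** (d ** d) = (d ** d) ** y -> y ** w = w ** y
  & forall (C : cstarAlgType R) (h : A -> C) z (mu : R), star_hom h -> 0 < mu -> mu <= 1 ->
      h (d ** d) ** z = (mu ^+ 2) *:r z -> h w ** z = mu *:r z].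
Proof.
have [|e e0|w [hw cw]] := @complete_nm _ A abs_it (fun m => 2 * (1 - sigma m)).
- exact: abs_sub.
- have [m hm] := sigma_cvg (divr_gt0 e0 (ltr0n R 2)); exists m; lra.
have uq := cvg_unique (@norm_hausdorff _ A).
exists w; split.
- apply: (uq _ _ _ _ _ cw); have := cvg_star cw.
  by under eq_fun do rewrite star_abs_it.
- have c1 : (fun n => abs_it n.+1) @ \oo --> w by rewrite (cvg_shiftS abs_it).
  have c2 : (fun n => abs_it n.+1) @ \oo --> k *: (d ** d) + w - k *: (w ** w).
    apply: cvgB; last by apply: cvgZr; exact: cvg_amul.
    apply: cvgD; first exact: cvg_cst.
    by rewrite -[X in _ --> X]scale1r; apply: cvgZ.
  have h : 0 = k *: (d ** d) - k *: (w ** w).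
    by apply: (@addIr _ w); rewrite add0r addrAC; exact: (uq _ _ _ _ c1 c2).
  have /eqP := esym h; rewrite -scalerBr scaler_eq0 => /orP[/eqP k0|].
    by move: kk; rewrite k0 addr0 => /eqP; rewrite eq_sym oner_eq0.
  by rewrite subr_eq0 => /eqP ->.
- move=> y yd; have c1 : (fun n => y ** abs_it n) @ \oo --> y ** w.
    by apply: cvg_amul => //; exact: cvg_cst.
  have c2 : (fun n => abs_it n ** y) @ \oo --> w ** y.
    by apply: cvg_amul => //; exact: cvg_cst.
  have E : (fun n => y ** abs_it n) = (fun n => abs_it n ** y).
    by apply/funext => n; exact: abs_it_comm.
  by rewrite E in c1; exact: (uq _ _ _ _ c1 c2).
move=> C h z mu hh mu0 mu1 hd.
have c1 : (fun n => h (abs_it n) ** z) @ \oo --> h w ** z.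
  apply: cvg_amul; last exact: cvg_cst.
  apply/cvg_nmP => e e0; move/cvg_nmP: cw => /(_ e e0); apply: filterS => n.
  by rewrite -(star_homB hh); apply: le_lt_trans; exact: nm_contractive.
suff c2 : (fun n => h (abs_it n) ** z) @ \oo --> mu *:r z.
  exact: (cvg_unique (@norm_hausdorff _ C) c1 c2).
have -> : (fun n => h (abs_it n) ** z) =
    (fun n => (sigma n - sqrt_it (1 - mu ^+ 2) n) *:r z).
  by apply/funext => n; exact: abs_it_eigen.
apply: cvgZl.
apply/(@cvg_nmP _ R[i]^o) => e e0.
have [N1 h1] := sigma_cvg (divr_gt0 e0 (ltr0n R 2)).
have q1 : 1 - mu < 1 by lra.
have q0 : 0 <= 1 - mu by lra.
have [N2 h2] := pow_small q0 q1 (divr_gt0 e0 (ltr0n R 2)).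
exists (maxn N1 N2) => // n /=; rewrite geq_max => /andP[N1n N2n].
have pb := sqrt_it_bound n (ltW mu0) mu1.
(* The gap to the limit [1 - mu] is multiplied by the mean of [1 - mu] and the current value, hence
   by at most [1 - mu]. *)
have geo m : 1 - mu - sqrt_it (1 - mu ^+ 2) m <= (1 - mu) ^+ m.
  elim: m => [|m IH]; first by rewrite expr0 /=; lra.
  have /andP[p0 p1] := sqrt_it_bound m (ltW mu0) mu1.
  have := ler_wpM2l q0 IH; rewrite -exprS /=.
  move: ((1 - mu) ^+ m.+1) (sqrt_it _ m) p0 p1 => a p p0 p1 hap.
  by have := sqr_ge0 (1 - mu - p); nra.
have g1 := geo n; have g2 : (1 - mu) ^+ n <= (1 - mu) ^+ N2 by rewrite ler_wiXn2l// ltW.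
have s1 := sigma_le R N1n; have /andP[_ s2] := sigma_bound R n.
rewrite (_ : nm _ = `|mu - (sigma n - sqrt_it (1 - mu ^+ 2) n)|).
  by move/andP: pb => [p0 p1]; rewrite ltr_norml; apply/andP; split; lra.
by rewrite -cabsR [in RHS]rmorphB.
Qed.

End AbsoluteValue.

(** The last clause is the fragment of functional calculus that lifting matrix units requires: [h]
    will be a quotient map, and [z] an element on which [h d] acts as a scalar of absolute value
    [mu]. *)
Theorem abs_exists (R : realType) (A : cstarAlgType R) (d : A) : star d = d ->
  exists w, [/\ star w = w, w ** w = d ** d,
    forall y, y ** (d ** d) = (d ** d) ** y -> y ** w = w ** y
  & forall (C : cstarAlgType R) (h : A -> C) z (mu : R), star_hom h -> 0 < mu ->
      h (d ** d) ** z = (mu ^+ 2)%:C *: z -> h w ** z = mu%:C *: z].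
Proof.
move=> sd; pose r := nm d + 1.
have r0 : 0 < r by rewrite ltr_wpDl ?nm_ge0.
have rc (t : R) : ((t%:C)^*)%R = t%:C :> R[i] by apply/CrealP; rewrite complex_real.
have rr : r%:C * r^-1%:C = 1 :> R[i].
  by rewrite -rmorphM mulfV ?gt_eqF// rmorph1.
pose d' := r^-1%:C *: d.
have sd' : star d' = d' by rewrite starZ sd rc.
have d1 : nm d' <= 1.
  have rV : `|r^-1| = r^-1 by rewrite ger0_norm// invr_ge0 ltW.
  by rewrite /d' nmZR rV ler_pdivrMl// mulr1 lerDl.
have d2 : d' ** d' = (r^-1%:C * r^-1%:C) *: (d ** d) by rewrite amulZl amulZr scalerA.
have [w [sw ww cw ew]] := abs_it_lim sd' d1.
exists (r%:C *: w); split.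
- by rewrite starZ sw rc.
- rewrite amulZl amulZr scalerA ww d2 scalerA mulrACA.
  by rewrite rr mul1r scale1r.
- by move=> y yd; rewrite amulZr amulZl cw// d2 amulZr amulZl yd.
move=> C h z mu hh mu0 hd.
have [->|z0] := eqVneq z 0; first by rewrite amul0r scaler0.
have d2z : h (d' ** d') ** z = ((mu / r) ^+ 2)%:C *: z.
  rewrite d2 (star_homZ hh) amulZl hd scalerA; congr (_ *: _).
  by rewrite -!rmorphM; congr (_%:C); field; rewrite gt_eqF.
have m0 : 0 < mu / r by rewrite divr_gt0.
(* As [z] is nonzero, [(mu / r) ^+ 2] is an eigenvalue of the contraction [h (d' ** d')]. *)
have m1 : mu / r <= 1.
  have m0' := ltW m0; suff : (mu / r) ^+ 2 <= 1 by rewrite expr_le1.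
  have nz : 0 < nm z.
    by rewrite lt_neqAle nm_ge0 eq_sym andbT; apply: contra z0 => /eqP/nm_eq0 ->.
  suff : (mu / r) ^+ 2 * nm z <= 1 * nm z by rewrite ler_pM2r.
  have <- : `|(mu / r) ^+ 2| = (mu / r) ^+ 2 by rewrite ger0_norm// sqr_ge0.
  rewrite -nmZR -d2z mul1r; apply: (le_trans (nmM _ _)); rewrite ler_piMl ?nm_ge0//.
  apply: (le_trans (nm_contractive hh _)); apply: (le_trans (nmM _ _)).
  by have := nm_ge0 d'; nra.
rewrite (star_homZ hh) amulZl (ew _ _ _ _ hh m0 m1 d2z) scalerA; congr (_ *: _).
by rewrite -rmorphM; congr (_%:C); field; rewrite gt_eqF.
Qed.

(** * Lifts of the Rokhlin homomorphism *)

Section ContinuousOrbits.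
Variables (R : realType) (G : topologicalGroupType) (A : cstarAlgType R).
Variable alpha : action G A.
Let hal g : star_hom (alpha g) := act_star_hom alpha g.

Lemma linf_alphaP (a : subalg (linf A)) : linf_alpha alpha a <->
  forall g (e : R), 0 < e ->
    \forall h \near g, forall n, nm (alpha g (val a n) - alpha h (val a n)) < e.
Proof.
split=> [ca g e e0|ha g B].
  have /= := ca g [set f | forall n, nm (alpha g (val a n) - f n) < e]; apply.
  apply/uniform_nbhs; exists [set xy : A * A | nm (xy.1 - xy.2) < e]; split=> [|f /= h n].
    rewrite -entourage_ballE; exists (e%:C : R[i]); first by rewrite /= ltr0C.
    by move=> [x y]; rewrite /= -ball_normE /= normE ltcR.
  exact: h.
move=> /uniform_nbhs [E [entE EB]].
move: entE; rewrite -entourage_ballE => -[e /= e0 eE].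
have eE' := ge0_complexE (ltW e0).
have re0 : 0 < complex.Re e by rewrite -ltr0C -eE'.
apply: filterS (ha g _ re0) => h hh; apply: EB => n _ /=; apply: eE.
by rewrite /= -ball_normE /= normE eE' ltcR; exact: hh.
Qed.

Lemma linf_alphaL (c : R[i]) a b : linf_alpha alpha a -> linf_alpha alpha b ->
  linf_alpha alpha (c *: a + b).
Proof.
move=> /linf_alphaP ha /linf_alphaP hb; apply/linf_alphaP => g e e0.
have c1 : 0 < cabs c + 1 by rewrite ltr_wpDl ?cabs_ge0.
have e2 : 0 < e / 2 by rewrite divr_gt0.
apply: filterS2 (ha g _ (divr_gt0 e2 c1)) (hb g _ e2) => h h1 h2 n.
have -> : val (c *: a + b) n = c *: val a n + val b n by [].
rewrite !(star_homP (hal _)) opprD addrACA -scalerBr.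
apply: (le_lt_trans (nmD _ _)); rewrite nmZ (splitr e); apply: ler_ltD => //.
have := h1 n; rewrite ltr_pdivlMr//; have := nm_ge0 (alpha g (val a n) - alpha h (val a n)).
have := cabs_ge0 c; nra.
Qed.

Lemma linf_alphaM a b : linf_alpha alpha a -> linf_alpha alpha b ->
  linf_alpha alpha (a ** b).
Proof.
move=> /linf_alphaP ha /linf_alphaP hb; apply/linf_alphaP => g e e0.
have /linf_nmP[M hM] := subalgP a; have /linf_nmP[N hN] := subalgP b.
have e2 : 0 < e / 2 by rewrite divr_gt0.
have M1 : 0 < `|M| + 1 by rewrite ltr_wpDl.
have N1 : 0 < `|N| + 1 by rewrite ltr_wpDl.
apply: filterS2 (ha g _ (divr_gt0 e2 N1)) (hb g _ (divr_gt0 e2 M1)) => h h1 h2 n.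
have -> : val (a ** b) n = val a n ** val b n by [].
rewrite !(star_homM (hal _)).
set x := alpha g _; set y := alpha g _; set x' := alpha h _; set y' := alpha h _.
have -> : x ** y - x' ** y' = (x - x') ** y + x' ** (y - y') by nc_ring.
have nx : nm x' <= `|M|.
  by apply: (le_trans (nm_contractive (hal h) _)); apply: le_trans (ler_norm M).
have ny : nm y <= `|N|.
  by apply: (le_trans (nm_contractive (hal g) _)); apply: le_trans (ler_norm N).
have := h1 n; have := h2 n; rewrite !ltr_pdivlMr// -/x -/y -/x' -/y' => q1 q2.
apply: (le_lt_trans (nmD _ _)).
have := nmM (x - x') y; have := nmM x' (y - y').
have := nm_ge0 (x - x'); have := nm_ge0 (y - y'); have := nm_ge0 x'; have := nm_ge0 y.
nra.
Qed.

Lemma linf_alpha_cst (x : A) : linf_alpha alpha (mksub (Defs.bounded_cst x)).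
Proof.
apply/linf_alphaP => g e e0; have /cvg_nmP/(_ e e0) := @act_continuous _ _ _ alpha x g.
by apply: filterS => h.
Qed.

Lemma linf_alpha_fixed a : (forall n, is_fixed alpha (val a n)) -> linf_alpha alpha a.
Proof.
move=> fa; apply/linf_alphaP => g e e0; apply: nearW => h n.
by rewrite !fa subrr nm0.
Qed.

Lemma seqalg_alphaL (c : R[i]) x y : seqalg_alpha alpha x -> seqalg_alpha alpha y ->
  seqalg_alpha alpha (c *: x + y).
Proof.
move=> [a ha <-] [b hb <-]; exists (c *: a + b); first exact: linf_alphaL.
by rewrite (star_homP (@eta_star_hom _ _)).
Qed.

Lemma seqalg_alphaM x y : seqalg_alpha alpha x -> seqalg_alpha alpha y ->
  seqalg_alpha alpha (x ** y).
Proof.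
move=> [a ha <-] [b hb <-]; exists (a ** b); first exact: linf_alphaM.
by rewrite (star_homM (@eta_star_hom _ _)).
Qed.

Lemma seqalg_alpha_cst x : seqalg_alpha alpha (cst_seq x).
Proof. by exists (mksub (Defs.bounded_cst x)) => //; exact: linf_alpha_cst. Qed.

Lemma seqalg_alpha0 : seqalg_alpha alpha 0.
Proof. by rewrite -(star_hom0 (@cst_seq_star_hom R A)); exact: seqalg_alpha_cst. Qed.

End ContinuousOrbits.

(* [X f] is a lift of the image of [f] under the Rokhlin homomorphism; its
   relations only hold after multiplication by elements of [A]. *)
Record rokhlin_lift (R : realType) (G : topologicalGroupType) (A : cstarAlgType R)
    (alpha : action G A) := RokhlinLift {
  rl :> subalg (CG R G) -> seqalg A;
  rl_comm : forall f a, rl f ** cst_seq a = cst_seq a ** rl f;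
  rl_lin : forall c f h a, rl (c *: f + h) ** cst_seq a = (c *: rl f + rl h) ** cst_seq a;
  rl_mul : forall f h a, rl (f ** h) ** cst_seq a = rl f ** rl h ** cst_seq a;
  rl_star : forall f a, rl (star f) ** cst_seq a = star (rl f) ** cst_seq a;
  rl_act : forall g f a, rl (left_translate g f) ** cst_seq a =
    alpha_inf alpha g (rl f) ** cst_seq a;
  rl_one : forall a, rl (CG1 R G) ** cst_seq a = cst_seq a;
  rl_cont : forall f, seqalg_alpha alpha (rl f)
}.

(** The Rokhlin property is used for [D = A]. The image of [1] is a unit only for F_alpha, whereas
    [rl_one] concerns [A]; the two are linked by [u], the class of an approximate unit of fixed
    elements. It lies in F_alpha, and multiplication by [u] fixes the elements of [A]. *)
Lemma rokhlin_lift_exists (R : realType) (G : topologicalGroupType)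
    (A : cstarAlgType R) (alpha : action G A) :
  compact [set: G] -> separable_set [set: A] -> Rokhlin_property alpha ->
  exists X : rokhlin_lift alpha, True.
Proof.
move=> cG sepA rok.
pose D : starSub A := @StarSub _ A (fun=> True) I (fun _ _ _ _ _ => I)
  (fun _ _ _ _ => I) (fun _ _ => I).
pose Dinv g d (_ : D d) : D (alpha g d) := I.
have [|phi [hphi aphi uphi ephi]] := rok D _ sepA Dinv.
  exact: closedT.
have hk : star_hom (@kappa R A D) := qpi_star_hom _.
have /choice[X hX] : forall f, exists x : subalg (commutant D),
    seqalg_alpha alpha (val x) /\ kappa x = phi f.
  by move=> f; have [x h1 h2] := aphi f; exists x.
have kE (x y : subalg (commutant D)) (a : A) : kappa x = kappa y ->
    val x ** cst_seq a = val y ** cst_seq a.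
  move=> /qpiP /(_ a I) [h _]; apply/eqP; rewrite -subr_eq0 -amulBl.
  by apply/eqP.
have hv : star_hom (val : subalg (commutant D) -> seqalg A) := subval_star_hom _.
have [e [fe e2 ce]] := @invariant_approx_unit_seq _ _ _ alpha cG sepA.
have be : linf A e by apply/linf_nmP; exists 2.
pose u : seqalg A := eta (mksub be).
have h2 := @eta_star_hom R A.
have ue a : u ** cst_seq a = cst_seq a.
  rewrite /u /cst_seq -(star_homM h2); apply/eta_eqP => eps eps0.
  have [/cvg_nmP/(_ _ eps0) h _] := ce a.
  by apply: filterS h => n; rewrite nm_sym => /ltW.
have eu a : cst_seq a ** u = cst_seq a.
  rewrite /u /cst_seq -(star_homM h2); apply/eta_eqP => eps eps0.
  have [_ /cvg_nmP/(_ _ eps0) h] := ce a.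
  by apply: filterS h => n; rewrite nm_sym => /ltW.
have cu : commutant D u by move=> a _; rewrite ue eu.
unshelve eexists; last by [].
apply: (@RokhlinLift _ _ _ alpha (fun f => val (X f))).
- by move=> f a; exact: (subalgP (X f) a I).
- move=> c f h a; rewrite -(star_homP hv); apply: kE.
  by rewrite (star_homP hk) !(hX _).2 (star_homP hphi).
- move=> f h a; rewrite -(star_homM hv); apply: kE.
  by rewrite (star_homM hk) !(hX _).2 (star_homM hphi).
- move=> f a; rewrite -(star_homS hv); apply: kE.
  by rewrite (star_homS hk) !(hX _).2 (star_homS hphi).
- move=> g f a; rewrite -[alpha_inf _ _ _]/(val (alpha_commutant Dinv g (X f))).
  by apply: kE; rewrite -F_actE !(hX _).2 ephi.
- move=> a; have [|h _] := uphi (kappa (mksub cu)).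
    exists (mksub cu) => //; exists (mksub be) => //.
    by apply: linf_alpha_fixed => n; exact: fe.
  rewrite -(hX (CG1 R G)).2 -(star_homM hk) in h.
  have := kE _ _ a h; rewrite (star_homM hv) -amulA.
  by rewrite [val (mksub cu)]/= ue.
- by move=> f; exact: (hX f).1.
Qed.

(** Polynomial against exponential growth, at the exponents reached by repeated squaring. *)
Lemma pow_vs_exp (K : nat) : exists j, ((2 ^ j.+1).+1 ^ K <= 2 ^ (2 ^ j.+1))%N.
Proof.
exists (2 * K)%N; set j := (2 * K)%N.
have h1 : ((2 ^ j.+1).+1 <= 2 ^ j.+2)%N.
  by rewrite [(2 ^ j.+2)%N]expnS mul2n -addnn -addn1 leq_add2l expn_gt0.
have [->|K0] := posnP K; first by rewrite expn0 expn_gt0.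
apply: (@leq_trans ((2 ^ j.+2) ^ K)%N); first by rewrite leq_exp2r.
rewrite -expnM leq_exp2l// /j expnS mul2n -addnn expnD.
have K2 : (K < 2 ^ K)%N by exact: ltn_expl.
by move: (2 ^ K)%N K2 => t; nia.
Qed.

(** * The homomorphism from C(G) (x) A and its norm *)

Section Amplification.
Variables (R : realType) (G : topologicalGroupType) (A : cstarAlgType R).
Variables (alpha : action G A) (X : rokhlin_lift alpha).
Implicit Types (f h : G -> R) (a b : A).

Lemma continuous_complex f : continuous f -> CG R G (fun g => (f g)%:C).
Proof.
move=> cf g; apply/(@cvg_nmP _ R[i]^o) => e e0.
have /cvgrPdist_lt/(_ e e0) := cf g; apply: filterS => h.
by rewrite -cabsR rmorphB.
Qed.

(* The image of [f (x) a] under the homomorphism from [C(G) (x) A] to the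
   sequence algebra; [0] when [f] is not continuous. *)
Definition tensor f a : seqalg A :=
  match pselect (continuous f) with
  | left cf => X (mksub (continuous_complex cf)) ** cst_seq a
  | right _ => 0
  end.

Let hc := @cst_seq_star_hom R A.

Lemma tensorE f a (cf : continuous f) : tensor f a = X (mksub (continuous_complex cf)) ** cst_seq a.
Proof.
by rewrite /tensor; case: pselect => // cf'; congr (X _ ** _); apply/val_inj.
Qed.

Lemma tensor_linearr f (c : R[i]) a b : tensor f (c *: a + b) = c *: tensor f a + tensor f b.
Proof.
rewrite /tensor; case: pselect => [cf|_]; last by rewrite scaler0 addr0.
by rewrite (star_homP hc) amulDr amulZr.
Qed.

Lemma tensorD f a b : tensor f (a + b) = tensor f a + tensor f b.
Proof. by rewrite -[a]scale1r tensor_linearr !scale1r. Qed.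

Lemma tensor0r f : tensor f 0 = 0.
Proof. by apply: (addrI (tensor f 0)); rewrite -tensorD !addr0. Qed.

Lemma tensorB f a b : tensor f (a - b) = tensor f a - tensor f b.
Proof. by rewrite -scaleN1r addrC tensor_linearr scaleN1r addrC. Qed.

Lemma tensor_sumr f (I : finType) (P : pred I) (F : I -> A) :
  tensor f (\sum_(i | P i) F i) = \sum_(i | P i) tensor f (F i).
Proof. exact: (big_morph (tensor f) (tensorD f) (tensor0r f)). Qed.

Lemma continuousZD (r : R) f h : continuous f -> continuous h ->
  continuous (fun g => r * f g + h g).
Proof.
move=> cf ch g; apply: (@cvgD _ R^o); last exact: ch.
by apply: cvgM; [exact: cvg_cst|exact: cf].
Qed.

Lemma continuousM2 f h : continuous f -> continuous h -> continuous (fun g => f g * h g).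
Proof. by move=> cf ch g; apply: cvgM; [exact: cf|exact: ch]. Qed.

Lemma tensor_linearl (r : R) f h a : continuous f -> continuous h ->
  tensor (fun g => r * f g + h g) a = r%:C *: tensor f a + tensor h a.
Proof.
move=> cf ch; rewrite (tensorE a (continuousZD (r := r) cf ch)) (tensorE a cf) (tensorE a ch).
rewrite -amulZl -amulDl -rl_lin; congr (X _ ** _); apply/val_inj/funext => g /=.
by rewrite rmorphD rmorphM.
Qed.

Lemma tensorM f h a b : continuous f -> continuous h ->
  tensor f a ** tensor h b = tensor (fun g => f g * h g) (a ** b).
Proof.
move=> cf ch; rewrite (tensorE _ (continuousM2 cf ch)) (tensorE a cf) (tensorE b ch).
rewrite amulA -(amulA (X _)) -rl_comm !amulA -(amulA _ (cst_seq a)) -(star_homM hc).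
rewrite -rl_mul; congr (X _ ** _); apply/val_inj/funext => g /=.
by rewrite rmorphM.
Qed.

Lemma tensorS f a : star (tensor f a) = tensor f (star a).
Proof.
rewrite /tensor; case: pselect => [cf|_]; last by rewrite star0.
rewrite rl_comm starM -(star_homS hc) -rl_star; congr (X _ ** _).
apply/val_inj/funext => g /=; by apply/CrealP; rewrite complex_real.
Qed.

Lemma continuous_translate f (g : G) : continuous f -> continuous (fun h : G => f (g^-1 * h)%g).
Proof.
move=> cf x; apply: (@continuous_comp _ _ _ (fun h : G => (g^-1 * h)%g) f); last exact: cf.
apply: (@continuous_comp _ _ _ (fun h : G => ((g^-1)%g, h)) (fun p => (p.1 * p.2)%g)).
  by apply: cvg_pair; [exact: cvg_cst|exact: cvg_id].
exact: mulg_continuous.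
Qed.

Lemma tensor_act f (g : G) a : continuous f ->
  alpha_inf alpha g (tensor f a) = tensor (fun h : G => f (g^-1 * h)%g) (alpha g a).
Proof.
move=> cf; have hi : star_hom (alpha_inf alpha g) := seqalg_map_star_hom (act_star_hom alpha g).
rewrite (tensorE a cf) (tensorE _ (continuous_translate (g := g) cf)) (star_homM hi).
rewrite /alpha_inf seqalg_map_cst -/(alpha_inf alpha g) -rl_act; congr (X _ ** _).
exact/val_inj.
Qed.

Lemma tensor1 a : tensor (fun=> 1) a = cst_seq a.
Proof.
have c1 : continuous (fun _ : G => 1 : R) by exact: cst_continuous.
rewrite (tensorE a c1) -[RHS](rl_one X); congr (X _ ** _); apply/val_inj/funext => g /=.
by rewrite rmorph1.
Qed.

Lemma tensor_cont f a : seqalg_alpha alpha (tensor f a).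
Proof.
rewrite /tensor; case: pselect => [cf|_]; last exact: seqalg_alpha0.
apply: seqalg_alphaM; [exact: rl_cont|exact: seqalg_alpha_cst].
Qed.

(** The function [f + i k] has modulus one, so [p + 'i *: q] and [p - 'i *: q] both have the norm of
    [cst_seq a], and [p] is their mean. *)
Lemma tensor_le1 f a : continuous f -> (forall g, `|f g| <= 1) -> nm (tensor f a) <= nm a.
Proof.
move=> cf f1; pose k g := Num.sqrt (1 - f g * f g).
have ck : continuous k.
  have c1 : continuous (fun t : G => 1 - f t * f t : R).
    by move=> g; apply: (@cvgB _ R^o); [exact: cvg_cst|apply: cvgM; exact: cf].
  by move=> g; exact: (continuous_comp (c1 g) (@sqrt_continuous R _)).
have kk g : k g * k g = 1 - f g * f g.
  rewrite -expr2 sqr_sqrtr// subr_ge0.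
  by have := f1 g; rewrite ler_norml => /andP[]; nra.
pose p := tensor f a; pose q := tensor k a.
have N (c : R[i]) : (c^*)%R = - c -> c * c = -1 -> nm (p + c *: q) = nm (cst_seq a).
  move=> cc c2; apply/eqP; rewrite -(@eqrXn2 _ 2) ?nm_ge0//; apply/eqP.
  rewrite -!nm_cstar; congr (nm _); rewrite starD starZ cc.
  rewrite amulDl !amulDr !amulZl !amulZr scalerA mulNr c2 opprK scale1r scaleNr.
  rewrite /p /q !tensorS !tensorM//.
  have -> : (fun g => k g * f g) = (fun g => f g * k g) by apply/funext => g; rewrite mulrC.
  rewrite addrA addrK -(star_homS hc) -(star_homM hc) -tensor1.
  have -> : (fun _ : G => 1) = (fun g => 1 * (f g * f g) + k g * k g).
    by apply/funext => g; rewrite kk mul1r addrC subrK.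
  by rewrite tensor_linearl ?scale1r//; exact: continuousM2.
have ca : nm (cst_seq a) <= nm a := nm_contractive hc a.
have i2 : 'i * 'i = -1 :> R[i] by rewrite -expr2 sqrCi.
have h1 := N 'i (conjCi _) i2.
have h2 : nm (p + (- 'i) *: q) = nm (cst_seq a).
  by apply: N; rewrite ?mulrNN// rmorphN /= conjCi.
have := nmD (p + 'i *: q) (p + (- 'i) *: q).
rewrite h1 h2 addrACA scaleNr subrr addr0.
have -> : p + p = (2 : R)%:C *: p by rewrite rmorph_nat scaler_nat mulr2n.
by rewrite nmZR ger0_norm// -/p; move: ca; clear h1 h2; nm_lra.
Qed.

Lemma tensor_le f a (M : R) : continuous f -> 0 < M -> (forall g, `|f g| <= M) ->
  nm (tensor f a) <= M * nm a.
Proof.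
move=> cf M0 fM.
have c0 : continuous (fun _ : G => 0 : R) by exact: cst_continuous.
have cf' : continuous (fun g => M^-1 * f g).
  by move=> g; apply: cvgM; [exact: cvg_cst|exact: cf].
have P0 : tensor (fun=> 0) a = 0.
  have := tensor_linearl 0 a c0 c0; have -> : (fun g : G => 0 * 0 + 0 : R) = (fun=> 0).
    by apply/funext => g; rewrite mul0r addr0.
  rewrite rmorph0 scale0r add0r => _.
  have := tensor_linearl 1 a c0 c0; have -> : (fun g : G => 1 * 0 + 0 : R) = (fun=> 0).
    by apply/funext => g; rewrite mulr0 addr0.
  by rewrite scale1r => /eqP; rewrite -subr_eq0 opprD addNKr oppr_eq0 => /eqP.
have -> : f = (fun g => M * (M^-1 * f g) + 0).
  by apply/funext => g; rewrite addr0 mulVKf ?gt_eqF.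
have MM : `|M| = M by rewrite ger0_norm// ltW.
rewrite tensor_linearl// P0 addr0 nmZR MM ler_pM2l//.
apply: tensor_le1 => // g; rewrite normrM normfV MM.
by rewrite ler_pdivrMl// mulr1.
Qed.

End Amplification.

Lemma continuous_prod (R : realType) (G : topologicalGroupType) (I : Type) (s : seq I)
    (F : I -> G -> R) : (forall i, continuous (F i)) ->
  continuous (fun g => \prod_(i <- s) F i g).
Proof.
move=> cF; elim: s => [|i s IH].
  have -> : (fun g => \prod_(i <- [::]) F i g) = (fun=> 1).
    by apply/funext => g; rewrite big_nil.
  exact: cst_continuous.
have -> : (fun g => \prod_(j <- i :: s) F j g) = (fun g => F i g * \prod_(j <- s) F j g).
  by apply/funext => g; rewrite big_cons.
exact: continuousM2.
Qed.

Lemma continuous_pow (R : realType) (G : topologicalGroupType) (f : G -> R) n :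
  continuous f -> continuous (fun g => f g ^+ n).
Proof.
move=> cf; elim: n => [|n IH]; first by under eq_fun do rewrite expr0; exact: cst_continuous.
by under eq_fun do rewrite exprS; exact: continuousM2.
Qed.

(* The norm of [C(G) (x) A] dominates the seminorm induced by [PX]: the
   [n]-th power of [z = \sum_i e_i c_i] expands into words in the [e_i c_i],
   which commutativity of the [e_i] groups into polynomially many monomials,
   each of norm at most [eps ^+ n]. *)
Section PowerTrick.
Variables (R : realType) (G : topologicalGroupType) (A : cstarAlgType R).
Variables (alpha : action G A) (X : rokhlin_lift alpha).
Variables (I : finType) (e : I -> G -> R) (eps : R).
Hypotheses (ce : forall i, continuous (e i)) (e0 : forall i g, 0 <= e i g).
Hypotheses (e1 : forall g, \sum_i e i g = 1) (eps0 : 0 < eps).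
Local Notation PX := (tensor X).

Let mon (m : {ffun I -> nat}) g := \prod_i e i g ^+ m i.

Let mon_continuous m : continuous (mon m).
Proof. by apply: continuous_prod => i; exact: continuous_pow. Qed.

Let mon_ge0 m g : 0 <= mon m g.
Proof. by apply: prodr_ge0 => i _; exact: exprn_ge0. Qed.

Definition words n (z : seqalg A) := exists (J : finType) (t : J -> {ffun I -> nat}) (C : J -> A),
  [/\ forall j i, (t j i <= n)%N, forall j, nm (C j) <= eps ^+ n,
      z = \sum_j PX (mon (t j)) (C j) & forall g, \sum_j mon (t j) g = 1].

Lemma words1 (c : I -> A) : (forall i, nm (c i) <= eps) -> words 1 (\sum_i PX (e i) (c i)).
Proof.
move=> hc; exists I, (fun i => [ffun k => (k == i) : nat]), c.
have monE i : mon [ffun k => (k == i) : nat] = e i.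
  apply/funext => g; rewrite /mon (bigD1 i)//= ffunE eqxx expr1 big1 ?mulr1// => k ki.
  by rewrite ffunE (negbTE ki) expr0.
split=> [j i|j||g].
- by rewrite ffunE leq_b1.
- by rewrite expr1.
- by apply: eq_bigr => i _; rewrite monE.
- by under eq_bigr do rewrite monE.
Qed.

Lemma wordsM n n' z z' : words n z -> words n' z' -> words (n + n') (z ** z').
Proof.
move=> [J [t [C [ht hC -> ht1]]]] [J' [t' [C' [ht' hC' -> ht1']]]].
have monD (m m' : {ffun I -> nat}) : mon [ffun i => m i + m' i]%N = (fun g => mon m g * mon m' g).
  by apply/funext => g; rewrite /mon -big_split; apply: eq_bigr => i _; rewrite ffunE exprD.
exists (J * J')%type, (fun p => [ffun i => t p.1 i + t' p.2 i]%N), (fun p => C p.1 ** C' p.2).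
split=> [[j j'] i|[j j']||g].
- by rewrite ffunE leq_add.
- by apply: (le_trans (nmM _ _)); rewrite exprD ler_pM ?nm_ge0.
- rewrite amul_suml -(pair_bigA _ (fun j j' => PX (mon [ffun i => t j i + t' j' i]%N) (C j ** C' j')))/=.
  apply: eq_bigr => j _; rewrite amul_sumr; apply: eq_bigr => j' _.
  by rewrite tensorM// monD.
- rewrite -(pair_bigA _ (fun j j' => mon [ffun i => t j i + t' j' i]%N g))/=.
  rewrite -[RHS](ht1 g); apply: eq_bigr => j _.
  by under eq_bigr do rewrite monD; rewrite -mulr_sumr ht1' mulr1.
Qed.

Lemma wordsS n z : words n z -> words n (star z).
Proof.
move=> [J [t [C [ht hC -> ht1]]]]; exists J, t, (fun j => star (C j)); split=> // [j|].
  by rewrite nm_star.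
by rewrite star_sum; apply: eq_bigr => j _; rewrite tensorS.
Qed.

(** There are at most [n.+1 ^ #|I|] distinct monomials. If [k] words share the monomial [T], then
    [k T <= 1] because all the monomials sum to one; the factor [1 / k] compensates the sum of their
    [k] coefficients. *)
Lemma words_le n z : words n z -> nm z <= n.+1%:R ^+ #|I| * eps ^+ n.
Proof.
move=> [J [t [C [ht hC -> ht1]]]].
pose p j : {ffun I -> 'I_n.+1} := [ffun i => inord (t j i)].
rewrite (partition_big p xpredT)//=; apply: (le_trans (nm_sum _ _ _)).
have bnd m : nm (\sum_(j | p j == m) PX (mon (t j)) (C j)) <= eps ^+ n.
  pose T : {ffun I -> nat} := [ffun i => m i : nat].
  have tE j : p j == m -> t j = T.
    move=> /eqP pm; apply/ffunP => i; rewrite ffunE -pm ffunE inordK// ltnS; exact: ht.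
  rewrite (eq_bigr (fun j => PX (mon T) (C j))); last by move=> j /tE ->.
  rewrite -tensor_sumr; set k := #|[pred j | p j == m]|.
  have [k0|k0] := posnP k.
    rewrite big1 ?tensor0r ?nm0 ?exprn_ge0 ?ltW// => j pj.
    by move/card0_eq: k0 => /(_ j); rewrite !inE pj.
  have kR : 0 < k%:R :> R by rewrite ltr0n.
  have sC : nm (\sum_(j | p j == m) C j) <= k%:R * eps ^+ n.
    apply: (le_trans (nm_sum _ _ _)); apply: (@le_trans _ _ (\sum_(j | p j == m) eps ^+ n)).
      by apply: ler_sum => j _; exact: hC.
    by rewrite sumr_const mulr_natl.
  have mT g : `|mon T g| <= k%:R^-1.
    rewrite ger0_norm// -[leRHS]mul1r ler_pdivlMr// mulr_natr -[leRHS](ht1 g).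
    rewrite -sumr_const (bigID (fun j => p j == m) xpredT)/=.
    rewrite -[leLHS]addr0; apply: lerD; last by apply: sumr_ge0.
    by rewrite le_eqVlt; apply/orP; left; apply/eqP/eq_bigr => j /tE ->.
  have kV : 0 < k%:R^-1 :> R by rewrite invr_gt0.
  apply: (le_trans (@tensor_le _ _ _ _ X _ _ _ (@mon_continuous T) kV mT)).
  by rewrite ler_pdivrMl.
apply: (le_trans (ler_sum _ (fun m _ => bnd m))).
by rewrite sumr_const -[X in X <= _]mulr_natl card_ffun card_ord natrX.
Qed.

(** Powers of the self-adjoint [star z ** z] are taken, since their norms are exact powers of
    [nm z]. The factor [2] absorbs the polynomial factor at a single exponent given by
    [pow_vs_exp]. *)
Lemma tensor_sum_le (c : I -> A) : (forall i, nm (c i) <= eps) ->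
  nm (\sum_i PX (e i) (c i)) <= 2 * eps.
Proof.
move=> hc; set z := \sum_i _.
pose y := fix y j := if j is i.+1 then y i ** y i else star z ** z.
have ys j : star (y j) = y j.
  by elim: j => [|j IH] /=; rewrite starM ?starK ?IH.
have yn j : nm (y j) = nm z ^+ (2 ^ j.+1).
  elim: j => [|j IH]; first by rewrite /= nm_cstar.
  by rewrite /= -{1}ys nm_cstar IH -exprM -expnSr.
have yw j : words (2 ^ j.+1) (y j).
  elim: j => [|j IH]; first by apply: (@wordsM 1 1); [apply: wordsS|]; exact: words1.
  by rewrite /= expnS mul2n -addnn; exact: wordsM.
have [j hj] := pow_vs_exp #|I|.
have := words_le (yw j); rewrite yn => h; rewrite leNgt; apply/negP => zl.
have N0 : (0 < 2 ^ j.+1)%N by rewrite expn_gt0.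
have lt : (2 * eps) ^+ (2 ^ j.+1) < nm z ^+ (2 ^ j.+1).
  by rewrite ltr_pXn2r// ?nnegrE ?nm_ge0// mulr_ge0// ltW.
have := lt_le_trans lt h; rewrite exprMn ltr_pM2r ?exprn_gt0//.
by rewrite -!natrX ltr_nat ltnNge hj.
Qed.

End PowerTrick.

(** * Images of continuous functions from G to A *)

Section Representation.
Variables (R : realType) (G : topologicalGroupType) (A : cstarAlgType R).
Variables (alpha : action G A) (X : rokhlin_lift alpha).
Hypothesis compG : compact [set: G].
Local Notation PX := (tensor X).
Implicit Types (F : G -> A) (eps : R) (z : seqalg A).

Let hi g : star_hom (alpha_inf alpha g) := seqalg_map_star_hom (act_star_hom alpha g).

Lemma tensor0l (a : A) : PX (fun=> 0) a = 0.
Proof.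
have c0 : continuous (fun _ : G => 0 : R) by exact: cst_continuous.
have := tensor_linearl X 1 a c0 c0; have -> : (fun g : G => 1 * 0 + 0 : R) = (fun=> 0).
  by apply/funext => g; rewrite mulr0 addr0.
by rewrite scale1r => /eqP; rewrite -subr_eq0 opprD addNKr oppr_eq0 => /eqP.
Qed.

Lemma tensor_fsum (I : Type) (s : seq I) (f : I -> G -> R) (a : A) :
  (forall i, continuous (f i)) ->
  PX (fun g => \sum_(i <- s) f i g) a = \sum_(i <- s) PX (f i) a.
Proof.
move=> cf.
have cs t : continuous (fun g => \sum_(i <- t) f i g).
  elim: t => [|i t IH]; first by under eq_fun do rewrite big_nil; exact: cst_continuous.
  under eq_fun do rewrite big_cons -[f i _]mul1r.
  exact: continuousZD.
elim: s => [|i s IH].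
  by rewrite big_nil -(tensor0l a); congr (tensor _ _ _); apply/funext => g; rewrite big_nil.
rewrite big_cons -IH -[PX (f i) a]scale1r -(tensor_linearl X 1)//.
by congr (tensor _ _ _); apply/funext => g; rewrite big_cons mul1r.
Qed.

(* [z] is the image of an approximation of [F] by partitions of unity. *)
Definition Rep F eps z := exists (I : finType) (e : I -> G -> R) (c : I -> A),
  [/\ forall i, continuous (e i), forall i g, 0 <= e i g, forall g, \sum_i e i g = 1,
      forall i g, e i g != 0 -> nm (F g - c i) <= eps & z = \sum_i PX (e i) (c i)].

(** The products [e i * e' j] refine both partitions of unity, so both functions are approximated
    over the same one, where the operations act on coefficients. *)
Lemma Rep_pair F eps z F' eps' z' : Rep F eps z -> Rep F' eps' z' ->
  exists (I : finType) (e : I -> G -> R) (c c' : I -> A),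
  [/\ forall i, continuous (e i), forall i g, 0 <= e i g, forall g, \sum_i e i g = 1,
      forall i g, e i g != 0 -> nm (F g - c i) <= eps /\ nm (F' g - c' i) <= eps'
    & [/\ z = \sum_i PX (e i) (c i), z' = \sum_i PX (e i) (c' i)
      & z ** z' = \sum_i PX (e i) (c i ** c' i)]].
Proof.
move=> [I [e [c [ce e0 e1 ec ->]]]] [I' [e' [c' [ce' e0' e1' ec' ->]]]].
exists (I * I')%type, (fun p g => e p.1 g * e' p.2 g), (fun p => c p.1), (fun p => c' p.2).
split.
- by move=> p; exact: continuousM2.
- by move=> p g; exact: mulr_ge0.
- move=> g; rewrite -(pair_bigA _ (fun i j => e i g * e' j g))/=.
  by under eq_bigr do rewrite -mulr_sumr e1' mulr1.
- by move=> [i j] g /=; rewrite mulf_eq0 negb_or => /andP[/ec h /ec' h'].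
split.
- rewrite -(pair_bigA _ (fun i j => PX (fun g => e i g * e' j g) (c i)))/=.
  apply: eq_bigr => i _; rewrite -tensor_fsum => [|j]; last exact: continuousM2.
  by congr (tensor _ _ _); apply/funext => g; rewrite -mulr_sumr e1' mulr1.
- rewrite -(pair_bigA _ (fun i j => PX (fun g => e i g * e' j g) (c' j)))/= exchange_big /=.
  apply: eq_bigr => j _; rewrite -tensor_fsum => [|i]; last exact: continuousM2.
  by congr (tensor _ _ _); apply/funext => g; rewrite -mulr_suml e1 mul1r.
- rewrite -(pair_bigA _ (fun i j => PX (fun g => e i g * e' j g) (c i ** c' j)))/=.
  rewrite amul_suml; apply: eq_bigr => i _; rewrite amul_sumr; apply: eq_bigr => j _.
  by rewrite tensorM.
Qed.

Lemma Rep_sub_le F eps z F' eps' z' (d : R) : 0 < d -> Rep F eps z -> Rep F' eps' z' ->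
  0 <= eps -> 0 <= eps' -> (forall g, nm (F g - F' g) <= d) ->
  nm (z - z') <= 2 * (eps + eps' + d).
Proof.
move=> d0 r r' p0 p0' FF'.
have [I [e [c [c' [ce e0 e1 ec [-> -> _]]]]]] := Rep_pair r r'.
(* Where [e i] vanishes identically the coefficients are unconstrained, and the term is replaced by
   [0]. *)
pose b i := if `[< exists g, e i g != 0 >] then c i - c' i else 0.
have -> : \sum_i PX (e i) (c i) - \sum_i PX (e i) (c' i) = \sum_i PX (e i) (b i).
  rewrite -sumrB; apply: eq_bigr => i _; rewrite -tensorB /b; case: asboolP => // no.
  have -> : e i = (fun=> 0); last by rewrite !tensor0l.
  by apply/funext => g; apply/eqP; apply: contra_notT no => h; exists g.
apply: tensor_sum_le => // [|i]; first by lra.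
rewrite /b; case: asboolP => [[g /ec[h1 h2]]|_]; last by rewrite nm0; lra.
have := nm_tri (F g) (c i) (c' i); have := nm_tri (F' g) (F g) (c' i).
by have := FF' g; rewrite (nm_sym (c i) (F g)); lra.
Qed.

Lemma RepL F eps z F' eps' z' (k : R[i]) : Rep F eps z -> Rep F' eps' z' ->
  Rep (fun g => k *: F g + F' g) (cabs k * eps + eps') (k *: z + z').
Proof.
move=> r r'; have [I [e [c [c' [ce e0 e1 ec [-> -> _]]]]]] := Rep_pair r r'.
exists I, e, (fun i => k *: c i + c' i); split=> // [i g /ec[h1 h2]|].
  rewrite opprD addrACA -scalerBr; apply: (le_trans (nmD _ _)); rewrite nmZ lerD//.
  by apply: ler_wpM2l => //; exact: cabs_ge0.
by rewrite scaler_sumr -big_split; apply: eq_bigr => i _; rewrite tensor_linearr.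
Qed.

Lemma RepM F eps z F' eps' z' (M : R) : Rep F eps z -> Rep F' eps' z' ->
  (forall g, nm (F g) <= M) -> (forall g, nm (F' g) <= M) ->
  Rep (fun g => F g ** F' g) (eps * M + (M + eps) * eps') (z ** z').
Proof.
move=> r r' hF hF'; have [I [e [c [c' [ce e0 e1 ec [_ _ ->]]]]]] := Rep_pair r r'.
exists I, e, (fun i => c i ** c' i); split=> // i g /ec[h1 h2].
have -> : F g ** F' g - c i ** c' i = (F g - c i) ** F' g + c i ** (F' g - c' i).
  by nc_ring.
apply: (le_trans (nmD _ _)); apply: lerD; apply: (le_trans (nmM _ _)).
  by apply: ler_pM => //; exact: nm_ge0.
apply: ler_pM => //; rewrite ?nm_ge0//.
have := nm_le_sub (c i) (F g); rewrite (nm_sym (c i)); have := hF g; lra.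
Qed.

Lemma RepS F eps z : Rep F eps z -> Rep (fun g => star (F g)) eps (star z).
Proof.
move=> [I [e [c [ce e0 e1 ec ->]]]]; exists I, e, (fun i => star (c i)); split=> //.
  by move=> i g /ec; rewrite -starB nm_star.
by rewrite star_sum; apply: eq_bigr => i _; rewrite tensorS.
Qed.

Lemma Rep_act F eps z (g : G) : Rep F eps z ->
  Rep (fun h => alpha g (F (g^-1 * h)%g)) eps (alpha_inf alpha g z).
Proof.
move=> [I [e [c [ce e0 e1 ec ->]]]].
exists I, (fun i h => e i (g^-1 * h)%g), (fun i => alpha g (c i)); split=> //.
- by move=> i; exact: continuous_translate.
- by move=> i h /ec; rewrite nm_act_sub.
- by rewrite (star_hom_sum (hi g)); apply: eq_bigr => i _; rewrite tensor_act.
Qed.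

Lemma Rep_cst (x : A) : Rep (fun=> x) 0 (cst_seq x).
Proof.
exists unit, (fun _ _ => 1), (fun _ => x); split=> //.
- by move=> _; exact: cst_continuous.
- by move=> g; rewrite big_const card_unit /= addr0.
- by move=> i g _; rewrite subrr nm0.
- by rewrite big_const card_unit /= addr0 tensor1.
Qed.

Lemma Rep_exists F eps : continuous F -> 0 < eps -> exists z, Rep F eps z.
Proof.
move=> cF eps0.
have e2 : 0 < eps / 2 by rewrite divr_gt0.
have nearF g : \forall h \near g, nm (F g - F h) < eps / 2.
  by move/cvg_nmP: (cF g); exact.
have [n [t ht]] := compact_finite_cover compG nearF.
(* The partition is made from [F] itself: [w i] is positive exactly where [F] is within [eps] of
   [F (t i)]. Covering at scale [eps / 2] makes the sum [W] positive. *)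
pose w (i : 'I_n.+1) g := Num.max 0 (eps - nm (F g - F (t i))).
have cw i : continuous (w i).
  have c1 : continuous (fun g => eps - nm (F g - F (t i))).
    move=> g; apply: (@cvgB _ R^o); first exact: cvg_cst.
    apply: (@continuous_nm _ _ _ (fun g => F g - F (t i))) => h.
    by apply: cvgB; [exact: cF|exact: cvg_cst].
  have c0 : continuous (fun _ : G => 0 : R) by exact: cst_continuous.
  by move=> g; exact: (continuous_max (c0 g) (c1 g)).
have w0 i g : 0 <= w i g by rewrite /w le_max lexx.
pose W g := \sum_i w i g.
have W0 g : 0 < W g.
  have [i hti] := ht g; rewrite /W (bigD1 i)//= ltr_pwDl ?sumr_ge0//.
  by rewrite /w lt_max nm_sym; apply/orP; right; lra.
have cW : continuous W.
  rewrite /W; elim: (index_enum _) => [|i s IH].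
    by under eq_fun do rewrite big_nil; exact: cst_continuous.
  by under eq_fun do rewrite big_cons -[w i _]mul1r; exact: continuousZD.
have cWV : continuous (fun g => (W g)^-1).
  by move=> g; apply: cvgV; [rewrite gt_eqF|exact: cW].
exists (\sum_i PX (fun g => w i g * (W g)^-1) (F (t i))).
exists 'I_n.+1, (fun i g => w i g * (W g)^-1), (fun i => F (t i)); split=> //.
- by move=> i; exact: continuousM2.
- by move=> i g; rewrite mulr_ge0// invr_ge0 ltW.
- by move=> g; rewrite -mulr_suml -/(W g) mulfV // gt_eqF.
- move=> i g; rewrite mulf_eq0 negb_or => /andP[+ _]; rewrite /w.
  by case: (leP 0 (eps - nm (F g - F (t i)))) => [|_]; rewrite ?eqxx//; lra.
Qed.

Lemma Rep_cont F eps z : Rep F eps z -> seqalg_alpha alpha z.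
Proof.
move=> [I [e [c [_ _ _ _ ->]]]].
elim: (index_enum _) => [|i s IH]; first by rewrite big_nil; exact: seqalg_alpha0.
by rewrite big_cons -[PX _ _]scale1r; apply: seqalg_alphaL => //; exact: tensor_cont.
Qed.

(** Translation combined with the action leaves the orbit map unchanged, so both elements represent
    the same function; [Rep_sub_le] with all three errors [eps] gives [6]. *)
Lemma Rep_orbit (x : A) eps z (g : G) : 0 < eps -> Rep (fun h => alpha h x) eps z ->
  nm (alpha_inf alpha g z - z) <= 6 * eps.
Proof.
move=> e0 r; have r' := Rep_act g r.
have -> : 6 * eps = 2 * (eps + eps + eps) by ring.
apply: (Rep_sub_le e0 r' r) => // [||h]; try exact: ltW.
by rewrite -actM mulVKg subrr nm0 ltW.
Qed.

End Representation.

(** * Extendibility of the inclusion of the fixed point algebra *)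

Section FixedPointAlgebra.
Variables (R : realType) (G : topologicalGroupType) (A : cstarAlgType R).
Variables (alpha : action G A).

Lemma closed_fixed : closed [set x | fixed_points alpha x].
Proof.
move=> x cx g; apply: nm_eq => e e0.
have [y /= fy xy] := closure_nm cx (divr_gt0 e0 (ltr0n R 2)).
apply: (le_trans (nm_tri (alpha g y) _ _)); rewrite nm_act_sub fy (nm_sym y); lra.
Qed.

Definition fixed_alg := closed_sub closed_fixed.
HB.instance Definition _ := CStarAlgebra.on fixed_alg.

Definition fixed_val (x : fixed_alg) : A := val (x : subalg (fixed_points alpha)).

Lemma fixed_val_star_hom : star_hom fixed_val.
Proof. exact: subval_star_hom. Qed.

Lemma nm_fixed_val x : nm (fixed_val x) = nm x.
Proof. by rewrite nm_closed_sub. Qed.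

Definition fixed_val_inf : seqalg fixed_alg -> seqalg A := seqalg_map fixed_val_star_hom.

Lemma fixed_val_inf_star_hom : star_hom fixed_val_inf.
Proof. exact: seqalg_map_star_hom. Qed.

Lemma nm_fixed_val_inf x : nm (fixed_val_inf x) = nm x.
Proof.
apply: le_anti; rewrite (nm_contractive fixed_val_inf_star_hom)/=.
elim/seqW: x => a; rewrite /fixed_val_inf seqalg_mapE; apply/nm_etaP => e e0.
have /nm_etaP/(_ e e0) := lexx (nm (eta (linf_map fixed_val_star_hom a))).
by apply: filterS => n; rewrite /= nm_fixed_val.
Qed.

Hypothesis compG : compact [set: G].

(** The hypothesis on [z] gives entries almost invariant under each [g], eventually and depending on
    [g]. Since the orbit maps of the lift [t] are continuous uniformly in the entry, compactness
    makes this uniform in [g], and [invariant_point] then applies to each entry. *)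
Lemma near_fixed z (eps : R) : seqalg_alpha alpha z -> 0 < eps ->
  (forall g, nm (alpha_inf alpha g z - z) <= eps) ->
  exists b, nm (fixed_val_inf b - z) <= 2 * eps.
Proof.
move=> [t /linf_alphaP ht <-] e0 hz.
have e2 : 0 < eps / 2 by rewrite divr_gt0.
have near_n : \forall n \near \oo, forall g, nm (alpha g (val t n) - val t n) <= 2 * eps.
  have /compact_near_coveringP cG := compG.
  suff: \forall n \near \oo, [set: G] `<=` (fun g => nm (alpha g (val t n) - val t n) <= 2 * eps).
    by apply: filterS => n h g; exact: h.
  apply: cG => g _.
  have := hz g; rewrite /alpha_inf seqalg_mapE -(star_homB (@eta_star_hom _ _)).
  move=> /nm_etaP /(_ _ e2) hn.
  exists ([set h | forall n, nm (alpha g (val t n) - alpha h (val t n)) < eps / 2],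
    [set n | nm (alpha g (val t n) - val t n) <= eps + eps / 2]); first by split=> //; exact: ht.
  move=> [h n] /= [h1 h2]; apply: (le_trans (nm_tri (alpha g (val t n)) _ _)).
  by have := h1 n; rewrite nm_sym; lra.
have /choice[b hb] : forall n, exists b : fixed_alg,
    (forall g, nm (alpha g (val t n) - val t n) <= 2 * eps) ->
    nm (fixed_val b - val t n) <= 2 * eps.
  move=> n; have [h|no] := pselect (forall g, nm (alpha g (val t n) - val t n) <= 2 * eps).
    have [||g|b fb hb] := @invariant_point _ _ _ alpha compG
        (fun y => nm (y - val t n) <= 2 * eps) (val t n).
    - apply: (@closed_lipschitz_ball _ _ (fun y => y - val t n) 1) => b b'.
      by rewrite opprB addrA subrK mul1r.
    - exact: convex_ball.
    - exact: h.
    - by exists (mksub (S := fixed_points alpha) fb).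
  by exists 0 => /no.
have bb : linf fixed_alg b.
  have /linf_nmP[M hM] := subalgP t.
  apply: (@near_linf _ _ _ (2 * eps + M)); apply: filterS near_n => n /hb h.
  rewrite -nm_fixed_val; apply: (le_trans (nm_le_sub _ (val t n))).
  by apply: lerD.
exists (eta (mksub bb)); rewrite /fixed_val_inf seqalg_mapE -(star_homB (@eta_star_hom _ _)).
apply/nm_etaP => d d0; apply: filterS near_n => n /hb h.
by apply: (le_trans h); rewrite lerDl ltW.
Qed.

Variable X : rokhlin_lift alpha.
Local Notation orb x := (fun h => alpha h x).

Lemma Rep_le F (e e' : R) z : e <= e' -> Rep X F e z -> Rep X F e' z.
Proof.
move=> ee [I [p [c [h1 h2 h3 h4 h5]]]]; exists I, p, c; split=> // i g /h4 h.
exact: le_trans ee.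
Qed.

Lemma rokhlin_average_exists x : exists p : seqalg fixed_alg, forall (e : R) z, 0 < e ->
  Rep X (orb x) e z -> nm (fixed_val_inf p - z) <= 5 * e.
Proof.
have p0 m : 0 < 2^-1 ^+ m :> R by rewrite exprn_gt0.
have mono m n : (m <= n)%N -> (2^-1 ^+ n : R) <= 2^-1 ^+ m.
  by move=> mn; rewrite ler_wiXn2l ?invr_ge0 ?invf_le1 ?ler1n.
have /choice[z hz] : forall m, exists z, Rep X (orb x) (2^-1 ^+ m) z.
  by move=> m; apply: Rep_exists => //; exact: act_continuous.
have /choice[b hb] : forall m, exists b, nm (fixed_val_inf b - z m) <= 12 * 2^-1 ^+ m.
  move=> m; have [||g|b h] := @near_fixed (z m) (6 * 2^-1 ^+ m).
  - exact: Rep_cont (hz m).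
  - by rewrite mulr_gt0.
  - exact: Rep_orbit (hz m).
  - by exists b; apply: (le_trans h); lra.
have hi := fixed_val_inf_star_hom.
(* Twice [12] from the fixed approximants and [6] from [Rep_sub_le] make up [30]. *)
have [m n mn|e e0|p [hp _]] := @complete_nm _ (seqalg fixed_alg) b (fun m => 30 * 2^-1 ^+ m).
- rewrite -nm_fixed_val_inf (star_homB hi).
  have h1 := Rep_sub_le (p0 m) (hz n) (hz m) (ltW (p0 n)) (ltW (p0 m)) (fun g => _).
  have {}h1 := h1 (fun g => _).
  have {h1} h1 : nm (z n - z m) <= 2 * (2^-1 ^+ n + 2^-1 ^+ m + 2^-1 ^+ m).
    by apply: h1 => g; rewrite subrr nm0 ltW.
  have q1 := nm_tri (z n) (fixed_val_inf (b n)) (fixed_val_inf (b m)).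
  have q2 := nm_tri (z m) (z n) (fixed_val_inf (b m)); rewrite (nm_sym (z m)) in q2.
  by move: (hb n) (hb m) (mono m n mn); move: h1 q1 q2; nm_lra.
- by have [m hm] := half_pow_small (divr_gt0 e0 (ltr0n R 30)); exists m; lra.
exists p => e w e0 hw.
(* The error is [30 + 12 + 2] times 2^-m plus [4 * e]; dividing by [44] leaves less than [5 * e]. *)
have [m hm] := half_pow_small (divr_gt0 e0 (ltr0n R 44)).
have h1 : nm (z m - w) <= 2 * (2^-1 ^+ m + e + e).
  apply: (Rep_sub_le e0 (hz m) hw (ltW (p0 m)) (ltW e0)) => g.
  by rewrite subrr nm0 ltW.
have q1 := nm_tri (fixed_val_inf (b m)) (fixed_val_inf p) w.
have q2 := nm_tri (z m) (fixed_val_inf (b m)) w.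
rewrite -(star_homB hi) nm_fixed_val_inf in q1.
by move: (hp m) (hb m); move: h1 hm q1 q2; nm_lra.
Qed.

(** The value [psi x] is determined by its distance to every representative of the orbit map of [x],
    and these representatives are stable under the operations; hence the homomorphism laws. The
    orbit map of a fixed element is constant, and is represented exactly by [cst_seq]. *)
Theorem rokhlin_average : exists psi : A -> seqalg fixed_alg,
  star_hom psi /\ forall x : fixed_alg, psi (fixed_val x) = cst_seq x.
Proof.
have /choice[psi hpsi] := rokhlin_average_exists.
have hi := fixed_val_inf_star_hom.
have ex x (e : R) : 0 < e -> exists z, Rep X (orb x) e z.
  by move=> e0; apply: Rep_exists => //; exact: act_continuous.
have inj p q : (forall e : R, 0 < e -> nm (fixed_val_inf p - fixed_val_inf q) <= e) -> p = q.
  by move=> h; apply: nm_eq => e /h; rewrite -(star_homB hi) nm_fixed_val_inf.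
exists psi; split; first split.
- move=> k x y; apply: inj => e e0; have k0 := cabs_ge0 k.
  have k1 : 0 < 10 * (cabs k + 1) by lra.
  have d0 := divr_gt0 e0 k1; set d := _ / _ in d0.
  have dE : d * (10 * (cabs k + 1)) = e by rewrite divfK// gt_eqF.
  have [z hz] := ex x _ d0; have [w hw] := ex y _ d0.
  have := RepL k hz hw.
  rewrite (_ : (fun g => _) = orb (k *: x + y)); last first.
    by apply/funext => g; rewrite (star_homP (act_star_hom alpha g)).
  have kd : 0 < cabs k * d + d by nra.
  move=> /(hpsi _ _ _ kd) h3; have h1 := hpsi _ _ _ d0 hz; have h2 := hpsi _ _ _ d0 hw.
  apply: (le_trans (nm_tri (k *: z + w) _ _)).
  rewrite (star_homP hi).
  set P := fixed_val_inf (psi x) in h1 *; set Q := fixed_val_inf (psi y) in h2 *.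
  have h4 : nm (k *: z + w - (k *: P + Q)) <= cabs k * (5 * d) + 5 * d.
    rewrite opprD addrACA -scalerBr; apply: (le_trans (nmD _ _)).
    by rewrite nmZ nm_sym (nm_sym w) lerD// ler_wpM2l.
  by nra.
- move=> x y; apply: inj => e e0; pose M := nm x + nm y.
  have x0 := nm_ge0 x; have y0 := nm_ge0 y.
  pose N := nm (fixed_val_inf (psi x)) + nm (fixed_val_inf (psi y)).
  have N1 : 0 <= N by apply: addr_ge0; exact: nm_ge0.
  have K0 : 0 < 10 * (M + N + 1) + 40 by rewrite /M; lra.
  pose d := Num.min 1 (e / (10 * (M + N + 1) + 40)).
  have d0 : 0 < d by rewrite lt_min ltr01 divr_gt0.
  have d1 : d <= 1 by rewrite ge_min lexx.
  have de : d * (10 * (M + N + 1) + 40) <= e by rewrite -ler_pdivlMr// /d ge_min lexx orbT.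
  have [z hz] := ex x _ d0; have [w hw] := ex y _ d0.
  have hx g : nm (alpha g x) <= M by rewrite nm_act /M lerDl.
  have hy g : nm (alpha g y) <= M by rewrite nm_act /M lerDr.
  have hzw := RepM hz hw hx hy.
  have oE : (fun g => alpha g x ** alpha g y) = orb (x ** y).
    by apply/funext => g; rewrite (star_homM (act_star_hom alpha g)).
  rewrite oE in hzw.
  have M0 : 0 <= M by rewrite /M; lra.
  have kd : 0 < d * M + (M + d) * d by nra.
  have h3 := hpsi _ _ _ kd hzw; have h1 := hpsi _ _ _ d0 hz; have h2 := hpsi _ _ _ d0 hw.
  set P := fixed_val_inf (psi x) in h1 *; set Q := fixed_val_inf (psi y) in h2 *.
  apply: (le_trans (nm_tri (z ** w) _ _)); rewrite (star_homM hi) -/P -/Q.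
  have -> : z ** w - P ** Q = - ((P - z) ** Q + z ** (Q - w)) by nc_ring.
  have q1 := nmD ((P - z) ** Q) (z ** (Q - w)).
  have q2 := nmM (P - z) Q; have q3 := nmM z (Q - w).
  have q4 : nm z <= N + 5.
    have := nm_le_sub z P; rewrite (nm_sym z P); have := nm_ge0 Q.
    by rewrite /N -/P -/Q; lra.
  have q5 : nm Q <= N by rewrite /N -/P -/Q lerDr nm_ge0.
  have q6 : nm (P - z) * nm Q <= 5 * d * N by apply: ler_pM; rewrite ?nm_ge0.
  have q7 : nm z * nm (Q - w) <= (N + 5) * (5 * d) by apply: ler_pM; rewrite ?nm_ge0.
  rewrite nmN; nra.
- move=> x; apply: inj => e e0.
  have d0 : 0 < e / 10 by rewrite divr_gt0.
  have [z hz] := ex x _ d0; have := RepS hz.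
  rewrite (_ : (fun g => star _) = orb (star x)); last first.
    by apply/funext => g; rewrite (star_homS (act_star_hom alpha g)).
  move=> /(hpsi _ _ _ d0) h1; have := hpsi _ _ _ d0 hz.
  rewrite -nm_star starB -(star_homS hi) => h2.
  move: h1 h2 (nm_tri (star z) (fixed_val_inf (psi (star x))) (fixed_val_inf (star (psi x)))).
  by rewrite (nm_sym (star z)); nm_lra.
- move=> x; apply: inj => e e0.
  have d0 : 0 < e / 5 by rewrite divr_gt0.
  have := Rep_le (ltW d0) (Rep_cst X (fixed_val x)).
  rewrite (_ : (fun=> _) = orb (fixed_val x)); last first.
    by apply/funext => g; rewrite (subalgP (x : subalg (fixed_points alpha)) g).
  move=> /(hpsi _ _ _ d0); rewrite /fixed_val_inf seqalg_map_cst; lra.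
Qed.

End FixedPointAlgebra.

Theorem fixed_points_extendible (R : realType) (G : topologicalGroupType)
    (A : cstarAlgType R) (alpha : action G A) :
  compact [set: G] -> separable_set [set: A] -> Rokhlin_property alpha ->
  seqalg_extendible (val : subalg (fixed_points alpha) -> A).
Proof.
move=> cG sepA rok E phi hphi.
have [X _] := rokhlin_lift_exists cG sepA rok.
have [psi [hpsi psiE]] := rokhlin_average cG X.
have hphi' : star_hom (phi : fixed_alg alpha -> seqalg E) := hphi.
pose tau x := seqalg_map hphi' (psi x).
have htau : star_hom tau.
  have hm := seqalg_map_star_hom hphi'.
  split=> [c x y|x y|x]; rewrite /tau.
  - by rewrite (star_homP hpsi) (star_homP hm).
  - by rewrite (star_homM hpsi) (star_homM hm).
  - by rewrite (star_homS hpsi) (star_homS hm).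
pose y (x : A) : seqalg E :=
  if pselect (fixed_points alpha x) is left fx then phi (mksub fx) else 0.
have tauD x : fixed_points alpha x -> tau x = cst_seq (y x).
  move=> fx; rewrite /y; case: pselect => // fx'.
  have := psiE (mksub fx' : fixed_alg alpha).
  by rewrite [fixed_val _]/= /tau => ->; rewrite seqalg_map_cst.
have [rho [hrho rhoE]] := seqalg_reindex (D := [set x | fixed_points alpha x]) sepA htau
  (starSub0 _) tauD.
exists rho => //; apply/funext => x /=; rewrite rhoE; last exact: subalgP.
rewrite /y; case: pselect => [fx|no]; last by case: no; exact: subalgP.
by congr phi; apply/val_inj.
Qed.

(** * Lifting of matrix units *)

Section MatrixUnits.
Variables (R : realType) (B C : cstarAlgType R) (q : B -> C).
Variables (T : eqType) (t0 : T) (K : Type) (Z : T -> K -> C) (y : T -> B).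
Hypothesis hq : star_hom q.
Hypothesis yZ : forall g k, q (y g) ** Z t0 k = Z g k.
Hypothesis ysZ : forall g h k, q (star (y g)) ** Z h k = if g == h then Z t0 k else 0.
Local Notation "r *:r x" := ((r : R)%:C *: x) (at level 40).

Let scM (r s : R) (x : C) : r *:r (s *:r x) = (r * s) *:r x.
Proof. by rewrite scalerA -rmorphM. Qed.

(** Holds because [x ** w ** star (x ** w)] equals [x ** d ** d ** star x]. *)
Lemma support_abs (x d w : B) : star w = w -> w ** w = d ** d -> x ** d = 0 -> x ** w = 0.
Proof.
move=> sw wd xd; rewrite -[x ** w]starK; rewrite (_ : star (x ** w) = 0) ?star0//.
apply: star_amul_eq0; rewrite starK.
have -> : x ** w ** star (x ** w) = x ** (w ** w) ** star x by rewrite starM sw; nc_ring.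
have -> : x ** (w ** w) ** star x = (x ** d) ** d ** star x by rewrite wd; nc_ring.
by rewrite xd; nc_ring.
Qed.

(* The positive and negative parts of [b ** (M g - sum of the other M h) ** b],
   where [M h := y h ** star (y h)], are exactly orthogonal; the positive one is
   [a g], and the negative one replaces [b] for the remaining indices. *)
Lemma orthogonal_lift (l : seq T) (b : B) (beta : R) : uniq l -> star b = b -> 0 < beta ->
  (forall h k, h \in l -> q b ** Z h k = beta *:r Z h k) ->
  exists a : T -> B,
  [/\ forall g, g \in l -> star (a g) = a g,
      forall g, g \in l -> exists2 lam : R, 0 < lam & forall k, q (a g) ** Z g k = lam *:r Z g k,
      forall g x, g \in l -> x ** b = 0 -> x ** a g = 0
    & forall g h, g \in l -> h \in l -> g != h -> a g ** a h = 0].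
Proof.
elim: l b beta => [|g l IH] b beta.
  by move=> _ _ _ _; exists (fun _ => 0).
rewrite cons_uniq => /andP[gl ul] sb b0 bZ.
pose M h := y h ** star (y h).
have MZ h h' k : q (M h) ** Z h' k = if h == h' then Z h k else 0.
  by rewrite /M (star_homM hq) -amulA ysZ; case: eqP => // _; rewrite ?yZ ?amul0r.
pose N := M g - \sum_(h <- l) M h.
have sM h : star (M h) = M h by rewrite /M starM starK.
have sN : star N = N by rewrite starB sM star_sum; under eq_bigr do rewrite sM.
have sumZ h k : uniq l -> q (\sum_(i <- l) M i) ** Z h k = if h \in l then Z h k else 0.
  move=> _; rewrite (star_hom_sum hq) amul_suml; under eq_bigr do rewrite MZ.
  elim: {+}l ul => [|i s IHs]; first by rewrite big_nil.
  rewrite big_cons inE /= => /andP[iNs us]; rewrite IHs// (eq_sym i).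
  have [->|_] /= := eqVneq h i; last by rewrite add0r.
  by rewrite (negbTE iNs) addr0.
pose d := b ** N ** b.
have sd : star d = d by rewrite /d !starM sb sN; nc_ring.
have [w [sw ww cw ew]] := abs_exists sd.
have dw : d ** w = w ** d by apply: cw; nc_ring.
have dZ h k : h \in g :: l -> q d ** Z h k =
    (if h == g then beta ^+ 2 else - beta ^+ 2) *:r Z h k.
  move=> hl; rewrite /d !(star_homM hq) -!amulA bZ// !amulZr.
  have -> : q N ** Z h k = (if h == g then 1 else -1) *:r Z h k.
    rewrite (star_homB hq) amulBl MZ sumZ// eq_sym; move: hl; rewrite inE.
    have [->|hg] /= := eqVneq h g; first by rewrite (negbTE gl) subr0 rmorph1 scale1r.
    by move=> ->; rewrite sub0r rmorphN1 scaleN1r.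
  rewrite amulZr bZ// !scM; congr (_%:C *: _); case: ifP => _; ring.
have b2 : 0 < beta ^+ 2 by rewrite exprn_gt0.
have wZ h k : h \in g :: l -> q w ** Z h k = (beta ^+ 2) *:r Z h k.
  move=> hl; apply: ew => //; rewrite (star_homM hq) -amulA dZ// amulZr dZ// scM.
  by congr (_%:C *: _); case: ifP => _; ring.
(* On [Z g] both [w] and [d] act as [beta ^+ 2], on the other [Z h] as [beta ^+ 2] and its opposite.
   So [w + d] and [w - d], twice the positive and negative parts of [d], separate [g] from the
   rest. *)
pose b' := w - d.
have [||h k hl|a [sa eZ supp orth]] := IH b' (2 * beta ^+ 2) ul.
- by rewrite starB sw sd.
- by rewrite mulr_gt0.
- have hl' : h \in g :: l by rewrite inE hl orbT.
  rewrite (star_homB hq) amulBl wZ// dZ//.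
  have -> : (h == g) = false by apply: contraNF gl => /eqP <-.
  by rewrite -scalerBl -rmorphB; congr (_%:C *: _); ring.
have ag : (w + d) ** b' = 0.
  have -> : (w + d) ** b' = w ** w - d ** d + (d ** w - w ** d) by rewrite /b'; nc_ring.
  by rewrite ww dw !subrr addr0.
have gne h : h \in l -> (h == g) = false by move=> hl; apply: contraNF gl => /eqP <-.
have supp0 x : x ** b = 0 -> x ** d = 0.
  by move=> xb; rewrite /d !amulA xb !amul0l.
exists (fun h => if h == g then w + d else a h); split.
- move=> h; rewrite inE; case: eqP => [_ _|_ /= hl]; last exact: sa.
  by rewrite starD sw sd.
- move=> h; rewrite inE; have [-> _|_ /= hl] := eqVneq h g; last exact: eZ.
  exists (2 * beta ^+ 2); first by rewrite mulr_gt0.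
  move=> k; rewrite (star_homD hq) amulDl wZ ?mem_head// dZ ?mem_head// eqxx.
  by rewrite -scalerDl -rmorphD; congr (_%:C *: _); ring.
- move=> h x; rewrite inE => hl xb; have xd := supp0 x xb.
  have xw := support_abs sw ww xd.
  case: eqP hl => [_ _|_ /= hl]; first by rewrite amulDr xd xw addr0.
  by apply: supp => //; rewrite /b' amulBr xd xw subrr.
move=> h h'; rewrite !inE; have [->|_] /= := eqVneq h g.
  move=> _; have [->|_] /= := eqVneq h' g; first by rewrite ?eqxx.
  by move=> hl' _; exact: supp.
move=> hl; have [-> _ _|_ /= hl' hh'] := eqVneq h' g; last exact: orth.
rewrite -[LHS]starK starM starD sw sd (sa h hl).
by rewrite (supp h _ hl ag) star0.
Qed.

Variables (l : seq T).
Hypothesis ul : uniq (t0 :: l).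

(* The polar decomposition of [x := a g ** y g ** c] need not exist in [B];
   multiplying by [w := |x + star x|] equalizes [star (xi g) ** xi g] instead. *)
Theorem matrix_unit_lift : exists (c : B) (xi : T -> B) (kappa : R),
  [/\ star c = c, 0 < kappa,
      forall g h, g \in t0 :: l -> h \in t0 :: l ->
        star (xi g) ** xi h = if g == h then c ** c else 0,
      forall g k, g \in t0 :: l -> q (xi g) ** Z t0 k = kappa *:r Z g k
    & forall k, q c ** Z t0 k = kappa *:r Z t0 k].
Proof.
pose L := t0 :: l.
(* Its image acts as the identity on the [Z h k], hence the starting eigenvalue [1]. *)
pose b := \sum_(h <- L) y h ** star (y h).
have [||h k hl|a [sa eZ _ orth]] := @orthogonal_lift L b 1 ul.
- by rewrite star_sum; apply: eq_bigr => h _; rewrite starM starK.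
- exact: ltr01.
- rewrite rmorph1 scale1r (star_hom_sum hq) amul_suml.
  rewrite (bigD1_seq h)//= big1 ?addr0 => [|i ih].
    by rewrite (star_homM hq) -amulA ysZ eqxx yZ.
  by rewrite (star_homM hq) -amulA ysZ (negbTE ih) amul0r.
have aZ g h k : g \in L -> h \in L -> g != h -> q (a g) ** Z h k = 0.
  move=> gL hL gh; have [lam l0 hl] := eZ h hL.
  have -> : Z h k = lam^-1 *:r (q (a h) ** Z h k).
    by rewrite hl scM mulVf ?gt_eqF// rmorph1 scale1r.
  by rewrite amulZr amulA -(star_homM hq) orth// (star_hom0 hq) amul0l scaler0.
have t0L : t0 \in L by exact: mem_head.
(* The support clauses confine [c] and [xi g] to the ranges of [a t0] and [a g]. The exact
   orthogonality of the [a g] then gives that of the [xi g]. *)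
suff H l' : uniq (t0 :: l') -> {subset l' <= L} -> exists (c : B) (xi : T -> B) (kappa : R),
    [/\ star c = c, 0 < kappa, forall x, x ** a t0 = 0 -> x ** c = 0,
      forall g, g \in t0 :: l' -> [/\ star (xi g) ** xi g = c ** c,
        forall x, x ** a g = 0 -> x ** xi g = 0
        & forall k, q (xi g) ** Z t0 k = kappa *:r Z g k]
    & forall k, q c ** Z t0 k = kappa *:r Z t0 k].
  have [|c [xi [kappa [sc k0 _ xiP cZ]]]] := H l ul.
    by move=> g gl; rewrite inE gl orbT.
  exists c, xi, kappa; split=> // [g h gL hL|g k gL]; last by have [_ _] := xiP g gL.
  have [e1 s1 _] := xiP g gL; have [_ s2 _] := xiP h hL.
  have [<- //|gh] := eqVneq g h; apply: s2.
  have h1 : a h ** xi g = 0 by apply: s1; rewrite orth// eq_sym.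
  by rewrite -[LHS]starK starM starK (sa h hL) h1 star0.
elim: l' => [|g l' IH].
  move=> _ _; have [lam l0 lZ] := eZ t0 t0L.
  exists (a t0), (fun _ => a t0), lam; split=> //; first exact: sa.
  by move=> g; rewrite inE => /eqP ->; split=> //; rewrite sa.
rewrite /= inE negb_or => /andP[/andP[tg tl'] /andP[gl' ul']] sub.
have gL : g \in L by apply: sub; rewrite mem_head.
have [|h hl'|c [xi [kappa [sc k0 suppc xiP cZ]]]] := IH.
- by rewrite /= tl'.
- by apply: sub; rewrite inE hl' orbT.
have [lam lam0 agZ] := eZ g gL.
pose x := a g ** y g ** c.
have agc : a g ** c = 0 by apply: suppc; apply: orth => //; rewrite eq_sym.
have cag : c ** a g = 0 by rewrite -[LHS]starK starM sc (sa g gL) agc star0.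
have sx : star x = c ** star (y g) ** a g by rewrite /x !starM sc (sa g gL) !amulA.
have xx : x ** x = 0.
  have -> : x ** x = a g ** y g ** (c ** a g) ** y g ** c by rewrite /x; nc_ring.
  by rewrite cag; nc_ring.
have sxx : star x ** star x = 0 by rewrite -starM xx star0.
pose s := x + star x.
have ss : star s = s by rewrite /s starD starK addrC.
have [w [sw ww cw ew]] := abs_exists ss.
have s2 : s ** s = x ** star x + star x ** x.
  have -> : s ** s = x ** x + star x ** star x + (x ** star x + star x ** x).
    by rewrite /s; nc_ring.
  by rewrite xx sxx !add0r.
pose p := star x ** x.
have ps2 : p ** (s ** s) = p ** p.
  have -> : p ** (s ** s) = star x ** (x ** x) ** star x + p ** p by rewrite s2 /p; nc_ring.
  by rewrite xx /p; nc_ring.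
have s2p : (s ** s) ** p = p ** p.
  have -> : (s ** s) ** p = x ** (star x ** star x) ** x + p ** p by rewrite s2 /p; nc_ring.
  by rewrite sxx /p; nc_ring.
have pw : p ** w = w ** p by apply: cw; rewrite ps2 s2p.
have sp : star p = p by rewrite /p starM starK.
(* Since [x ** x = 0], the square of [s] is an orthogonal sum of [x ** star x] and [p]; thus
   [w ** p] plays the role of [|x|^3]. Its square [p ** p ** p] is also [star z ** z] for
   [z = x ** star x ** x], the new [xi g]. *)
pose c' := w ** p.
have sc' : star c' = c' by rewrite /c' starM sw sp pw.
have cc' : c' ** c' = p ** p ** p.
  have -> : c' ** c' = w ** (p ** w) ** p by rewrite /c'; nc_ring.
  have -> : w ** (p ** w) ** p = (s ** s) ** p ** p by rewrite pw -ww; nc_ring.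
  by rewrite s2p.
(* Solves [c ** t = c'], so right multiplication by [t] carries the earlier [xi h] from the weight
   [c] to the weight [c']. *)
pose t := star (y g) ** a g ** a g ** y g ** c ** w.
have ct : c ** t = c' by rewrite /c' -pw /p sx /x /t; nc_ring.
pose mu := kappa * lam.
have mu0 : 0 < mu by rewrite mulr_gt0.
have q_ x1 x2 z : q (x1 ** x2) ** z = q x1 ** (q x2 ** z) by rewrite (star_homM hq) amulA.
have xZ0 k : q x ** Z t0 k = mu *:r Z g k.
  by rewrite /x !q_ cZ !amulZr yZ agZ scM.
have sxZg k : q (star x) ** Z g k = mu *:r Z t0 k.
  by rewrite sx !q_ agZ !amulZr ysZ eqxx cZ scM mulrC.
have sxZ0 k : q (star x) ** Z t0 k = 0.
  by rewrite sx !q_ aZ// 1?eq_sym// !amul0r.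
have pZ k : q p ** Z t0 k = (mu ^+ 2) *:r Z t0 k.
  by rewrite /p q_ xZ0 amulZr sxZg scM -expr2.
have wZ k : q w ** Z t0 k = mu *:r Z t0 k.
  apply: ew => //; rewrite s2 (star_homD hq) amulDl q_ sxZ0 amul0r add0r.
  exact: pZ.
have tZ k : q t ** Z t0 k = (kappa^-1 * mu ^+ 3) *:r Z t0 k.
  rewrite /t !q_ wZ !amulZr cZ !amulZr yZ agZ !amulZr agZ !amulZr ysZ eqxx !scM.
  by congr (_%:C *: _); rewrite /mu; field; rewrite gt_eqF.
have m3 : 0 < mu ^+ 3 by rewrite exprn_gt0.
have km : kappa * (kappa^-1 * mu ^+ 3) = mu ^+ 3 by rewrite mulVKf// gt_eqF.
exists c', (fun h => if h == g then x ** star x ** x else xi h ** t), (mu ^+ 3).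
split=> //.
- by move=> z /suppc zc; rewrite -ct amulA zc amul0l.
- move=> h; rewrite (_ : (h \in [:: t0, g & l']) = (h == g) || (h \in t0 :: l')); last first.
    by rewrite !inE orbCA.
  have [-> _|hg /= hl'] := eqVneq h g.
    rewrite /=; split=> [|z za|k].
    + by rewrite cc' (starM (x ** star x)) (starM x) starK /p; nc_ring.
    + have zx : z ** x = 0 by rewrite /x !amulA za !amul0l.
      have -> : z ** (x ** star x ** x) = (z ** x) ** star x ** x by nc_ring.
      by rewrite zx; nc_ring.
    + by rewrite (q_ (x ** star x)) (q_ x) xZ0 !amulZr sxZg !amulZr xZ0 !scM; congr (_%:C *: _); ring.
  have [e1 e2 e3] := xiP h hl'; split=> [|z /e2 za|k].
  + have -> : star (xi h ** t) ** (xi h ** t) = star t ** (star (xi h) ** xi h) ** t.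
      by rewrite starM; nc_ring.
    have ct' : star t ** c = c' by rewrite -[LHS]starK (starM (star t)) starK sc ct sc'.
    have -> : star t ** (star (xi h) ** xi h) ** t = (star t ** c) ** (c ** t).
      by rewrite e1; nc_ring.
    by rewrite ct ct'.
  + by rewrite amulA za amul0l.
  + by rewrite (q_ (xi h) t) tZ amulZr e3 scM mulrC km.
- move=> k; rewrite /c' q_ pZ amulZr wZ scM; congr (_%:C *: _); ring.
Qed.

End MatrixUnits.

(** * Matrices over a hereditary subalgebra *)

Section Hereditary.
Variables (R : realType) (B : cstarAlgType R) (c : B).
Hypothesis sc : star c = c.
Implicit Types (b : nat -> B) (z w : B).

(** The closure of c B c, given by sequences so that one [b] can be followed under several maps at
    once. *)
Definition hereditary z := exists b, (fun n => c ** b n ** c) @ \oo --> z.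

Lemma hereditary0 : hereditary 0.
Proof.
exists (fun _ => 0); rewrite (_ : (fun _ => _) = (fun _ => 0)); first exact: cvg_cst.
by apply/funext => n; rewrite amul0r amul0l.
Qed.

Lemma hereditaryP (k : R[i]) z w : hereditary z -> hereditary w -> hereditary (k *: z + w).
Proof.
move=> [b bz] [b' bw]; exists (fun n => k *: b n + b' n).
rewrite (_ : (fun _ => _) = (fun n => k *: (c ** b n ** c) + c ** b' n ** c)).
  by apply: cvgD => //; exact: cvgZr.
by apply/funext => n; rewrite amulDr amulDl amulZr amulZl.
Qed.

Lemma hereditaryM z w : hereditary z -> hereditary w -> hereditary (z ** w).
Proof.
move=> [b bz] [b' bw]; exists (fun n => b n ** c ** c ** b' n).
rewrite (_ : (fun _ => _) = (fun n => (c ** b n ** c) ** (c ** b' n ** c))).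
  exact: cvg_amul.
by apply/funext => n; nc_ring.
Qed.

Lemma hereditaryS z : hereditary z -> hereditary (star z).
Proof.
move=> [b bz]; exists (fun n => star (b n)).
rewrite (_ : (fun _ => _) = (fun n => star (c ** b n ** c))); first exact: cvg_star.
by apply/funext => n; rewrite !starM sc; nc_ring.
Qed.

Definition hereditary_sub : starSub B :=
  StarSub hereditary0 hereditaryP hereditaryM hereditaryS.

Lemma closed_hereditary : closed [set z | hereditary_sub z].
Proof.
move=> z cz.
have /choice[b hb] : forall n, exists x, nm (z - c ** x ** c) < 2^-1 ^+ n.
  move=> n; have p0 : 0 < 2^-1 ^+ n / 2 :> R by rewrite divr_gt0// exprn_gt0.
  have [y [b /cvg_nmP/(_ _ p0)[N _ /(_ N (leqnn N)) hN]] zy] := closure_nm cz p0.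
  exists (b N); apply: (le_lt_trans (nm_tri y _ _)); move: hN zy => /=; lra.
exists b; apply/cvg_nmP => e /half_pow_small[N Ne]; exists N => // n /= Nn.
apply: (lt_le_trans (hb n)); apply: le_trans (ltW Ne).
by rewrite ler_wiXn2l ?invr_ge0 ?invf_le1 ?ler1n.
Qed.

Definition hereditary_alg := closed_sub closed_hereditary.
HB.instance Definition _ := CStarAlgebra.on hereditary_alg.

Lemma hereditary_sandwich x : hereditary (c ** x ** c).
Proof. by exists (fun _ => x); exact: cvg_cst. Qed.

Variables (T : eqType) (L : seq T) (xi : T -> B).
Hypothesis xiE : forall g h, g \in L -> h \in L ->
  star (xi g) ** xi h = if g == h then c ** c else 0.

Let nm_xi g x : g \in L -> nm (xi g ** x) = nm (c ** x).
Proof.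
move=> gL; apply/eqP; rewrite -(@eqrXn2 _ 2) ?nm_ge0//; apply/eqP; rewrite -!nm_cstar.
congr (nm _); rewrite !starM sc.
have -> : star x ** star (xi g) ** (xi g ** x) = star x ** (star (xi g) ** xi g) ** x.
  by nc_ring.
by rewrite xiE// eqxx; nc_ring.
Qed.

Lemma nm_sandwich g h x : g \in L -> h \in L ->
  nm (xi g ** x ** star (xi h)) = nm (c ** x ** c).
Proof.
move=> gL hL; rewrite -amulA nm_xi//.
have -> : c ** (x ** star (xi h)) = star (xi h ** (star x ** c)).
  by rewrite starM (starM (star x)) starK sc; nc_ring.
rewrite nm_star nm_xi//.
have -> : c ** (star x ** c) = star (c ** x ** c).
  by rewrite starM (starM c) sc.
by rewrite nm_star.
Qed.

(** The closure of the assignment of [xi g ** b ** star (xi h)] to [c ** b ** c]. By [nm_sandwich]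
    this assignment is isometric, hence well defined on limits. *)
Definition mu_graph g h z w := exists b,
  (fun n => c ** b n ** c) @ \oo --> z /\
  (fun n => xi g ** b n ** star (xi h)) @ \oo --> w.

Lemma mu_graph_ex g h z : g \in L -> h \in L -> hereditary z -> exists w, mu_graph g h z w.
Proof.
move=> gL hL [b bz].
have bz' := bz; move/cvg_nmP: bz' => bz'.
have /choice[k hk] : forall m, exists k, nm (z - c ** b k ** c) < 2^-1 ^+ m / 2.
  move=> m; have p0 : 0 < 2^-1 ^+ m / 2 :> R by rewrite divr_gt0// exprn_gt0.
  by have [N _ /(_ N (leqnn N)) hN] := bz' _ p0; exists N.
have mono m n : (m <= n)%N -> (2^-1 ^+ n : R) <= 2^-1 ^+ m.
  by move=> mn; rewrite ler_wiXn2l ?invr_ge0 ?invf_le1 ?ler1n.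
have [m n mn||w [_ hw]] := @complete_nm _ B
  (fun m => xi g ** b (k m) ** star (xi h)) (fun m => 2^-1 ^+ m).
- have -> : xi g ** b (k n) ** star (xi h) - xi g ** b (k m) ** star (xi h) =
      xi g ** (b (k n) - b (k m)) ** star (xi h) by nc_ring.
  rewrite nm_sandwich//.
  have -> : c ** (b (k n) - b (k m)) ** c = (z - c ** b (k m) ** c) - (z - c ** b (k n) ** c).
    by nc_ring.
  apply: (le_trans (nmB _ _)); have := hk m; have := hk n; have := mono _ _ mn; lra.
- exact: half_pow_small.
exists w, (fun m => b (k m)); split=> //.
apply/cvg_nmP => e /half_pow_small[N Ne]; exists N => // n /= Nn.
have := hk n; have := mono _ _ Nn; have : 0 < 2^-1 ^+ n :> R by rewrite exprn_gt0.
by move: Ne; lra.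
Qed.

Lemma mu_graph_uniq g h z w w' : g \in L -> h \in L ->
  mu_graph g h z w -> mu_graph g h z w' -> w = w'.
Proof.
move=> gL hL [b [bz bw]] [b' [bz' bw']]; apply/eqP; rewrite -subr_eq0; apply/eqP.
apply: (@cvg_nm_le0 _ _ _ (fun n => xi g ** b n ** star (xi h) - xi g ** b' n ** star (xi h))
  (fun n => c ** b n ** c - c ** b' n ** c)); first exact: cvgB.
  by rewrite -[X in _ --> X](subrr z); exact: cvgB.
move=> n; have -> : xi g ** b n ** star (xi h) - xi g ** b' n ** star (xi h) =
    xi g ** (b n - b' n) ** star (xi h) by nc_ring.
by rewrite nm_sandwich// amulBr amulBl.
Qed.

(* [mu g h z] stands for [v_g z v_h^*], where [v_g] is the isometry with
   [v_g c = xi g]. *)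
Theorem matrix_amplification : exists mu : T -> T -> hereditary_alg -> B,
  [/\ forall g h (k : R[i]) (z w : hereditary_alg), g \in L -> h \in L -> mu g h (k *: z + w) = k *: mu g h z + mu g h w,
      forall g h h' k (z w : hereditary_alg), g \in L -> h \in L -> h' \in L -> k \in L ->
        mu g h z ** mu h' k w = if h == h' then mu g k (z ** w) else 0,
      forall g h (z : hereditary_alg), g \in L -> h \in L -> star (mu g h z) = mu h g (star z),
      forall g h (z : hereditary_alg), g \in L -> h \in L -> nm (mu g h z) <= nm z
    & forall g h (z : hereditary_alg) x, g \in L -> h \in L ->
        val (z : subalg hereditary_sub) = c ** x ** c -> mu g h z = xi g ** x ** star (xi h)].
Proof.
pose v (z : hereditary_alg) : B := val (z : subalg hereditary_sub).
have hv (z : hereditary_alg) : hereditary (v z) := subalgP (z : subalg hereditary_sub).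
have /choice[f hf] : forall ghz : T * T * hereditary_alg, exists w,
    ghz.1.1 \in L -> ghz.1.2 \in L -> mu_graph ghz.1.1 ghz.1.2 (v ghz.2) w.
  move=> [[g h] z] /=; have [gL|gN] := boolP (g \in L); last by exists 0.
  have [hL|hN] := boolP (h \in L); last by exists 0.
  by have [w hw] := mu_graph_ex gL hL (hv z); exists w.
pose mu g h (z : hereditary_alg) := f (g, h, z).
have muP g h (z : hereditary_alg) : g \in L -> h \in L -> mu_graph g h (v z) (mu g h z).
  exact: (hf (g, h, z)).
have muE g h (z : hereditary_alg) w : g \in L -> h \in L -> mu_graph g h (v z) w -> mu g h z = w.
  by move=> gL hL; apply: mu_graph_uniq => //; exact: muP.
exists mu; split.
- move=> g h k z w gL hL; apply: muE => //.
  have [b [bz bw]] := muP g h z gL hL; have [b' [bz' bw']] := muP g h w gL hL.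
  exists (fun n => k *: b n + b' n); split.
    rewrite (_ : (fun _ => _) = (fun n => k *: (c ** b n ** c) + c ** b' n ** c)).
      by apply: cvgD => //; exact: cvgZr.
    by apply/funext => n; rewrite amulDr amulDl amulZr amulZl.
  rewrite (_ : (fun _ => _) = (fun n => k *: (xi g ** b n ** star (xi h)) +
      xi g ** b' n ** star (xi h))).
    by apply: cvgD => //; exact: cvgZr.
  by apply/funext => n; rewrite amulDr amulDl amulZr amulZl.
- move=> g h h' k z w gL hL hL' kL.
  have [b [bz bw]] := muP g h z gL hL; have [b' [bz' bw']] := muP h' k w hL' kL.
  have E n : (xi g ** b n ** star (xi h)) ** (xi h' ** b' n ** star (xi k)) =
      xi g ** b n ** (star (xi h) ** xi h') ** b' n ** star (xi k) by nc_ring.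
  case: eqP => [hh'|/eqP/negbTE hh'].
    apply/esym/muE => //; exists (fun n => b n ** c ** c ** b' n); split.
      rewrite (_ : (fun _ => _) = (fun n => (c ** b n ** c) ** (c ** b' n ** c))).
        exact: cvg_amul.
      by apply/funext => n; nc_ring.
    rewrite (_ : (fun _ => _) =
      (fun n => (xi g ** b n ** star (xi h)) ** (xi h' ** b' n ** star (xi k)))).
      exact: cvg_amul.
    by apply/funext => n; rewrite E xiE// hh' eqxx; nc_ring.
  apply: (cvg_unique (@norm_hausdorff _ B) (cvg_amul bw bw')).
  rewrite (_ : (fun _ => _) = (fun _ => 0)); first exact: cvg_cst.
  by apply/funext => n; rewrite E xiE// hh'; nc_ring.
- move=> g h z gL hL; apply/esym/muE => //.
  have [b [bz bw]] := muP g h z gL hL; exists (fun n => star (b n)); split.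
    rewrite (_ : (fun _ => _) = (fun n => star (c ** b n ** c))); first exact: cvg_star.
    by apply/funext => n; rewrite !starM sc; nc_ring.
  rewrite (_ : (fun _ => _) = (fun n => star (xi g ** b n ** star (xi h)))); first exact: cvg_star.
  by apply/funext => n; rewrite !starM starK; nc_ring.
- move=> g h z gL hL; have [b [bz bw]] := muP g h z gL hL.
  rewrite nm_closed_sub; apply/ler_addgt0Pr => e e0.
  have e2 : 0 < e / 2 by rewrite divr_gt0.
  move/cvg_nmP: bz => /(_ _ e2) bz; move/cvg_nmP: bw => /(_ _ e2) bw.
  have [n [/= h1 h2]] := filter_ex (filterI bz bw).
  have := nm_le_sub (mu g h z) (xi g ** b n ** star (xi h)).
  rewrite nm_sandwich//; have := nm_le_sub (c ** b n ** c) (v z).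
  by rewrite (nm_sym _ (v z)); move: h1 h2; rewrite -/(v z); lra.
- move=> g h z x gL hL zx; apply: muE => //; exists (fun _ => x); split.
    by rewrite /v zx; exact: cvg_cst.
  exact: cvg_cst.
Qed.

End Hereditary.

(** * Crossed products by finite groups *)

(** Codes of *-polynomials, with coefficients numbered in a countable dense set; their countability
    makes the generated algebra separable. *)
Inductive star_term (K : Type) :=
| TVar of K | TLin of nat & star_term K & star_term K
| TMul of star_term K & star_term K | TStar of star_term K.

Section StarTermCount.
Variable K : countType.

Fixpoint star_term_encode (t : star_term K) : GenTree.tree K :=
  match t with
  | TVar k => GenTree.Leaf k
  | TLin n a b => GenTree.Node n.+2 [:: star_term_encode a; star_term_encode b]
  | TMul a b => GenTree.Node 0 [:: star_term_encode a; star_term_encode b]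
  | TStar a => GenTree.Node 1 [:: star_term_encode a]
  end.

Fixpoint star_term_decode (t : GenTree.tree K) : option (star_term K) :=
  match t with
  | GenTree.Leaf k => Some (TVar k)
  | GenTree.Node n [:: a; b] =>
      match star_term_decode a, star_term_decode b with
      | Some a, Some b => Some (if n is m.+2 then TLin m a b else TMul a b)
      | _, _ => None
      end
  | GenTree.Node n [:: a] => omap (@TStar K) (star_term_decode a)
  | _ => None
  end.

Lemma star_term_encodeK : pcancel star_term_encode star_term_decode.
Proof. by elim=> //= [n a -> b ->|a -> b ->|a ->]. Qed.

HB.instance Definition _ := Countable.copy (star_term K) (pcan_type star_term_encodeK).

End StarTermCount.

Section GeneratedSubalgebra.
Variables (R : realType) (C : cstarAlgType R) (K : countType) (gen : K -> C) (q : nat -> R[i]).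
Hypothesis dq : forall z (e : R), 0 < e -> exists i, cabs (z - q i) < e.

Fixpoint term_eval (t : star_term K) : C :=
  match t with
  | TVar k => gen k
  | TLin n a b => q n *: term_eval a + term_eval b
  | TMul a b => term_eval a ** term_eval b
  | TStar a => star (term_eval a)
  end.

(* Only ensures that the generated subalgebra contains [0]. *)
Variable k0 : K.

Definition generated (x : C) := exists t : nat -> star_term K, (fun n => term_eval (t n)) @ \oo --> x.

Lemma cvg_coeff z : exists i : nat -> nat, (fun m => q (i m) : R[i]^o) @ \oo --> (z : R[i]^o).
Proof.
have /choice[i hi] : forall m, exists i, cabs (z - q i) < 2^-1 ^+ m.
  by move=> m; apply: dq; rewrite exprn_gt0.
exists i; apply/(@cvg_nmP _ R[i]^o) => e /half_pow_small[N Ne]; exists N => // m /= Nm.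
apply: (lt_trans (hi m)); apply: le_lt_trans Ne.
by rewrite ler_wiXn2l ?invr_ge0 ?invf_le1 ?ler1n.
Qed.

Lemma generatedP c x y : generated x -> generated y -> generated (c *: x + y).
Proof.
move=> [s sx] [t ty]; have [i ic] := cvg_coeff c.
exists (fun n => TLin (i n) (s n) (t n)) => /=.
by apply: cvgD => //; exact: cvgZ.
Qed.

Lemma generatedM x y : generated x -> generated y -> generated (x ** y).
Proof. by move=> [s sx] [t ty]; exists (fun n => TMul (s n) (t n)); exact: cvg_amul. Qed.

Lemma generatedS x : generated x -> generated (star x).
Proof. by move=> [s sx]; exists (fun n => TStar (s n)); exact: cvg_star. Qed.

Lemma generated_eval t : generated (term_eval t).
Proof. by exists (fun _ => t); exact: cvg_cst. Qed.

Lemma generated0 : generated 0.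
Proof.
rewrite -(_ : (-1) *: gen k0 + gen k0 = 0); last by rewrite scaleN1r addNr.
by apply: generatedP; exact: (generated_eval (TVar k0)).
Qed.

Definition generated_sub : starSub C :=
  StarSub generated0 generatedP generatedM generatedS.

Lemma closed_generated : closed [set x | generated_sub x].
Proof.
move=> x cx.
have /choice[t ht] : forall n, exists t, nm (x - term_eval t) < 2^-1 ^+ n.
  move=> n; have p0 : 0 < 2^-1 ^+ n / 2 :> R by rewrite divr_gt0// exprn_gt0.
  have [y [t /cvg_nmP/(_ _ p0)[N _ /(_ N (leqnn N)) hN]] xy] := closure_nm cx p0.
  exists (t N); apply: (le_lt_trans (nm_tri y _ _)); move: hN xy => /=; lra.
exists t; apply/cvg_nmP => e /half_pow_small[N Ne]; exists N => // n /= Nn.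
apply: (lt_le_trans (ht n)); apply: le_trans (ltW Ne).
by rewrite ler_wiXn2l ?invr_ge0 ?invf_le1 ?ler1n.
Qed.

Definition generated_alg := closed_sub closed_generated.
HB.instance Definition _ := CStarAlgebra.on generated_alg.

Lemma separable_generated : separable_set [set: generated_alg].
Proof.
pose f t : generated_alg := mksub (generated_eval t : generated_sub _).
exists (range f); first exact: sub_countable (card_image_le _ _) (countableP _).
split=> // x _; have [t tx] := subalgP (x : subalg generated_sub).
move=> B /nbhs_ballP[e /= e0 eB]; have eE := ge0_complexE (ltW e0).
have re0 : 0 < complex.Re e by rewrite -ltr0C -eE.
move/cvg_nmP: tx => /(_ _ re0)[N _ /(_ N (leqnn N)) hN].
exists (f (t N)); split; first by exists (t N).
by apply: eB; rewrite -ball_normE /= normE eE ltcR nm_closed_sub.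
Qed.

End GeneratedSubalgebra.

(* As [rho] is a homomorphism, all the *-polynomial relations between the [gen k]
   and constant sequences pass to the [rho (gen k)]. *)
Theorem seqalg_reindex_family (R : realType) (E : cstarAlgType R) (K : countType)
    (gen : K -> seqalg (seqalg E)) (k0 : K) :
  exists (S : starSub (seqalg (seqalg E))) (rho : subalg S -> seqalg E),
  [/\ closed [set x | S x], forall k, S (gen k), star_hom rho
    & forall (x : subalg S) y, val x = cst_seq y -> rho x = y].
Proof.
have [q dq] := dense_complex R.
have sep := separable_generated gen dq k0.
pose A := generated_alg gen dq k0; pose S := generated_sub gen dq k0.
pose v (x : A) : seqalg (seqalg E) := val (x : subalg S).
have hv : star_hom v by exact: subval_star_hom.
pose D := [set x : A | exists y, v x = cst_seq y].
have /choice[y hy] : forall x : A, exists y, D x -> v x = cst_seq y.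
  move=> x; have [[y xy]|nD] := pselect (D x); first by exists y.
  by exists 0.
have D0 : D 0 by exists 0; rewrite (star_hom0 hv) (star_hom0 (@cst_seq_star_hom _ _)).
have [rho [hrho rhoE]] := seqalg_reindex sep hv D0 hy.
exists S, rho; split=> //.
- exact: closed_generated.
- by move=> k; exact: (generated_eval gen q (TVar k)).
move=> x z xz; have Dx : D x by exists z.
have zy : cst_seq (y x) = cst_seq z by rewrite -xz; exact: esym (hy x Dx).
rewrite (rhoE x Dx).
apply: nm_eq => e e0; suff : nm (cst_seq (y x - z)) <= 0.
  by move=> /nm_etaP/(_ e e0)[N _ /(_ N (leqnn N))]; rewrite /= add0r.
by rewrite (star_homB (@cst_seq_star_hom _ _)) zy subrr nm0.
Qed.

(** A covariant representation in which [U g a] stands for the product of the image of [a] by the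
    unitary of [g]. Only the product is recorded, as the unitary need not lie in the algebra. *)
Definition covariant (R : realType) (G : topologicalGroupType) (A C : starAlgType R)
    (act : G -> A -> A) (U : G -> A -> C) : Prop :=
  [/\ forall g (k : R[i]) a b, U g (k *: a + b) = k *: U g a + U g b,
      forall g h a b, U g a ** U h b = U (g * h)%g (a ** act g b)
    & forall g a, star (U g a) = U (g^-1)%g (act (g^-1)%g (star a))].

Lemma covariant_star_hom (R : realType) (G : topologicalGroupType) (A C : starAlgType R)
    (act : G -> A -> A) (U : G -> A -> C) :
  covariant act U -> (forall a, act 1%g a = a) -> star_hom (U 1%g).
Proof.
move=> [UL UM US] act1; split=> [k a b|a b|a]; first exact: UL.
- by rewrite UM mulg1 act1.
- by rewrite US invg1 act1.
Qed.

(** Reduces to the homomorphism [U 1], because [U g a ** star (U g a)] is [U 1 (a ** star a)]. *)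
Lemma covariant_nm (R : realType) (G : topologicalGroupType) (A C : cstarAlgType R)
    (alpha : action G A) (U : G -> A -> C) : covariant alpha U ->
  forall g a, nm (U g a) <= nm a.
Proof.
move=> cU g a; have h1 := covariant_star_hom cU (act1 alpha); have [_ UM US] := cU.
rewrite -(@ler_pXn2r _ 2) ?nnegrE ?nm_ge0// -!nm_cstarr US UM mulgV -actM mulgV act1.
exact: nm_contractive.
Qed.

Section CovariantSeqalg.
Variables (R : realType) (G : topologicalGroupType) (A C : cstarAlgType R).
Variables (alpha : action G A) (U : G -> A -> C).
Hypothesis cU : covariant alpha U.

Let U0 g : U g 0 = 0.
Proof.
have [UL _ _] := cU; apply: (addrI (U g 0)); rewrite addr0.
by have := UL g 1 0 0; rewrite !scale1r addr0.
Qed.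

Let UB g a b : U g (a - b) = U g a - U g b.
Proof. by have [UL _ _] := cU; rewrite addrC -scaleN1r UL scaleN1r addrC. Qed.

Lemma covariant_linf g (a : subalg (linf A)) : linf C (fun m => U g (val a m)).
Proof.
have /linf_nmP[M hM] := subalgP a; apply/linf_nmP; exists M => m.
exact: le_trans (covariant_nm cU g _) (hM m).
Qed.

(** Entrywise application gives a meaning to e_g u_g when e_g is only an element of the sequence
    algebra. *)
Definition covariant_inf g (x : seqalg A) : seqalg C := eta (mksub (covariant_linf g (qrep x))).

Lemma covariant_infE g (a : subalg (linf A)) :
  covariant_inf g (eta a) = eta (mksub (covariant_linf g a)).
Proof.
apply/eta_eqP => e e0; have /eta_eqP/(_ e e0) := eta_qrep (eta a).
apply: filterS => n; apply: le_trans.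
by rewrite /= -UB; exact: (covariant_nm cU).
Qed.

Lemma covariant_inf_cst g a : covariant_inf g (cst_seq a) = cst_seq (U g a).
Proof. by rewrite covariant_infE; congr eta; exact/val_inj. Qed.

Lemma covariant_infP : covariant (alpha_inf alpha) covariant_inf.
Proof.
have [UL UM US] := cU; have hA := @eta_star_hom R A; have hC := @eta_star_hom R C.
split=> [g k|g h|g].
- elim/seqW=> a; elim/seqW=> b; rewrite -(star_homP hA) !covariant_infE -(star_homP hC).
  by congr eta; apply/val_inj/funext => n; exact: UL.
- elim/seqW=> a; elim/seqW=> b.
  rewrite /alpha_inf seqalg_mapE -(star_homM hA) !covariant_infE -(star_homM hC).
  by congr eta; apply/val_inj/funext => n; exact: UM.
- elim/seqW=> a; rewrite -(star_homS hA) /alpha_inf seqalg_mapE !covariant_infE -(star_homS hC).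
  by congr eta; apply/val_inj/funext => n; exact: US.
Qed.

End CovariantSeqalg.

Lemma finite_hausdorff_continuous (T : topologicalType) (S : topologicalType) (f : T -> S) :
  finite_set [set: T] -> hausdorff_space T -> continuous f.
Proof.
move=> finT hT x B /nbhs_singleton Bfx.
have /closed_openC : closed ([set: T] `\ x).
  apply: (accessible_finite_set_closed.1 (hausdorff_accessible hT)).
  exact: sub_finite_set finT.
have -> : ~` ([set: T] `\ x) = [set x].
  apply/seteqP; split=> y /= => [h|-> [_]]; last exact.
  by apply: contrapT => yx; apply: h; split.
move=> ox; have nx : nbhs x [set x] by apply: open_nbhs_nbhs; split.
by apply: filterS nx => y ->.
Qed.

Section FiniteGroup.
Variables (R : realType) (G : topologicalGroupType) (A : cstarAlgType R).
Variables (alpha : action G A) (finG : finite_set [set: G]) (hG : hausdorff_space G).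
Local Notation enumG := (finmap.enum_fset (fset_set [set: G])).

Lemma enumG_mem (g : G) : g \in enumG.
Proof. by rewrite in_fset_set// inE. Qed.

Lemma enumG_uniq : uniq enumG.
Proof. exact: finmap.fset_uniq. Qed.

Section Units.
Variable X : rokhlin_lift alpha.

Let delta (g h : G) : R := (h == g)%:R.

Let cdelta g : continuous (delta g).
Proof. exact: finite_hausdorff_continuous. Qed.

Let e g : seqalg A := X (mksub (continuous_complex (@cdelta g))).

Let eE g a : e g ** cst_seq a = tensor X (delta g) a.
Proof. by rewrite (tensorE X a (@cdelta g)). Qed.

Lemma unit_comm g a : e g ** cst_seq a = cst_seq a ** e g.
Proof. exact: rl_comm. Qed.

Lemma unit_star g a : star (e g) ** cst_seq a = e g ** cst_seq a.
Proof.
rewrite -rl_star; congr (X _ ** _); apply/val_inj/funext => h /=.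
by apply/CrealP; rewrite complex_real.
Qed.

Lemma unit_mul g h a : e g ** e h ** cst_seq a = if g == h then e g ** cst_seq a else 0.
Proof.
rewrite -rl_mul; case: eqP => [<-|gh].
  congr (X _ ** _); apply/val_inj/funext => t.
  change ((delta g t)%:C * (delta g t)%:C = (delta g t)%:C).
  by rewrite -rmorphM /delta mulr_natl mulrb; case: (t == g).
rewrite -(tensor0l X a) (tensorE X a (@cst_continuous _ _ (0 : R))).
congr (X _ ** _); apply/val_inj/funext => t.
change ((delta g t)%:C * (delta h t)%:C = 0%:C :> R[i]).
rewrite -rmorphM /delta; case: (eqVneq t g) => [tg|_]; last by rewrite mul0r.
by case: eqP => [th|_]; [case: gh; rewrite -tg -th|rewrite mulr0].
Qed.

Lemma unit_act g h a : alpha_inf alpha h (e g) ** cst_seq a = e (h * g)%g ** cst_seq a.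
Proof.
rewrite -rl_act; congr (X _ ** _); apply/val_inj/funext => t /=.
by rewrite /delta (can2_eq (mulVKg h) (mulKg h)).
Qed.

Lemma unit_sum a : \sum_(g <- enumG) e g ** cst_seq a = cst_seq a.
Proof.
under eq_bigr do rewrite eE.
rewrite -(tensor_fsum X) -?[RHS](tensor1 X)//; congr tensor; apply/funext => h.
rewrite (bigD1_seq h) ?enumG_mem ?enumG_uniq//= /delta eqxx big1 ?addr0// => g.
by rewrite eq_sym => /negbTE ->.
Qed.

Variables (C : cstarAlgType R) (U : G -> A -> C).
Hypothesis cU : covariant alpha U.

Let W g := covariant_inf cU g (e g).

(** With W_g = e_g u_g, the product W_g^* W_h contains e_g e_h and vanishes unless [g = h], when it
    becomes the translate e_1 of e_g. In the last sum each term reduces to e_h a u_g, and the e_h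
    sum to one on [A]. *)
Lemma covariant_units_relations : exists W : G -> seqalg C,
  [/\ forall g h a, star (W g) ** W h ** cst_seq (U 1%g a) =
        if g == h then W 1%g ** cst_seq (U 1%g a) else 0,
      forall a, W 1%g ** cst_seq (U 1%g a) = cst_seq (U 1%g a) ** W 1%g,
      forall g a, W g ** W 1%g ** cst_seq (U 1%g a) = W g ** cst_seq (U 1%g a)
    & forall g a, \sum_(h <- enumG) W h ** cst_seq (U 1%g (alpha (h^-1)%g a)) **
        star (W (g^-1 * h)%g) = cst_seq (U g a)].
Proof.
have [UL UM US] := covariant_infP cU.
have hi g : star_hom (alpha_inf alpha g) by exact: seqalg_map_star_hom.
have iM g h x : alpha_inf alpha g (alpha_inf alpha h x) = alpha_inf alpha (g * h)%g x.
  elim/seqW: x => x; rewrite /alpha_inf !seqalg_mapE; congr eta.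
  by apply/val_inj/funext => n /=; rewrite actM.
have i1 x : alpha_inf alpha 1%g x = x.
  elim/seqW: x => x; rewrite /alpha_inf !seqalg_mapE; congr eta.
  by apply/val_inj/funext => n /=; rewrite act1.
have ic g a : alpha_inf alpha g (cst_seq a) = cst_seq (alpha g a).
  by rewrite /alpha_inf seqalg_map_cst.
have U0 g : covariant_inf cU g 0 = 0.
  apply: (addrI (covariant_inf cU g 0)); rewrite addr0.
  by have := UL g 1 0 0; rewrite !scale1r addr0.
have U_sum g (F : G -> seqalg A) :
    covariant_inf cU g (\sum_(h <- enumG) F h) = \sum_(h <- enumG) covariant_inf cU g (F h).
  elim: enumG => [|h l IH]; first by rewrite !big_nil.
  by rewrite !big_cons -IH -[F h]scale1r UL !scale1r.
exists W; split.
- move=> g h a; rewrite -(covariant_inf_cst cU) /W US !UM -iM -!(star_homM (hi _)) ic.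
  rewrite -(amulA (star _)) unit_comm amulA unit_star -amulA -unit_comm amulA unit_mul.
  rewrite i1 !mulg1; case: eqP => [<-|_]; last by rewrite (star_hom0 (hi _)) U0.
  by rewrite (star_homM (hi _)) ic unit_act mulVg -actM mulVg act1.
- by move=> a; rewrite -(covariant_inf_cst cU) /W !UM !i1 unit_comm.
- move=> g a; rewrite -(covariant_inf_cst cU) /W !UM !mulg1 ic.
  by rewrite -amulA unit_act mulg1 amulA unit_mul eqxx.
- move=> g a; rewrite -[RHS](covariant_inf_cst cU) -(unit_sum a) U_sum; apply: eq_bigr => h _.
  rewrite -(covariant_inf_cst cU) /W US !UM !mulg1 ic -actM mulgV act1 iM.
  rewrite invgM invgK mulVKg -amulA (star_homS (hi _)); congr covariant_inf.
  rewrite (_ : cst_seq a ** _ = e h ** cst_seq a) ?amulA ?unit_mul ?eqxx//.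
  rewrite -[LHS]starK starM starK -(star_homS (@cst_seq_star_hom R A)) unit_act mulVKg.
  by rewrite unit_comm starM -(star_homS (@cst_seq_star_hom R A)) starK unit_star.
Qed.

End Units.

(** The relations are brought back by reindexing a separable algebra. It is generated by the [W g]
    and the constant sequences over a dense sequence of [A]; being closed, it contains those over
    all of [A]. *)
Theorem covariant_units (X : rokhlin_lift alpha) (E : cstarAlgType R) (U : G -> A -> seqalg E) :
  separable_set [set: A] -> covariant alpha U ->
  exists V : G -> seqalg E,
  [/\ forall g h a, star (V g) ** V h ** U 1%g a = if g == h then V 1%g ** U 1%g a else 0,
      forall a, V 1%g ** U 1%g a = U 1%g a ** V 1%g,
      forall g a, V g ** V 1%g ** U 1%g a = V g ** U 1%g a
    & forall g a, \sum_(h <- enumG) V h ** U 1%g (alpha (h^-1)%g a) **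
        star (V (g^-1 * h)%g) = U g a].
Proof.
move=> sepA cU; have [W [W1 W2 W3 W4]] := covariant_units_relations X cU.
have [s [ds _]] := dense_seq (D := setT) sepA I.
pose gen (k : nat + nat) := match k with
  | inl j => W (nth 1%g enumG j) | inr i => cst_seq (U 1%g (s i)) end.
have [S [rho [clS Sgen hrho rhoc]]] := seqalg_reindex_family gen (inl 0%N).
have hv : star_hom (val : subalg S -> _) := subval_star_hom S.
have SW g : S (W g).
  have := Sgen (inl (index g enumG)); by rewrite /= nth_index// enumG_mem.
have SU a : S (cst_seq (U 1%g a)).
  have hU : star_hom (fun a => cst_seq (U 1%g a)).
    have h1 := covariant_star_hom cU (act1 alpha); have h2 := @cst_seq_star_hom R (seqalg E).
    by split=> [k x y|x y|x]; rewrite ?(star_homP h1) ?(star_homM h1) ?(star_homS h1)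
      ?(star_homP h2) ?(star_homM h2) ?(star_homS h2).
  apply: clS => B /nbhs_ballP[e /= e0 eB]; have eE := ge0_complexE (ltW e0).
  have re0 : 0 < complex.Re e by rewrite -ltr0C -eE.
  have [i hi] := ds a _ re0.
  exists (cst_seq (U 1%g (s i))); split; first exact: (Sgen (inr i)).
  apply: eB; rewrite -ball_normE /= normE eE ltcR -(star_homB hU).
  exact: le_lt_trans (nm_contractive hU _) hi.
pose w g := mksub (SW g); pose p a := mksub (SU a).
have rp a : rho (p a) = U 1%g a by exact: rhoc.
have vw g : val (w g) = W g by [].
have vp a : val (p a) = cst_seq (U 1%g a) by [].
exists (fun g => rho (w g)); split=> [g h a|a|g a|g a].
- rewrite -!rp -(star_homS hrho) -!(star_homM hrho).
  have -> : star (w g) ** w h ** p a = if g == h then w 1%g ** p a else 0.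
    by apply/val_inj; rewrite !(star_homM hv) (star_homS hv) vw vp W1; case: eqP.
  by case: eqP => // _; rewrite (star_hom0 hrho).
- rewrite -!rp -!(star_homM hrho); congr rho.
  by apply/val_inj; rewrite !(star_homM hv) W2.
- rewrite -!rp -!(star_homM hrho); congr rho.
  by apply/val_inj; rewrite !(star_homM hv) W3.
- pose x := \sum_(h <- enumG) w h ** p (alpha (h^-1)%g a) ** star (w (g^-1 * h)%g).
  rewrite -[RHS](rhoc x); last first.
    rewrite (star_hom_sum hv) -W4; apply: eq_bigr => h _.
    by rewrite !(star_homM hv) (star_homS hv).
  rewrite (star_hom_sum hrho); apply: eq_bigr => h _.
  by rewrite !(star_homM hrho) (star_homS hrho) rp.
Qed.

End FiniteGroup.

Section CrossedProduct.
Variables (R : realType) (G : topologicalGroupType) (A : cstarAlgType R).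
Variables (alpha : action G A) (finG : finite_set [set: G]).
Local Notation P := (crossed_product alpha finG).
Local Notation enumG := (finmap.enum_fset (fset_set [set: G])).
Let hal g : star_hom (alpha g) := act_star_hom alpha g.

Lemma sum_enumG_div (V : nmodType) (F : G -> V) h :
  \sum_(t <- enumG) F t = \sum_(k <- enumG) F (h * k^-1)%g.
Proof.
rewrite -(big_map (fun k => (h * k^-1)%g) xpredT F); apply: perm_big.
have inj : injective (fun k : G => (h * k^-1)%g) by move=> x y /(can_inj (mulKg h))/invg_inj.
apply: uniq_perm; rewrite ?map_inj_uniq ?enumG_uniq// => x.
rewrite enumG_mem//; apply/esym/mapP; exists (x^-1 * h)%g; first exact: enumG_mem.
by rewrite invgM invgK mulVKg.
Qed.

Section Amplify.
Variables (H B : cstarAlgType R) (mu : G -> G -> H -> B) (theta : A -> H).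
Hypothesis htheta : star_hom theta.
Hypothesis muL : forall g h (k : R[i]) (z w : H),
  mu g h (k *: z + w) = k *: mu g h z + mu g h w.
Hypothesis muM : forall g h h' k (z w : H),
  mu g h z ** mu h' k w = if h == h' then mu g k (z ** w) else 0.
Hypothesis muS : forall g h (z : H), star (mu g h z) = mu h g (star z).
Hypothesis mu_le : forall g h (z : H), nm (mu g h z) <= nm z.

(** The regular representation: its matrix entry at [h], [k] is the translate by [h^-1] of
    [f (h * k^-1)], here mapped by [theta] and placed by the matrix units [mu h k]. *)
Definition amplify (f : P) : B := \sum_(h <- enumG) \sum_(k <- enumG)
  mu h k (theta (alpha (h^-1)%g (f (h * k^-1)%g))).

Lemma mu_sum g h (F : G -> H) :
  \sum_(t <- enumG) mu g h (F t) = mu g h (\sum_(t <- enumG) F t).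
Proof.
have mu0 : mu g h 0 = 0.
  apply: (addrI (mu g h 0)); rewrite addr0.
  by have := muL g h 1 0 0; rewrite !scale1r addr0.
elim: enumG => [|t l IH]; first by rewrite !big_nil mu0.
by rewrite !big_cons IH -[mu g h (F t)]scale1r -muL scale1r.
Qed.

Lemma amplify_star_hom : star_hom amplify.
Proof.
split=> [k f f'|f f'|f].
- rewrite /amplify scaler_sumr -big_split; apply: eq_bigr => h _ /=.
  rewrite scaler_sumr -big_split; apply: eq_bigr => t _ /=.
  by rewrite -muL -(star_homP htheta) -(star_homP (hal _)).
- rewrite /amplify amul_suml; apply: eq_bigr => h _.
  rewrite amul_suml; under [RHS]eq_bigr do rewrite amul_sumr.
  under [RHS]eq_bigr => t _.
    rewrite (bigD1_seq t) ?enumG_mem ?enumG_uniq//= [X in _ + X]big1 ?addr0; last first.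
      move=> t' tt'; rewrite amul_sumr big1// => s _.
      by rewrite muM eq_sym (negbTE tt').
    rewrite amul_sumr; under eq_bigr => s _ do rewrite muM eqxx -(star_homM htheta).
    over.
  rewrite exchange_big /=; apply: eq_bigr => s _.
  rewrite mu_sum -(star_hom_sum htheta); congr (mu _ _ (theta _)).
  rewrite [(f ** f') _]/(convolution f f' _) /convolution sum_groupE//.
  rewrite [X in alpha _ X](_ : _ = \sum_(t <- enumG)
      f (h * t^-1)%g ** alpha (h * t^-1)%g (f' ((h * t^-1)^-1 * (h * s^-1))%g)); last first.
    exact: (sum_enumG_div (fun t => f t ** alpha t (f' (t^-1 * (h * s^-1))%g))).
  rewrite (star_hom_sum (hal _)); apply: eq_bigr => t _.
  rewrite (star_homM (hal _)) -actM invgM invgK !mulgA mulVg mul1g.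
  by rewrite -(mulgA t) mulVg mulg1.
- rewrite /amplify star_sum; under [RHS]eq_bigr do rewrite star_sum.
  rewrite [RHS]exchange_big /=; apply: eq_bigr => h _; apply: eq_bigr => t _.
  rewrite muS -(star_homS htheta) -(star_homS (hal _)).
  rewrite [star f _]/(convolution_star f _) /convolution_star -actM.
  by rewrite invgM invgK mulgA mulVg mul1g.
Qed.

Lemma amplify_le f : nm (amplify f) <= \sum_(h <- enumG) \sum_(k <- enumG) nm (f (h * k^-1)%g).
Proof.
apply: (le_trans (nm_sum _ _ _)); apply: ler_sum => h _.
apply: (le_trans (nm_sum _ _ _)); apply: ler_sum => k _.
apply: (le_trans (mu_le _ _ _)); apply: (le_trans (nm_contractive htheta _)).
exact: nm_contractive.
Qed.

End Amplify.

Definition crossed_unit (g : G) (a : A) : P := fun s => if s == g then a else 0.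

Lemma covariant_crossed_unit : covariant alpha crossed_unit.
Proof.
split=> [g k a b|g h a b|g a]; apply/funext => s.
- rewrite -[RHS]/(k *: (if s == g then a else 0) + (if s == g then b else 0)).
  by rewrite /crossed_unit; case: eqP => // _; rewrite scaler0 addr0.
- rewrite -[LHS]/(convolution (crossed_unit g a) (crossed_unit h b) s) /convolution sum_groupE// /crossed_unit.
  rewrite (bigD1_seq g) ?enumG_mem ?enumG_uniq//= eqxx big1 ?addr0; last first.
    by move=> t /negbTE ->; rewrite amul0l.
  rewrite (can2_eq (mulVKg g) (mulKg g)).
  by case: eqP => // _; rewrite (star_hom0 (hal _)) amul0r.
- rewrite -[LHS]/(convolution_star (crossed_unit g a) s) /convolution_star /crossed_unit.
  rewrite (can2_eq invgK invgK); case: eqP => [->//|_].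
  by rewrite star0 (star_hom0 (hal _)).
Qed.

Lemma crossed_unit_sum (f : P) : f = \sum_(g <- enumG) crossed_unit g (f g).
Proof.
apply/funext => s.
have -> : (\sum_(g <- enumG) crossed_unit g (f g)) s = \sum_(g <- enumG) crossed_unit g (f g) s.
  by elim: enumG => [|g l IH]; rewrite ?big_nil// !big_cons -IH.
rewrite (bigD1_seq s) ?enumG_mem ?enumG_uniq//= /crossed_unit eqxx big1 ?addr0// => g.
by rewrite eq_sym => /negbTE ->.
Qed.

Lemma covariant_comp (C : cstarAlgType R) (psi : P -> C) : star_hom psi ->
  covariant alpha (fun g a => psi (crossed_unit g a)).
Proof.
move=> hpsi; have [UL UM US] := covariant_crossed_unit.
by split=> [g k a b|g h a b|g a]; rewrite ?UL -?US ?(star_homP hpsi) -?(star_homM hpsi) ?UM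
  ?(star_homS hpsi).
Qed.

End CrossedProduct.

(** * Coordinate truncations and lifting through a hereditary subalgebra *)

Section Truncation.
Variables (R : realType) (E : cstarAlgType R) (k : nat).
Implicit Types b x y : linf_alg E.

Lemma trunc_bounded b : linf E (fun n => if n == k then ev n b else 0).
Proof.
have /linf_nmP[M hM] := subalgP (b : subalg (linf E)); apply/linf_nmP; exists `|M| => n.
case: ifP => _; last by rewrite nm0.
exact: le_trans (hM n) (ler_norm M).
Qed.

Definition trunc b : linf_alg E := mksub (trunc_bounded b).

Lemma ev_trunc n b : ev n (trunc b) = if n == k then ev n b else 0.
Proof. by []. Qed.

Lemma trunc_star_hom : star_hom trunc.
Proof.
split=> [c x y|x y|x]; apply: ev_inj => n;
  rewrite ?(star_homP (ev_star_hom _ _)) ?(star_homM (ev_star_hom _ _))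
    ?(star_homS (ev_star_hom _ _)) !ev_trunc.
- by rewrite (star_homP (@ev_star_hom _ E n)); case: eqP => //; rewrite scaler0 addr0.
- by rewrite (star_homM (@ev_star_hom _ E n)); case: eqP => //; rewrite amul0l.
- by rewrite (star_homS (@ev_star_hom _ E n)); case: eqP => //; rewrite star0.
Qed.

Lemma trunc_sandwich x b y : x ** trunc b ** y = trunc (x ** b ** y).
Proof.
apply: ev_inj => n; have h := @ev_star_hom _ E n.
rewrite !(star_homM h) !ev_trunc !(star_homM h); case: eqP => // _.
by rewrite amul0r amul0l.
Qed.

Lemma nm_trunc b : nm (trunc b) <= nm (ev k b).
Proof.
apply/nm_linf_algP; first exact: nm_ge0.
by move=> n; rewrite ev_trunc; case: eqP => [->//|_]; rewrite nm0 nm_ge0.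
Qed.

End Truncation.

Lemma star_hom_sandwich (R : realType) (A B : starAlgType R) (f : A -> B) : star_hom f ->
  forall x (k : R[i]) b y, f (x ** (k *: b) ** y) = k *: (f x ** f b ** f y).
Proof.
by move=> hf x k b y; rewrite !(star_homM hf) (star_homZ hf) amulZr amulZl.
Qed.

Section SliceLift.
Variables (R : realType) (A B C : cstarAlgType R) (q : B -> C) (c : B) (t : nat -> B -> B).
Variables (rho : A -> C) (k : R[i]) (r : A -> B).
Hypothesis sc : star c = c.
Hypothesis hq : star_hom q.
Hypothesis ht : forall j, star_hom (t j).
Hypothesis tE : forall j x b y, x ** t j b ** y = t j (x ** b ** y).
Hypothesis tnull : forall x, q x = 0 ->
  forall e : R, 0 < e -> \forall j \near \oo, nm (t j x) <= e.
Hypothesis hrho : star_hom rho.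
Hypothesis qr : forall a, q (c ** (k *: r a) ** c) = rho a.
Local Notation H := (hereditary_alg sc).
Let v (z : H) : B := val (z : subalg (hereditary_sub sc)).
Let hv : star_hom v := subval_star_hom _.
Let comp x := c ** (k *: x) ** c.

Definition slice j x : H := mksub (hereditary_sandwich c (k *: t j x) : hereditary_sub sc _).

Lemma val_slice j x : v (slice j x) = t j (comp x).
Proof. by rewrite /comp -tE (star_homZ (ht j)). Qed.

Lemma slice_bounded x : linf H (slice^~ x).
Proof.
apply/linf_nmP; exists (nm (comp x)) => j; rewrite nm_closed_sub -/(v _) val_slice.
exact: nm_contractive.
Qed.

Definition slice_lift x : seqalg H := eta (mksub (slice_bounded x)).

Lemma slice_null (z : nat -> H) x : q x = 0 -> (forall j, v (z j) = t j x) ->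
  forall e : R, 0 < e -> \forall j \near \oo, nm (z j) <= e.
Proof.
move=> qx vz e e0; apply: filterS (tnull qx e0) => j.
by rewrite nm_closed_sub -/(v _) vz.
Qed.

Lemma slice_lift_star_hom : star_hom (fun a => slice_lift (r a)).
Proof.
have hH := @eta_star_hom R H; have qc a : q (comp (r a)) = rho a := qr a.
split=> [z a b|a b|a].
- rewrite -(star_homP hH); apply/eta_eqP.
  apply: (@slice_null _ (comp (r (z *: a + b)) - (z *: comp (r a) + comp (r b)))).
    by rewrite (star_homB hq) (star_homP hq) !qc (star_homP hrho) subrr.
  move=> j; rewrite (star_homB (ht j)) (star_homP (ht j)) -!val_slice.
  by rewrite -(star_homP hv) -(star_homB hv).
- rewrite -(star_homM hH); apply/eta_eqP.
  apply: (@slice_null _ (comp (r (a ** b)) - comp (r a) ** comp (r b))).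
    by rewrite (star_homB hq) (star_homM hq (comp _)) !qc (star_homM hrho) subrr.
  move=> j; rewrite (star_homB (ht j)) (star_homM (ht j) (comp _)) -!val_slice.
  by rewrite -(star_homM hv) -(star_homB hv).
- rewrite -(star_homS hH); apply/eta_eqP.
  apply: (@slice_null _ (comp (r (star a)) - star (comp (r a)))).
    by rewrite (star_homB hq) (star_homS hq) !qc (star_homS hrho) subrr.
  move=> j; rewrite (star_homB (ht j)) (star_homS (ht j)) -!val_slice.
  by rewrite -(star_homS hv) -(star_homB hv).
Qed.

End SliceLift.

Theorem crossed_product_weakly_semiprojective (R : realType) (G : topologicalGroupType)
    (A : cstarAlgType R) (alpha : action G A) (finG : finite_set [set: G]) :
  hausdorff_space G -> rokhlin_lift alpha -> separable_set [set: A] ->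
  weakly_semiprojective A -> weakly_semiprojective (crossed_product alpha finG).
Proof.
move=> hG X sepA wspA E psi hpsi.
set U := fun g a => psi (crossed_unit alpha finG g a).
have cU : covariant alpha U by exact: covariant_comp.
have [V [V1 V2 V3 V4]] := covariant_units finG hG X sepA cU.
have hU := covariant_star_hom cU (act1 alpha).
set u := U 1%g in V1 V2 V3 V4 hU.
have uVs b : u b ** star (V 1%g) = star (V 1%g) ** u b.
  by apply: (can_inj (@starK _ _)); rewrite !starM !starK -(star_homS hU) V2.
(* On the elements [u a], [V 1], its adjoint and [star (V 1) ** V 1] all act alike: [V 1] behaves as
   a projection there. *)
have Vsu a : star (V 1%g) ** u a = V 1%g ** u a.
  have := V1 1%g 1%g a; rewrite eqxx => <-; rewrite -amulA V2 amulA -uVs.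
  have := congr1 star (V1 1%g 1%g (star a)).
  by rewrite eqxx !starM starK -(star_homS hU) starK amulA => ->.
pose rho a := V 1%g ** u a.
have hrho : star_hom rho.
  rewrite /rho; split=> [k a b|a b|a].
  - by rewrite (star_homP hU) amulDr amulZr.
  - have -> : V 1%g ** u a ** (V 1%g ** u b) = V 1%g ** (u a ** V 1%g) ** u b by nc_ring.
    by rewrite -V2 (amulA (V 1%g)) V3 (star_homM hU) amulA.
  - by rewrite (star_homS hU) starM -(star_homS hU) uVs Vsu.
have Vrho g a : V g ** u a = V g ** rho a by rewrite /rho amulA V3.
pose q : linf_alg E -> seqalg E := @eta R E.
have hq : star_hom q := eta_linf_alg_star_hom E.
pose y g : linf_alg E := qrep (V g).
have qy g : q (y g) = V g := eta_qrep (V g).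
pose Z g a := V g ** u a.
have yZ g a : q (y g) ** Z 1%g a = Z g a by rewrite qy /Z amulA V3.
have ysZ g h a : q (star (y g)) ** Z h a = if g == h then Z 1%g a else 0.
  by rewrite (star_homS hq) qy /Z amulA V1.
pose enumG := finmap.enum_fset (fset_set [set: G]).
pose l := [seq g <- enumG | g != 1%g].
have ul : uniq (1%g :: l) by rewrite /= mem_filter eqxx /= filter_uniq// enumG_uniq.
have memL g : g \in 1%g :: l by rewrite inE mem_filter enumG_mem// andbT orbN.
have [c [xi [kappa [sc k0 xiE xiZ cZ]]]] := matrix_unit_lift hq yZ ysZ ul.
have {}xiZ g a : q (xi g) ** rho a = kappa%:C *: (V g ** u a) := xiZ g a (memL g).
have {}cZ a : q c ** rho a = kappa%:C *: rho a := cZ a.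
have [mu [muL muM muS mu_le muE]] := matrix_amplification sc xiE.
pose H : cstarAlgType R := hereditary_alg sc.
(* Compensates the factor [kappa] contributed by [c], or by some [xi g], on each side of a
   sandwich. *)
pose kk : R[i] := (kappa ^- 2)%:C.
have kkK (x : seqalg E) : kk *: (kappa%:C *: (kappa%:C *: x)) = x.
  rewrite !scalerA -!rmorphM (_ : _ * kappa * kappa = 1) ?rmorph1 ?scale1r//.
  by field; rewrite gt_eqF.
pose r a : linf_alg E := qrep (rho a).
have qr a : q (r a) = rho a := eta_qrep (rho a).
have qcomp a : q (c ** (kk *: r a) ** c) = rho a.
  have rc : rho a ** q c = kappa%:C *: rho a.
    rewrite -[LHS]starK starM -(star_homS hq) sc -(star_homS hrho) cZ starZ.
    by rewrite (star_homS hrho) starK conj_Creal// complex_real.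
  by rewrite (star_hom_sandwich hq) qr -amulA rc amulZr cZ kkK.
have tE j (x b y : linf_alg E) : x ** trunc j b ** y = trunc j (x ** b ** y) := trunc_sandwich j x b y.
have tnull x : q x = 0 -> forall e : R, 0 < e -> \forall j \near \oo, nm (trunc j x) <= e.
  move=> qx e e0; have /eta_eqP/(_ e e0) : eta (x : subalg (linf E)) = eta 0.
    by rewrite -/(q x) qx (star_hom0 (@eta_star_hom R E)).
  apply: filterS => j; rewrite subr0; apply: le_trans.
  exact: nm_trunc.
have ht j := trunc_star_hom E j.
have htau := slice_lift_star_hom sc hq ht tE tnull hrho qcomp.
have [th hth thE] := wspA H _ htau.
pose theta n a : H := val (th a) n.
have htheta n : star_hom (theta n).
  rewrite /theta; split=> [k a b|a b|a].
  - by rewrite (star_homP hth).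
  - by rewrite (star_homM hth).
  - by rewrite (star_homS hth).
have muL' g h (k : R[i]) (z w : H) : mu g h (k *: z + w) = k *: mu g h z + mu g h w.
  exact: muL.
have muM' g h h' k (z w : H) : mu g h z ** mu h' k w = if h == h' then mu g k (z ** w) else 0.
  exact: muM.
have muS' g h (z : H) : star (mu g h z) = mu h g (star z) by exact: muS.
have mu_le' g h (z : H) : nm (mu g h z) <= nm z by exact: mu_le.
have hamp n := amplify_star_hom alpha finG (htheta n) muL' muM' muS'.
(* The diagonal: coordinate [n] of the [n]-th amplification, as the [n]-th slice carries only
   coordinate [n]. *)
pose Theta0 (f : crossed_product alpha finG) n := ev n (amplify mu (theta n) f).
have bTheta f : linf E (Theta0 f).
  apply/linf_nmP; eexists => n; apply: (le_trans (nm_contractive (ev_star_hom E n) _)).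
  exact: (amplify_le (htheta n) mu_le').
exists (fun f => mksub (bTheta f)).
  split=> [k f f'|f f'|f]; apply/val_inj/funext => n; have he := @ev_star_hom _ E n.
  - by rewrite /= /Theta0 (star_homP (hamp n)) (star_homP he).
  - by rewrite /= /Theta0 (star_homM (hamp n)) (star_homM he).
  - by rewrite /= /Theta0 (star_homS (hamp n)) (star_homS he).
have bt h k x : linf E (fun n => ev n (mu h k (theta n x))).
  apply/linf_nmP; exists (nm x) => n; apply: (le_trans (nm_contractive (ev_star_hom E n) _)).
  exact: le_trans (mu_le' _ _ _) (nm_contractive (htheta n) _).
have btE h k x : eta (mksub (bt h k x)) = V h ** u x ** star (V k).
  pose z : linf_alg E := xi h ** (kk *: r x) ** star (xi k).
  have <- : q z = V h ** u x ** star (V k).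
    have e1 : rho x ** star (q (xi k)) = kappa%:C *: (u x ** star (V k)).
      rewrite -[LHS]starK starM starK -(star_homS hrho) xiZ starZ starM.
      by rewrite -(star_homS hU) starK conj_Creal// complex_real.
    rewrite (star_hom_sandwich hq) qr (star_homS hq).
    by rewrite xiZ Vrho amulZl -amulA e1 !amulZr kkK amulA -Vrho.
  (* By [thE], [theta n x] differs from the [n]-th slice of [r x] by a null sequence. On that slice
     [mu h k] is explicit and has the coordinate [n] of [z]. *)
  apply/eta_eqP => e e0; have /eta_eqP/(_ e e0) := congr1 (@^~ x) thE.
  apply: filterS => n; apply: le_trans.
  suff : nm (ev n (mu h k (theta n x)) - ev n z) <= nm (theta n x - slice (@trunc R E) kk sc n (r x)) by [].
  have -> : ev n z = ev n (mu h k (slice (@trunc R E) kk sc n (r x))).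
    by rewrite (muE _ _ _ (kk *: trunc n (r x)))// -(star_homZ (ht n)) trunc_sandwich ev_trunc eqxx.
  rewrite -(star_homB (@ev_star_hom _ E n)); apply: (le_trans (nm_contractive (ev_star_hom E n) _)).
  have -> : mu h k (theta n x) - mu h k (slice (@trunc R E) kk sc n (r x)) = mu h k (theta n x - slice (@trunc R E) kk sc n (r x)).
    by rewrite addrC -scaleN1r -muL' scaleN1r addrC.
  exact: mu_le'.
apply/funext => f /=.
have -> : mksub (bTheta f) = \sum_(h <- enumG) \sum_(k <- enumG)
    mksub (bt h k (alpha (h^-1)%g (f (h * k^-1)%g))).
  apply/val_inj/funext => n.
  have hvn : star_hom (fun b : subalg (linf E) => val b n) by split.
  rewrite (star_hom_sum hvn) /= /Theta0 /amplify (star_hom_sum (ev_star_hom E n)).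
  apply: eq_bigr => h _; rewrite (star_hom_sum hvn) (star_hom_sum (ev_star_hom E n)).
  by apply: eq_bigr.
have hE := @eta_star_hom R E.
(* Both sides become double sums of [V h ** u _ ** star (V k)]; on the right [V4] has
   [k = g^-1 * h], that is, [g = h * k^-1]. *)
rewrite (star_hom_sum hE) [in RHS](crossed_unit_sum f) (star_hom_sum hpsi).
under [RHS]eq_bigr do rewrite -/(U _ _) -V4.
rewrite [RHS]exchange_big /=; apply: eq_bigr => h _.
rewrite (star_hom_sum hE) [RHS](sum_enumG_div finG _ h); apply: eq_bigr => k _.
by rewrite btE invgM invgK -mulgA mulVg mulg1.
Qed.

Theorem proposition4p19 (R : realType) (G : topologicalGroupType)
    (A : cstarAlgType R) (alpha : action G A) :
  compact [set: G] -> hausdorff_space G -> @second_countable G ->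
  separable_set [set: A] -> Rokhlin_property alpha ->
  [/\ seqalg_extendible (val : subalg (fixed_points alpha) -> A),
      weakly_semiprojective A ->
        weakly_semiprojective (subalg (fixed_points alpha))
    & forall finG : finite_set [set: G],
        weakly_semiprojective A ->
        weakly_semiprojective (crossed_product alpha finG)].
Proof.
move=> cG hG _ sepA rok; have ext := fixed_points_extendible cG sepA rok.
split=> // [wspA B psi hpsi|finG]; last first.
  have [X _] := rokhlin_lift_exists cG sepA rok.
  exact: crossed_product_weakly_semiprojective.
have [rho hrho psiE] := ext B psi hpsi; have [phi hphi phiE] := wspA B rho hrho.
have hv := @subval_star_hom R A (fixed_points alpha).
exists (phi \o val); last by rewrite psiE -phiE.
split=> [c x y|x y|x].
- exact: etrans (congr1 phi (star_homP hv c x y)) (star_homP hphi _ _ _).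
- exact: etrans (congr1 phi (star_homM hv x y)) (star_homM hphi _ _).
- exact: etrans (congr1 phi (star_homS hv x)) (star_homS hphi _).
Qed.
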